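(* Let $V=\bigoplus_{i\in\mathbb{Z}}V^i$ be a graded vector space over $\mathbf{k}$, let $\mathfrak{C}_{\mathrm{Lie}}(V)=\mathrm{Hom}(\overline{S}(V),V)$, $\mathfrak{C}_{\mathrm{RB}}(V)=\mathrm{Hom}(\overline{S}(V),V)$ and $\mathfrak{C}_{\mathrm{RBA}_{(\mu,\lambda)}}(V)=s\mathfrak{C}_{\mathrm{Lie}}(V)\oplus\mathfrak{C}_{\mathrm{RB}}(V)$. There exists an $L_\infty[1]$-algebra structure $\{l_i\}_{i\ge1}$ on $\mathfrak{C}_{\mathrm{RBA}_{(\mu,\lambda)}}(V)$ given as follows. For homogeneous $f\in\mathrm{Hom}(S^{n+1}(V),V)\subseteq\mathfrak{C}_{\mathrm{Lie}}(V)$, $g\in\mathrm{Hom}(S^{m+1}(V),V)\subseteq\mathfrak{C}_{\mathrm{Lie}}(V)$ and $\xi_j\in\mathrm{Hom}(S^{m_j+1}(V),V)\subseteq\mathfrak{C}_{\mathrm{RB}}(V)$, $1\le j\le i-1$, $$l_1(sf)=-A_nf,\qquad l_2(sf,sg)=(-1)^{|f|}s[f,g]_{\mathrm{NR}},$$ and for $i\ge2$ $$l_i(sf,\xi_1,\dots,\xi_{i-1})=-\sum_{\tau\in\mathrm{Sh}(m_1+1,\dots,m_{i-1}+1,n+2-i)}\varepsilon(\tau)A_{n-i+1}\big(f(\xi_1\otimes\cdots\otimes\xi_{i-1}\otimes\mathrm{Id}^{\otimes n+2-i})\big)\tau^{-1}$$ $$-\sum_{k=1}^{i-1}\sum_{\tau\in\mathrm{Sh}(m_1+1,\dots,\widehat{m_k+1},\dots,m_{i-1}+1,n+3-i,m_k)}\varepsilon(\tau)(-1)^{(|f|+\sum_{j=1}^{k-1}|\xi_j|)|\xi_k|}B_{n-i+3}\,\xi_k\big(f(\xi_1\otimes\cdots\otimes\widehat{\xi_k}\otimes\cdots\otimes\xi_{i-1}\otimes\mathrm{Id}^{\otimes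 n+3-i})\otimes\mathrm{Id}^{\otimes m_k}\big)\tau^{-1},$$ where a hat means omission; all components of $\{l_i\}_{i\ge1}$ other than $l_1(sf)$, $l_2(sf,sg)$, $l_i(sf,\xi_1,\dots,\xi_{i-1})$ for $i\ge2$, and those obtained from these components by graded symmetry, vanish.
   Context: $\mathbf{k}$ is a field of characteristic $0$, $\mu,\lambda\in\mathbf{k}$, and $\mathbf{k}$ contains a square root $t=\sqrt{\mu^2-4\lambda}$. Constants: $B_n=\frac1t\big((\frac{\mu+t}{2})^n-(\frac{\mu-t}{2})^n\big)$ read formally as a polynomial in $\mu,\lambda$: $B_0=0$, $B_1=1$, $B_{n+1}=\mu B_n-\lambda B_{n-1}$; $A_n=\lambda B_n$ for $n\ge0$, and $A_{-1}=-1$. $S^n(V)$ is the $n$-th graded symmetric power, $\overline S(V)=\bigoplus_{n\ge1}S^n(V)$. For a homogeneous linear map $f$, $|f|$ is its degree as a map of graded spaces; $(sW)^n=W^{n+1}$, so $sf$ has degree $|f|-1$. The Koszul sign $\varepsilon(\sigma)=\varepsilon(\sigma;v_1,\dots,v_n)$ is defined by $v_1\odot\cdots\odot v_n=\varepsilon(\sigma)v_{\sigma(1)}\odot\cdots\odot v_{\sigma(n)}$ in $S(V)$. $\mathrm{Sh}(i_1,\dots,i_r)$ is the set of permutations increasing on consecutive blocks of sizes $i_1,\dots,i_r$; sums with a negative block size are zero. $(F\tau^{-1})(v_1,\dots,v_N)=F(v_{\tau(1)},\dots,v_{\tau(N)})$, and $\varepsilon(\tau)$ is computed on the arguments $v_1,\dots,v_N$.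 Tensor products of homogeneous maps are evaluated with the usual Koszul rule $(\alpha\otimes\beta)(u\otimes v)=(-1)^{|\beta||u|}\alpha(u)\otimes\beta(v)$. Graded Nijenhuis-Richardson bracket: for $P\in\mathrm{Hom}(S^{p+1}(V),V)$, $Q\in\mathrm{Hom}(S^{q+1}(V),V)$, $[P,Q]_{\mathrm{NR}}=P\bar\circ Q-(-1)^{|P||Q|}Q\bar\circ P$, where $(P\bar\circ Q)(v_1,\dots,v_{p+q+1})=\sum_{\sigma\in\mathrm{Sh}(q+1,p)}\varepsilon(\sigma)P(Q(v_{\sigma(1)},\dots,v_{\sigma(q+1)}),v_{\sigma(q+2)},\dots,v_{\sigma(p+q+1)})$. An $L_\infty[1]$-algebra is a graded vector space $L$ with maps $l_n:L^{\otimes n}\to L$, $n\ge1$, of degree $1$ such that $l_n(x_{\sigma(1)},\dots,x_{\sigma(n)})=\varepsilon(\sigma)l_n(x_1,\dots,x_n)$ and $\sum_{i=1}^n\sum_{\sigma\in\mathrm{Sh}(i,n-i)}\varepsilon(\sigma)l_{n-i+1}(l_i(x_{\sigma(1)},\dots,x_{\sigma(i)}),x_{\sigma(i+1)},\dots,x_{\sigma(n)})=0$ for all homogeneous $x_j$. *)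

(* Defs.v *)
From HB Require Import structures.
From mathcomp Require Import all_boot all_order all_algebra all_fingroup.
From mathcomp Require Import boolp functions.

Set Implicit Arguments.
Unset Strict Implicit.
Unset Printing Implicit Defensive.

Import GRing.Theory Num.Theory.
Local Open Scope ring_scope.

(** Internal direct sum decomposition [V = (+)_(d : int) V^d], where [h d v]
    means [v \in V^d]. *)
Definition is_grading (K : fieldType) (V : lmodType K) (h : int -> V -> Prop) :=
  [/\ forall d, h d 0,
      forall d a u v, h d u -> h d v -> h d (a *: u + v),
      forall v, exists (s : seq int) (w : int -> V),
        [/\ uniq s, forall d, h d (w d) & v = \sum_(d <- s) w d]
    & forall (s : seq int) (w : int -> V), uniq s -> (forall d, h d (w d)) ->
        \sum_(d <- s) w d = 0 -> forall d, d \in s -> w d = 0].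

Record gvect (K : fieldType) := GVect {
  gcar :> lmodType K;
  gdeg : int -> gcar -> Prop;
  gdegP : is_grading gdeg }.

Arguments gdeg {K g}.

Lemma sum_uniq_ext (V : nmodType) (s s' : seq int) (w : int -> V) :
  uniq s -> uniq s' -> {subset s <= s'} ->
  \sum_(d <- s') (if d \in s then w d else 0) = \sum_(d <- s) w d.
Proof.
move=> us us' ss; rewrite -big_mkcond /= -big_filter; apply: perm_big.
apply: uniq_perm => //; first exact: filter_uniq.
by move=> d; rewrite mem_filter; case: (boolP (d \in s)) => // /ss.
Qed.

Lemma homog_spanD (K : fieldType) (V : lmodType K) (h : int -> V -> Prop)
    (a : K) (s1 s2 : seq int) (w1 w2 : int -> V) :
  (forall d, h d 0) ->
  (forall d a u v, h d u -> h d v -> h d (a *: u + v)) ->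
  uniq s1 -> uniq s2 -> (forall d, h d (w1 d)) -> (forall d, h d (w2 d)) ->
  exists (s : seq int) (w : int -> V), [/\ uniq s, forall d, h d (w d)
    & a *: \sum_(d <- s1) w1 d + \sum_(d <- s2) w2 d = \sum_(d <- s) w d].
Proof.
move=> h0 hZ u1 u2 h1 h2; exists (undup (s1 ++ s2)).
exists (fun d => a *: (if d \in s1 then w1 d else 0)
                 + (if d \in s2 then w2 d else 0)); split.
- exact: undup_uniq.
- by move=> d; apply: hZ; case: ifP.
- rewrite big_split /= -scaler_sumr !sum_uniq_ext ?undup_uniq // => d ds;
    by rewrite mem_undup mem_cat ds ?orbT.
Qed.

(** [(s W)^d = W^(d+1)] with the same underlying vector space, so the element
    written [sf] is [f] itself. *)
Definition shift_deg (K : fieldType) (W : gvect K) (d : int) (w : W) : Prop :=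
  gdeg (d + 1) w.

Lemma shift_degP (K : fieldType) (W : gvect K) : is_grading (@shift_deg K W).
Proof.
have [h0 hZ hs hi] := gdegP W; rewrite /shift_deg; split.
- by move=> d; apply: h0.
- by move=> d a u v; apply: hZ.
- move=> v; have [s [w [us hw ->]]] := hs v.
  exists [seq d - 1 | d <- s], (fun d => w (d + 1)); split=> [|d|].
  + by rewrite map_inj_uniq //; apply: addIr.
  + exact: hw.
  + by rewrite big_map; apply: eq_bigr => d _; rewrite subrK.
- move=> s w us hw e d ds.
  have := hi [seq x + 1 | x <- s] (fun x => w (x - 1)).
  rewrite map_inj_uniq; last exact: addIr.
  move=> /(_ us) H.
  have {}H : forall x, x \in [seq x + 1 | x <- s] -> w (x - 1) = 0.
    apply: H => [x|]; first by have := hw (x - 1); rewrite subrK.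
    by rewrite big_map -[RHS]e; apply: eq_bigr => x _; rewrite addrK.
  by have := H (d + 1) (map_f _ ds); rewrite addrK.
Qed.

Definition shift (K : fieldType) (W : gvect K) : gvect K :=
  GVect (@shift_degP K W).

Definition dsum_deg (K : fieldType) (W1 W2 : gvect K) (d : int)
  (w : (W1 * W2)%type) : Prop := gdeg d w.1 /\ gdeg d w.2.

Lemma sum_pair (K : fieldType) (W1 W2 : lmodType K) (s : seq int)
    (w : int -> (W1 * W2)%type) :
  \sum_(d <- s) w d = (\sum_(d <- s) (w d).1, \sum_(d <- s) (w d).2).
Proof.
elim: s => [|d s IHs]; first by rewrite !big_nil.
by rewrite !big_cons IHs; case: (w d).
Qed.

Lemma dsum_degP (K : fieldType) (W1 W2 : gvect K) :
  is_grading (@dsum_deg K W1 W2).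
Proof.
have [h0 hZ hs hi] := gdegP W1; have [k0 kZ ks ki] := gdegP W2.
have H0 d : @dsum_deg K W1 W2 d 0 by split.
have HZ d a u v :
    @dsum_deg K W1 W2 d u -> dsum_deg d v -> dsum_deg d (a *: u + v).
  by move=> [u1 u2] [v1 v2]; split; [apply: hZ | apply: kZ].
split=> //.
- move=> [v1 v2]; have [s1 [w1 [us1 hw1 e1]]] := hs v1.
  have [s2 [w2 [us2 hw2 e2]]] := ks v2.
  have A1 d : @dsum_deg K W1 W2 d (w1 d, 0) by split.
  have A2 d : @dsum_deg K W1 W2 d (0, w2 d) by split.
  have [s [w [us hw e]]] := homog_spanD 1 H0 HZ us1 us2 A1 A2.
  exists s, w; split=> //; rewrite -e scale1r !sum_pair /= -e1 -e2 !big1 //.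
  by congr pair; rewrite ?addr0 ?add0r.
- move=> s w us hw; rewrite sum_pair => -[e1 e2] d ds.
  have /= x1 := hi s (fun d => (w d).1) us (fun d => (hw d).1) e1 d ds.
  have /= x2 := ki s (fun d => (w d).2) us (fun d => (hw d).2) e2 d ds.
  by rewrite [w d]surjective_pairing x1 x2.
Qed.

Definition dsum (K : fieldType) (W1 W2 : gvect K) : gvect K :=
  GVect (@dsum_degP K W1 W2).

(** [(v_(sigma 1), ..., v_(sigma n))], with positions numbered from 0. *)
Definition permute (T : nmodType) (n : nat) (sigma : 'S_n) (v : seq T) : seq T :=
  [seq v`_(sigma i) | i : 'I_n].

(** [Sh(i_1, ..., i_r)] for [bs = [:: i_1; ...; i_r]]; empty unless
    [n = i_1 + ... + i_r]. *)
Definition shuffle (bs : seq nat) (n : nat) (sigma : 'S_n) : bool :=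
  (sumn bs == n) &&
  all (sorted ltn) (reshape bs [seq nat_of_ord (sigma i) | i : 'I_n]).

(** The sign with
    [v_1 ... v_n = koszul ds sigma *: v_(sigma 1) ... v_(sigma n)]
    in the graded symmetric algebra, where [ds] lists the degrees of the [v_i]:
    each inverted pair is transposed exactly once. *)
Definition koszul (K : fieldType) (ds : seq int) (n : nat) (sigma : 'S_n) : K :=
  \prod_(p : 'I_n * 'I_n | (p.1 < p.2)%N && (sigma p.2 < sigma p.1)%N)
    (-1) ^ (ds`_(sigma p.1) * ds`_(sigma p.2)).

(** A family of maps [W1^(x n) -> W2], n >= 1, is a function on sequences, the
    n-th map being its restriction to the sequences of size n. *)

Section MultiMaps.
Variables (K : fieldType) (W1 W2 : gvect K).
Implicit Type F : seq W1 -> W2.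

(** [ds] lists degrees of the (homogeneous) entries of [v]. *)
Definition homog (ds : seq int) (v : seq W1) : Prop :=
  size ds = size v /\ forall i, (i < size v)%N -> gdeg ds`_i v`_i.

Definition multilinear F : Prop :=
  forall (s1 s2 : seq W1) (a : K) (x y : W1),
    F (s1 ++ (a *: x + y) :: s2) = a *: F (s1 ++ x :: s2) + F (s1 ++ y :: s2).

Definition gsymmetric F : Prop :=
  forall ds v (sigma : 'S_(size v)), homog ds v ->
    F (permute sigma v) = koszul K ds sigma *: F v.

Definition has_degree (e : int) F : Prop :=
  forall ds v, (0 < size v)%N -> homog ds v -> gdeg (\sum_(d <- ds) d + e) (F v).

End MultiMaps.

(** [L_infty[1]]-structure maps: [l_n] is the restriction of [l] to sequences
    of size [n]; [l [::]] is irrelevant. *)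
Definition is_Linfty1 (K : fieldType) (L : gvect K) (l : seq L -> L) : Prop :=
  [/\ multilinear l, has_degree 1 l, gsymmetric l
    & forall ds x, (0 < size x)%N -> homog ds x ->
      \sum_(1 <= i < (size x).+1)
        \sum_(sigma : 'S_(size x) | shuffle [:: i; (size x - i)%N] sigma)
          koszul K ds sigma *:
            l (l (take i (permute sigma x)) :: drop i (permute sigma x)) = 0].

Section HomS.
Variables (K : fieldType) (V : gvect K).
Implicit Type F : seq V -> V.

(** Degree [d] linear maps [\bar S(V) -> V]. A linear map [S^n(V) -> V] is a
    graded symmetric multilinear map on [V^n]; arity 0 is normalised to 0. *)
Definition homS_homog (d : int) F : Prop :=
  [/\ F [::] = 0, multilinear F, gsymmetric F & has_degree d F].

(** The total space is spanned by the homogeneous maps. No finiteness is imposed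
    on arities: the degree [d] part is the product over n >= 1 of
    [Hom^d(S^n(V), V)]. *)
Definition homS_pred : {pred (seq V -> V)} := fun F =>
  `[< exists (s : seq int) (G : int -> (seq V -> V)),
        [/\ uniq s, forall d, homS_homog d (G d) & F = \sum_(d <- s) G d] >].

Lemma homS_homog0 d : homS_homog d 0.
Proof.
have [h0 _ _ _] := gdegP V; split=> //.
- move=> s1 s2 a x y; rewrite -[LHS]/(0 : V) -[RHS]/(a *: (0 : V) + 0).
  by rewrite scaler0 addr0.
- by move=> ds v sg _; rewrite -[LHS]/(0 : V) -[RHS]/(_ *: (0 : V)) scaler0.
Qed.

Lemma homS_homogZ d a F G :
  homS_homog d F -> homS_homog d G -> homS_homog d (a *: F + G).
Proof.
have [_ hZ _ _] := gdegP V.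
move=> [F0 Fl Fs Fd] [G0 Gl Gs Gd]; split.
- by rewrite -[LHS]/(a *: F [::] + G [::]) F0 G0 scaler0 addr0.
- move=> s1 s2 b x y; rewrite !addrfctE !scalrfctE Fl Gl !scalerDr !scalerA (mulrC a).
  by rewrite addrACA.
- move=> ds v sg hv; rewrite !addrfctE !scalrfctE (Fs ds) // (Gs ds) //.
  by rewrite scalerDr !scalerA mulrC.
- by move=> ds v v0 hv; apply: hZ; [apply: Fd | apply: Gd].
Qed.

Lemma homS_submod_closed : submod_closed homS_pred.
Proof.
split.
  apply/asboolP; exists [::], (fun=> 0); split=> //; last by rewrite big_nil.
  exact: homS_homog0.
move=> a F G /asboolP[s1 [w1 [u1 h1 ->]]] /asboolP[s2 [w2 [u2 h2 ->]]].
apply/asboolP.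
have [s [w [us hw e]]] := homog_spanD a homS_homog0 homS_homogZ u1 u2 h1 h2.
by exists s, w.
Qed.

HB.instance Definition _ :=
  GRing.isSubmodClosed.Build K (seq V -> V) homS_pred homS_submod_closed.

Record homS := HomS { homS_val :> seq V -> V; _ : homS_val \in homS_pred }.

HB.instance Definition _ := [isSub for homS_val].
HB.instance Definition _ := [Choice of homS by <:].
HB.instance Definition _ := [SubChoice_isSubLmodule of homS by <:].

Definition homS_deg (d : int) (f : homS) : Prop := homS_homog d f.

Lemma homS_val_sum (s : seq int) (G : int -> homS) :
  (\sum_(d <- s) G d : homS) = \sum_(d <- s) (G d : seq V -> V) :> (seq V -> V).
Proof. by rewrite -[LHS]/(val _) raddf_sum. Qed.

Lemma sum_fctE (s : seq int) (G : int -> (seq V -> V)) v :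
  (\sum_(d <- s) G d) v = \sum_(d <- s) G d v.
Proof. by elim: s => [|d s IHs]; rewrite ?big_nil // !big_cons -IHs. Qed.

Lemma multilinear_sum F s1 s2 (s : seq int) (w : int -> V) : multilinear F ->
  F (s1 ++ \sum_(d <- s) w d :: s2) = \sum_(d <- s) F (s1 ++ w d :: s2).
Proof.
move=> Fl.
have F0 : F (s1 ++ 0 :: s2) = 0.
  have := Fl s1 s2 1 0 0; rewrite !scale1r addr0 => /eqP.
  by rewrite -subr_eq subrr eq_sym => /eqP.
elim: s => [|d s IHs]; first by rewrite !big_nil.
by rewrite !big_cons -IHs -[w d]scale1r Fl !scale1r.
Qed.

Lemma multilinear_homog0 F : F [::] = 0 -> multilinear F ->
  (forall ds v, (0 < size v)%N -> homog ds v -> F v = 0) -> F = 0.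
Proof.
move=> F0 Fl Fh; apply/funext => v.
have [_ _ hs _] := gdegP V.
suff H v2 : forall ds v1, homog ds v1 -> F (v1 ++ v2) = 0.
  by apply: (H v [::] [::]); split.
elim: v2 => [|x v2 IHv] ds v1 hv1.
  rewrite cats0; case: v1 hv1 => [//|y v1] /Fh; exact.
have [s [w [_ hw ->]]] := hs x; rewrite multilinear_sum // big1 // => d _.
rewrite -cat_rcons; apply: (IHv (rcons ds d)).
case: hv1 => sz hv1; split=> [|i]; first by rewrite !size_rcons sz.
rewrite size_rcons ltnS leq_eqVlt => /predU1P[->|lti].
  by rewrite !nth_rcons sz ltnn eqxx.
by rewrite !nth_rcons sz lti; apply: hv1.
Qed.

Lemma homS_degP : is_grading homS_deg.
Proof.
have [_ _ _ hi] := gdegP V; split.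
- exact: homS_homog0.
- by move=> d a u v; apply: homS_homogZ.
- move=> [F PF]; have /asboolP[s [G [us hG e]]] := PF.
  have PG d : G d \in homS_pred.
    apply/asboolP; exists [:: d], G; split=> //.
    by rewrite big_seq1.
  exists s, (fun d => HomS (PG d)); split=> //.
  by apply/val_inj; rewrite /= homS_val_sum.
- move=> s w us hw e d ds; apply/val_inj => /=.
  have [w0 wl _ _] := hw d; apply: multilinear_homog0 => // es v v0 hv.
  pose c := \sum_(x <- es) x.
  have ex : \sum_(x <- [seq c + x | x <- s]) (w (x - c) : seq V -> V) v = 0.
    have := congr1 (fun f : homS => f v) e; rewrite homS_val_sum sum_fctE /=.
    rewrite big_map => H; rewrite -[RHS]H.
    by apply: eq_bigr => x _; rewrite addrC addKr.
  have := hi _ _ _ _ ex (c + d); rewrite [c + d - c]addrC addKr; apply.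
  + by rewrite map_inj_uniq //; apply: addrI.
  + move=> x; have [_ _ _ wd] := hw (x - c).
    by have := wd es v v0 hv; rewrite -/c addrC subrK.
  + exact: map_f.
Qed.

Definition HomSV : gvect K := GVect homS_degP.

(** [f \in Hom(S^n(V), V)]. *)
Definition arity (n : nat) (f : homS) : Prop := forall v, size v <> n -> f v = 0.

(** [s C_Lie(V) (+) C_RB(V)]. *)
Definition CRBA : gvect K := dsum (shift HomSV) HomSV.

Definition of_sLie (f : homS) : CRBA := (f, 0).
Definition of_RB (xi : homS) : CRBA := (0, xi).
Definition sLie_part (x : CRBA) : homS := x.1.
Definition RB_part (x : CRBA) : homS := x.2.

(** A pure element: [inl f] stands for [sf] and [inr xi] for [xi]. *)
Definition of_pure (z : homS + homS) : CRBA :=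
  match z with inl f => of_sLie f | inr xi => of_RB xi end.
Definition is_sLie (z : homS + homS) : bool := if z is inl _ then true else false.

(** The structure maps are given by their values at homogeneous arguments [v]
    whose degrees are listed in [dv]; multilinearity determines them elsewhere. *)

(** [P \bar\circ Q], for [P] of arity [p+1] and [Q] of arity [q+1]. *)
Definition nr_circ (p : nat) (P : homS) (q : nat) (Q : homS)
    (dv : seq int) (v : seq V) : V :=
  \sum_(sigma : 'S_(size v) | shuffle [:: q.+1; p] sigma)
    koszul K dv sigma *:
      P (Q (take q.+1 (permute sigma v)) :: drop q.+1 (permute sigma v)).

(** [[P, Q]_NR], for [P], [Q] of degrees [dP], [dQ]. *)
Definition nr_bracket (p : nat) (dP : int) (P : homS) (q : nat) (dQ : int)
    (Q : homS) (dv : seq int) (v : seq V) : V :=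
  nr_circ p P q Q dv v - (-1) ^ (dP * dQ) *: nr_circ q Q p P dv v.

(** [(xi_1 (x) ... (x) xi_r (x) Id (x) ... (x) Id)(w)] up to its Koszul sign,
    where [xi_j] takes [bs_j] arguments. *)
Fixpoint tensor_eval (xis : seq homS) (bs : seq nat) (w : seq V) : seq V :=
  match xis, bs with
  | xi :: xis', b :: bs' => xi (take b w) :: tensor_eval xis' bs' (drop b w)
  | _, _ => w
  end.

(** Its Koszul sign, with [es] the degrees of the [xi_j] and [dw] those of the
    arguments: [(a (x) b)(u (x) u') = (-1)^(|b| |u|) a(u) (x) b(u')] applied with
    [a = xi_1] and [b = xi_2 (x) ... (x) xi_r (x) Id (x) ... (x) Id], recursively. *)
Fixpoint tensor_sign (es : seq int) (bs : seq nat) (dw : seq int) : K :=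
  match es, bs with
  | e :: es', b :: bs' =>
      (-1) ^ ((\sum_(d <- es') d) * (\sum_(d <- take b dw) d))
        * tensor_sign es' bs' (drop b dw)
  | _, _ => 1
  end.

Fixpoint Bcoef (mu lam : K) (n : nat) : K :=
  match n with
  | 0 => 0
  | n1.+1 => if n1 is n2.+1 then mu * Bcoef mu lam n1 - lam * Bcoef mu lam n2
             else 1
  end.

(** [A_n]; the only negative index that occurs is -1. *)
Definition Acoef (mu lam : K) (n : int) : K :=
  match n with Posz n => lam * Bcoef mu lam n | Negz _ => -1 end.

Definition omit (T : Type) (k : nat) (s : seq T) : seq T :=
  take k s ++ drop k.+1 s.

Section Mixed.
Variables (mu lam : K) (n : nat) (df : int) (f : homS).
Variables (ms : seq nat) (es : seq int) (xis : seq homS).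
Variables (dv : seq int) (v : seq V).

(** Here [f] has arity [n+1] and degree [df], and [xi_j] has arity [m_j + 1] and
    degree [e_j]. The guards on [i] discard negative block sizes. *)
Let i := (size xis).+1.
Let bs := [seq m.+1 | m <- ms].

Definition mixed_first : V :=
  \sum_(tau : 'S_(size v) |
      (i <= n + 2)%N && shuffle (rcons bs (n + 2 - i)%N) tau)
    let w := permute tau v in
    let dw := permute tau dv in
    (koszul K dv tau * Acoef mu lam (n%:Z - i%:Z + 1) * tensor_sign es bs dw)
      *: f (tensor_eval xis bs w).

(** The summand of index [k], numbered from 0. *)
Definition mixed_second (k : nat) : V :=
  \sum_(tau : 'S_(size v) |
      (i <= n + 3)%N && shuffle (omit k bs ++ [:: (n + 3 - i)%N; ms`_k]) tau)
    let N := (sumn (omit k bs) + (n + 3 - i))%N in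
    let w := permute tau v in
    let dw := permute tau dv in
    (koszul K dv tau
       * (-1) ^ ((df + \sum_(e <- take k es) e) * es`_k)
       * Bcoef mu lam (n + 3 - i)%N
       * tensor_sign (omit k es) (omit k bs) (take N dw))
      *: xis`_k (f (tensor_eval (omit k xis) (omit k bs) (take N w)) :: drop N w).

(** The value at [v] of [l_i(sf, xi_1, ..., xi_(i-1))], [i >= 2]. *)
Definition mixed : V := - mixed_first - \sum_(0 <= k < i.-1) mixed_second k.

End Mixed.

(** The maps on the product over arities are determined by their components on
    the factors [Hom(S^n(V), V)]: the part of [l x] of arity at most [N] depends
    only on the parts of arity at most [N] of the arguments. *)
Definition agree_upto (N : nat) (x y : CRBA) : Prop :=
  forall v, (size v <= N)%N ->
    sLie_part x v = sLie_part y v /\ RB_part x v = RB_part y v.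

Definition arity_continuous (l : seq CRBA -> CRBA) : Prop :=
  forall (N : nat) (xs ys : seq CRBA), size xs = size ys ->
    (forall j, (j < size xs)%N -> agree_upto N xs`_j ys`_j) ->
    agree_upto N (l xs) (l ys).

End HomS.

(* Main.v *)
From mathcomp Require Import all_boot all_order all_algebra all_fingroup ring zify.
From mathcomp Require Import boolp functions.
Require Import Defs.

Set Implicit Arguments.
Unset Strict Implicit.
Unset Printing Implicit Defensive.

Import GRing.Theory Num.Theory.
Local Open Scope ring_scope.

(** Let [R = K[s] / (s^2 - mu s + lam)]; in [R] one has [s^k = B_k s - A_(k-1)], which
    is where the constants come from.  Extend [f] in [C_Lie(V)] multilinearly to
    [V (x) R] and put [y = xi(x) + s x] for [xi] in [C_RB(V)].  Writing
    [F(y) = P + s U] with [P], [U] in [V], the mixed operations are the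
    polarization of [rho = P - (d xi)(U)], and the Lie part is that of
    [- F o F].  Let [D] be the insertion of the operations, [delta] that of
    [U], and [nabla = D + delta], an odd derivation.  Then [nabla y = F(y)],
    and [D F = - F o F] gives [nabla (F(y)) = 0], that is
    [nabla P = nabla U = 0].  The Jacobi identities are [D^2 xi = 0] and
    [D^2 F = 0]; the first follows from [D xi = rho], [nabla P = nabla U = 0]
    and the cancellation of the terms quadratic in the odd [U].

    Polarized expressions are functions of words: products become signed sums over
    splittings of a word, and [F(y)] a sum over set partitions. *)

(** * Koszul signs and splittings of words *)

(** The points [xi(x) + s x] of [V (x) R] form the graph of [xi]. A velocity [P + s U] at such a
    point moves [x] by [U], so the vector field [F] is tangent to the graph exactly when
    [P = (d xi)(U)]. For a binary bracket and linear [xi], up to degree shifts, this reads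
    [xi x, xi y] = xi([xi x, y] + [x, xi y] + mu [x, y]) + lam [x, y], the relation with weights
    [mu] and [lam]. Thus [rho] is the defect of tangency, the velocity at which the graph itself has
    to move in order to follow [F]; moving [xi] by [rho] and [x] by [U] then carries the point [y]
    along [F].

    The obstacle is that Koszul signs need degrees while the arguments are arbitrary vectors, and
    zero has every degree. Hence each letter of a word declares a degree and only its component in
    that degree counts: all expressions become total and multilinear, with signs that depend on the
    declarations alone. Maps and points are letters of one kind, so [D] and [delta] are instances of
    a single insertion operator. Summing over the declared degrees finally gives back functions of
    vectors. *)

Section Sign.
Variable K : fieldType.
Definition sg (d e : int) : K := (-1) ^ (d * e).

Lemma sgDl a b c : sg (a + b) c = sg a c * sg b c.
Proof. by rewrite /sg mulrDl expfzDr // oppr_eq0 oner_eq0. Qed.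

Lemma sgDr a b c : sg a (b + c) = sg a b * sg a c.
Proof. by rewrite /sg mulrDr expfzDr // oppr_eq0 oner_eq0. Qed.

Lemma sgC a b : sg a b = sg b a.
Proof. by rewrite /sg mulrC. Qed.

Lemma sg0 a : sg a 0 = 1.
Proof. by rewrite /sg mulr0 expr0z. Qed.

Lemma sg0l a : sg 0 a = 1.
Proof. by rewrite sgC sg0. Qed.

Lemma sg11 : sg 1 1 = -1.
Proof. by rewrite /sg mulr1 expr1z. Qed.

Lemma sgP a b : sg a b = 1 \/ sg a b = -1.
Proof.
have H n : (-1 : K) ^+ n = 1 \/ (-1 : K) ^+ n = -1.
  by rewrite -signr_odd; case: odd; rewrite ?expr0 ?expr1; auto.
rewrite /sg; case: (a * b) => n; first exact: H.
by rewrite NegzE -exprnN; case: (H n.+1) => ->; rewrite ?invr1 ?invrN1; auto.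
Qed.

Lemma sg_sq a b : sg a b * sg a b = 1.
Proof. by case: (sgP a b) => ->; rewrite ?mulrNN mul1r. Qed.

Lemma sgNr a b : sg a (- b) = sg a b.
Proof.
have := sgDr a b (- b); rewrite subrr sg0; case: (sgP a b) => ->; rewrite ?mul1r //.
by rewrite mulN1r => ->; rewrite opprK.
Qed.

Lemma sgNl a b : sg (- a) b = sg a b.
Proof. by rewrite sgC sgNr sgC. Qed.

End Sign.

(** Every Koszul sign is 1 or -1, so after bilinear expansion an identity of signs is checked by
    cases on the signs of atomic degrees; [sgC] first identifies the two orders of each pair. *)
Ltac sign_cases :=
  rewrite ?(sgDl, sgDr, sgNl, sgNr, sg0, sg0l, sg11);
  repeat match goal with |- context [sg ?K ?a ?b] =>
    rewrite ?(sgC K b a); case: (sgP K a b) => -> end;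
  rewrite ?(mulr1, mul1r, mulrNN, mulrN1, mulN1r, opprK); try done; try ring.

Section Splits.
Variables (K : fieldType) (T : Type) (deg : T -> int).
Local Notation sg := (sg K).

Definition degw (w : seq T) : int := \sum_(t <- w) deg t.

Lemma degw0 : degw [::] = 0. Proof. by rewrite /degw big_nil. Qed.
Lemma degw_cons t w : degw (t :: w) = deg t + degw w.
Proof. by rewrite /degw big_cons. Qed.
Lemma degw1 t : degw [:: t] = deg t. Proof. by rewrite degw_cons degw0 addr0. Qed.
Lemma degw_cat u w : degw (u ++ w) = degw u + degw w.
Proof. by rewrite /degw big_cat. Qed.

(* The sum, with Koszul signs, over all splittings of [w] into two subwords. *)
Fixpoint unsh (U : lmodType K) (w : seq T) (G : seq T -> seq T -> U) : U :=
  if w is t :: w' then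
    unsh w' (fun a b => G (t :: a) b)
    + unsh w' (fun a b => sg (deg t) (degw a) *: G a (t :: b))
  else G [::] [::].

Inductive spl : seq T -> seq T -> seq T -> Prop :=
| spl0 : spl [::] [::] [::]
| spll t w a b : spl w a b -> spl (t :: w) (t :: a) b
| splr t w a b : spl w a b -> spl (t :: w) a (t :: b).

Lemma spl_sum (M : nmodType) (f : T -> M) w a b : spl w a b ->
  \sum_(t <- w) f t = \sum_(t <- a) f t + \sum_(t <- b) f t.
Proof.
elim=> [|t w' a' b' _ IH|t w' a' b' _ IH]; rewrite ?big_nil ?addr0 // !big_cons IH.
  by rewrite addrA.
by rewrite addrCA.
Qed.

Lemma spl_degw w a b : spl w a b -> degw w = degw a + degw b.
Proof. exact: spl_sum. Qed.

Lemma spl_size w a b : spl w a b -> (size w = size a + size b)%N.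
Proof. by elim=> //= t w' a' b' _ ->; rewrite ?addSn ?addnS. Qed.

Lemma spl_count (q : pred T) w a b : spl w a b -> (count q w = count q a + count q b)%N.
Proof.
elim=> //= t w' a' b' _ ->; first by rewrite addnA.
by rewrite addnCA.
Qed.

Section OneTarget.
Variable U : lmodType K.
Implicit Type G : seq T -> seq T -> U.

Lemma eq_unsh w G G' : (forall a b, spl w a b -> G a b = G' a b) -> unsh w G = unsh w G'.
Proof.
elim: w G G' => [|t w IH] G G' e /=; first by apply: e; constructor.
by congr (_ + _); apply: IH => a b s; rewrite e //; constructor.
Qed.

Lemma unsh0 w G : (forall a b, spl w a b -> G a b = 0) -> unsh w G = 0.
Proof.
elim: w G => [|t w IH] G e /=; first by apply: e; constructor.
by rewrite !IH ?addr0 // => a b s; rewrite e ?scaler0 //; constructor.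
Qed.

Lemma unshD w G G' : unsh w (fun a b => G a b + G' a b) = unsh w G + unsh w G'.
Proof.
elim: w G G' => [//|t w IH] G G' /=; rewrite IH addrACA; congr (_ + _).
by rewrite -IH; apply: eq_unsh => a b _; rewrite scalerDr.
Qed.

Lemma unshZ w c G : unsh w (fun a b => c *: G a b) = c *: unsh w G.
Proof.
elim: w G => [//|t w IH] G /=; rewrite IH scalerDr; congr (_ + _).
by rewrite -IH; apply: eq_unsh => a b _; rewrite !scalerA mulrC.
Qed.

Lemma unshN w G : unsh w (fun a b => - G a b) = - unsh w G.
Proof. by rewrite -scaleN1r -unshZ; apply: eq_unsh => a b _; rewrite scaleN1r. Qed.

Lemma unsh_nill w G : (forall t a b, spl w (t :: a) b -> G (t :: a) b = 0) ->
  unsh w G = G [::] w.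
Proof.
elim: w G => [//|t w IH] G e /=; rewrite unsh0 ?add0r.
  rewrite IH ?degw0 ?sg0 ?scale1r // => t' a b s; rewrite e ?scaler0 //.
  by constructor.
by move=> a b s; apply: e; constructor.
Qed.

Lemma unsh_nilr w G : (forall t a b, spl w a (t :: b) -> G a (t :: b) = 0) ->
  unsh w G = G w [::].
Proof.
elim: w G => [//|t w IH] G e /=; rewrite [X in _ + X]unsh0 ?addr0.
  by rewrite IH // => t' a b s; apply: e; constructor.
by move=> a b s; rewrite e ?scaler0 //; constructor.
Qed.

(** Coassociativity of the unshuffle coproduct: both sides run over the splittings of [w] into three
    subwords. With cocommutativity ([unsh_comm]) and the compatibility with concatenation
    ([unsh_cat]) it replaces all handling of permutations in the Jacobi identities. *)
Lemma unsh_assoc w (G : seq T -> seq T -> seq T -> U) :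
  unsh w (fun a b => unsh a (fun a1 a2 => G a1 a2 b))
  = unsh w (fun a b => unsh b (fun b1 b2 => G a b1 b2)).
Proof.
elim: w G => [//|t w IH] G /=; rewrite !unshD -!addrA; congr (_ + _).
  by rewrite IH.
under [in RHS]eq_unsh do rewrite scalerDr -!unshZ.
rewrite unshD -!IH; congr (_ + _); apply: eq_unsh => a b s.
rewrite -unshZ; apply: eq_unsh => a1 a2 s1.
by rewrite (spl_degw s1) sgDr scalerA.
Qed.

Lemma unsh_comm w G : unsh w G = unsh w (fun a b => sg (degw a) (degw b) *: G b a).
Proof.
elim: w G => [|t w IH] G /=; first by rewrite degw0 sg0 scale1r.
rewrite addrC [in LHS]IH [X in _ + X]IH; congr (_ + _); apply: eq_unsh => a b _.
  by rewrite scalerA degw_cons; congr (_ *: _); sign_cases.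
by rewrite scalerA degw_cons; congr (_ *: _); sign_cases.
Qed.

Lemma unsh_swap12 w (G : seq T -> seq T -> seq T -> U) :
  unsh w (fun a b => unsh b (fun b1 b2 => G a b1 b2))
  = unsh w (fun a b => unsh b (fun b1 b2 => sg (degw a) (degw b1) *: G b1 a b2)).
Proof.
by rewrite -!unsh_assoc; apply: eq_unsh => a b _; rewrite unsh_comm.
Qed.

Lemma unsh_cat u w G : unsh (u ++ w) G
  = unsh u (fun a b => unsh w (fun c d => sg (degw b) (degw c) *: G (a ++ c) (b ++ d))).
Proof.
elim: u G => [|t u IH] G /=.
  by apply: eq_unsh => a b _; rewrite degw0 sg0l scale1r.
rewrite !IH; congr (_ + _); apply: eq_unsh => a b _.
rewrite -unshZ; apply: eq_unsh => c d _; rewrite !scalerA degw_cons degw_cat.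
by congr (_ *: _); sign_cases.
Qed.

Lemma unsh_catl u w G :
  (forall a b t c d, spl w (t :: c) d -> G (a ++ t :: c) (b ++ d) = 0) ->
  unsh (u ++ w) G = unsh u (fun a b => G a (b ++ w)).
Proof.
move=> e; rewrite unsh_cat; apply: eq_unsh => a b _.
by rewrite unsh_nill ?degw0 ?sg0 ?scale1r ?cats0 // => t c d s; rewrite e ?scaler0.
Qed.

Lemma unsh_catr u w G :
  (forall a t b c d, spl u a (t :: b) -> G (a ++ c) (t :: b ++ d) = 0) ->
  unsh (u ++ w) G = unsh w (fun c d => G (u ++ c) d).
Proof.
move=> e; rewrite unsh_cat unsh_nilr => [|t a b s].
  by apply: eq_unsh => c d _; rewrite degw0 sg0l scale1r.
by apply: unsh0 => c d s'; rewrite e ?scaler0.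
Qed.

Definition swap (c : seq T -> U) : Prop := forall w1 t t' w2,
  c (w1 ++ t :: t' :: w2) = sg (deg t) (deg t') *: c (w1 ++ t' :: t :: w2).

Lemma degw_swap w1 t t' w2 : degw (w1 ++ t :: t' :: w2) = degw (w1 ++ t' :: t :: w2).
Proof. by rewrite !degw_cat !degw_cons; congr (_ + _); rewrite addrCA. Qed.

(** The coproduct descends from words to the graded symmetric coalgebra. Once the common prefix is
    stripped, the two letters either go to the same subword, where the symmetry of [G] applies, or
    to different ones, and these two terms are exchanged. *)
Lemma unsh_swap G : (forall b, swap (G^~ b)) -> (forall a, swap (G a)) ->
  swap (fun w => unsh w G).
Proof.
move=> G1 G2 w1 t t'; elim: w1 G G1 G2 => [|t0 w1 IH] G G1 G2 w2 /=.
  rewrite !scalerDr -!addrA; congr (_ + _).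
    by rewrite -unshZ; apply: eq_unsh => a b _; rewrite (G1 _ [::]).
  rewrite addrCA; congr (_ + (_ + _)); rewrite -unshZ; apply: eq_unsh => a b _.
  - by rewrite degw_cons scalerA; congr (_ *: _); sign_cases.
  - by rewrite degw_cons scalerA; congr (_ *: _); sign_cases.
  - by rewrite (G2 _ [::]) !scalerA; congr (_ *: _); sign_cases.
rewrite scalerDr; congr (_ + _).
  by apply: IH => [b w w' w''|a]; [exact: (G1 b (t0 :: w)) | exact: G2].
apply: IH => [b w s s' w''|a w s s' w''].
  by rewrite G1 !scalerA degw_swap mulrC.
by rewrite (G2 a (t0 :: w)) !scalerA mulrC.
Qed.

End OneTarget.

Lemma unsh_lin (U U' : lmodType K) (phi : U -> U') w G :
  (forall x y, phi (x + y) = phi x + phi y) -> (forall c x, phi (c *: x) = c *: phi x) ->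
  phi (unsh w G) = unsh w (fun a b => phi (G a b)).
Proof.
move=> pD pZ; elim: w G => [//|t w IH] G /=; rewrite pD !IH.
by congr (_ + _); apply: eq_unsh => a b _; rewrite pZ.
Qed.

Lemma spl_all (q : pred T) w a b : spl w a b -> all q w -> all q a && all q b.
Proof.
elim=> //= t w' a' b' _ IH /andP[-> /IH /andP[-> ->]] //.
Qed.

Lemma unsh_cat_both (U : lmodType K) u w (G : seq T -> seq T -> U) :
  (forall a b t c d, spl w (t :: c) d -> G (a ++ t :: c) (b ++ d) = 0) ->
  (forall a t b d, spl u a (t :: b) -> G a (t :: b ++ d) = 0) ->
  unsh (u ++ w) G = G u w.
Proof.
move=> h1 h2; rewrite unsh_catl // unsh_nilr ?cat0s // => t a b s; exact: h2.
Qed.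

End Splits.
Arguments unsh {K T} deg {U} w G.
Arguments degw {T} deg w.
Arguments swap {K T} deg {U} c.

Lemma degw_map (T T' : Type) (deg : T -> int) (deg' : T' -> int) (f : T -> T') w :
  (forall t, deg' (f t) = deg t) -> degw deg' (map f w) = degw deg w.
Proof. by move=> e; rewrite /degw big_map; apply: eq_bigr => t _; rewrite e. Qed.

Lemma unsh_map (K : fieldType) (T T' : Type) (deg : T -> int) (deg' : T' -> int) (f : T -> T')
    (U : lmodType K) w (G : seq T' -> seq T' -> U) :
  (forall t, deg' (f t) = deg t) ->
  unsh deg' (map f w) G = unsh deg w (fun a b => G (map f a) (map f b)).
Proof.
move=> e; elim: w G => [//|t w IH] G /=; rewrite !IH e; congr (_ + _).
by apply: eq_unsh => a b _; rewrite (degw_map _ e).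
Qed.

Section MoreSplits.
Variables (K : fieldType) (T : Type) (deg : T -> int) (U : lmodType K).

Lemma unsh_cat_skip u w (G : seq T -> seq T -> U) :
  (forall t a b c d, spl u (t :: a) b -> G (t :: a ++ c) (b ++ d) = 0) ->
  unsh deg (u ++ w) G = unsh deg w (fun c d => sg K (degw deg u) (degw deg c) *: G c (u ++ d)).
Proof.
by move=> h; rewrite unsh_cat unsh_nill // => t a b s; rewrite unsh0 // => c d _; rewrite h ?scaler0.
Qed.

Lemma unsh_two s t (G : seq T -> seq T -> U) : unsh deg [:: s; t] G =
  G [:: s; t] [::] + G [:: s] [:: t]
  + (sg K (deg s) (deg t) *: G [:: t] [:: s] + G [::] [:: s; t]).
Proof. by rewrite /= degw0 degw1 !sg0 !scale1r. Qed.

Lemma unsh_extract t0 w (G : seq T -> seq T -> U) : (forall a b, size a <> 1%N -> G a b = 0) ->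
  unsh deg w G = \sum_(0 <= k < size w)
    sg K (deg (nth t0 w k)) (degw deg (take k w)) *: G [:: nth t0 w k] (omit k w).
Proof.
elim: w G => [|t w IH] G h; first by rewrite /= big_nil h.
rewrite [LHS]/= unsh_nill => [|t' a b _]; last by rewrite h.
rewrite big_nat_recl //= /omit ?take0 ?drop0 degw0 sg0 scale1r; congr (_ + _); first by case: (w).
rewrite IH => [|a b sa]; last by rewrite h ?scaler0.
apply: eq_bigr => k _; rewrite degw1 scalerA degw_cons; congr (_ *: _).
by rewrite sgDr mulrC; congr (_ * _); exact: sgC.
Qed.

End MoreSplits.

(** * Homogeneous components and words of declared degrees *)

Section Graded.
Variables (K : fieldType) (W : gvect K).

Lemma gdeg0 d : gdeg d (0 : W).
Proof. by have [h0 _ _ _] := gdegP W. Qed.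

Lemma gdegZD d a (u v : W) : gdeg d u -> gdeg d v -> gdeg d (a *: u + v).
Proof. by have [_ hZ _ _] := gdegP W; apply: hZ. Qed.

Lemma gdegD d (u v : W) : gdeg d u -> gdeg d v -> gdeg d (u + v).
Proof. by rewrite -[u in u + v]scale1r; apply: gdegZD. Qed.

Lemma gdegZ d a (u : W) : gdeg d u -> gdeg d (a *: u).
Proof. by move=> h; rewrite -[_ *: _]addr0; apply: gdegZD => //; apply: gdeg0. Qed.

Lemma gdegN d (u : W) : gdeg d u -> gdeg d (- u).
Proof. by rewrite -scaleN1r; apply: gdegZ. Qed.

Lemma gdec (v : W) : exists sw : seq int * (int -> W),
  [/\ uniq sw.1, forall d, gdeg d (sw.2 d) & v = \sum_(d <- sw.1) sw.2 d].
Proof. by have [_ _ hs _] := gdegP W; have [s [w h]] := hs v; exists (s, w). Qed.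

(** A grading only asserts that a decomposition exists, so one is chosen; [supp v] may list degrees
    whose component is zero. By [comp_unique] the components do not depend on the choice. *)
Definition supp (v : W) : seq int := (projT1 (cid (gdec v))).1.
Definition comp (d : int) (v : W) : W :=
  if d \in supp v then (projT1 (cid (gdec v))).2 d else 0.

Lemma supp_uniq v : uniq (supp v).
Proof. by rewrite /supp; case: cid => sw []. Qed.

Lemma comp_deg d v : gdeg d (comp d v).
Proof.
rewrite /comp; case: ifP => _; last exact: gdeg0.
by case: cid => sw [].
Qed.

Lemma comp_sum v : v = \sum_(d <- supp v) comp d v.
Proof.
have e : v = \sum_(d <- supp v) (projT1 (cid (gdec v))).2 d.
  by rewrite /supp; case: cid => sw [].
by rewrite {1}e; apply: eq_big_seq => d ds; rewrite /comp ds.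
Qed.

Lemma comp_out d v : d \notin supp v -> comp d v = 0.
Proof. by rewrite /comp => /negbTE->. Qed.

Lemma comp_unique (s : seq int) (u : int -> W) v : uniq s -> (forall d, gdeg d (u d)) ->
  v = \sum_(d <- s) u d -> forall d, comp d v = if d \in s then u d else 0.
Proof.
move=> us hu e d; have [_ _ _ hi] := gdegP W.
pose s' := undup (s ++ supp v).
have us' : uniq s' by exact: undup_uniq.
(* The difference of the two decompositions is a homogeneous family with sum zero over a list
   containing both supports, so it vanishes. *)
pose z d := comp d v - (if d \in s then u d else 0).
have hz x : gdeg x (z x).
  by apply: gdegD; [exact: comp_deg | apply: gdegN; case: ifP => _ //; exact: gdeg0].
have z0 : \sum_(x <- s') z x = 0.
  rewrite big_split /= sumrN (@sum_uniq_ext _ s) // => [|x xs]; last first.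
    by rewrite mem_undup mem_cat xs.
  rewrite -e (eq_bigr (fun x => if x \in supp v then comp x v else 0)); last first.
    by move=> x _; case: ifP => // /negbT /comp_out.
  rewrite sum_uniq_ext; [by rewrite -comp_sum subrr|exact: supp_uniq|by []|].
  by move=> x xs; rewrite mem_undup mem_cat xs orbT.
have [ds|] := boolP (d \in s').
  by have /eqP := hi s' z us' hz z0 d ds; rewrite subr_eq0 => /eqP.
rewrite mem_undup mem_cat negb_or => /andP[/negbTE -> /comp_out]; exact.
Qed.

Lemma comp_id d v : gdeg d v -> comp d v = v.
Proof.
move=> hv; rewrite (@comp_unique [:: d] (fun x => if x == d then v else 0)).
- by rewrite mem_head eqxx.
- by [].
- by move=> x; case: eqP => [->|_] //; exact: gdeg0.
- by rewrite big_seq1 eqxx.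
Qed.

Lemma comp_ne d e v : gdeg e v -> e <> d -> comp d v = 0.
Proof.
move=> hv ne; rewrite (@comp_unique [:: e] (fun x => if x == e then v else 0)).
- by rewrite inE; case: eqP => // /esym.
- by [].
- by move=> x; case: eqP => [->|_] //; exact: gdeg0.
- by rewrite big_seq1 eqxx.
Qed.

Lemma comp_comp d v : comp d (comp d v) = comp d v.
Proof. by apply: comp_id; exact: comp_deg. Qed.

Lemma compZD d a u v : comp d (a *: u + v) = a *: comp d u + comp d v.
Proof.
pose s := undup (supp u ++ supp v).
rewrite (@comp_unique s (fun x => a *: comp x u + comp x v)).
- case: ifP => // /negbT; rewrite mem_undup mem_cat negb_or => /andP[h1 h2].
  by rewrite !comp_out // scaler0 addr0.
- exact: undup_uniq.
- by move=> x; apply: gdegZD; exact: comp_deg.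
have ss x : {subset supp x <= s} -> x = \sum_(d <- s) comp d x.
  move=> sx; rewrite {1}(comp_sum x) -(@sum_uniq_ext _ (supp x) s) ?supp_uniq ?undup_uniq //.
  by apply: eq_bigr => y _; case: ifP => // /negbT /comp_out.
rewrite big_split -scaler_sumr /=; congr (_ *: _ + _); apply: ss => x xs;
  by rewrite mem_undup mem_cat xs ?orbT.
Qed.

Lemma comp0 d : comp d 0 = 0.
Proof. by apply: comp_id; exact: gdeg0. Qed.

(* In a word over [int * W] each letter declares a degree; [thom] says that the
   declarations are correct, and [tl] that a map is multilinear and ignores all
   components of a letter but the one in its declared degree. *)
Fixpoint thom (u : seq (int * W)) : Prop :=
  if u is x :: u' then gdeg x.1 x.2 /\ thom u' else True.

Lemma thom_cat u u' : thom u -> thom u' -> thom (u ++ u').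
Proof. by elim: u => //= x u IH [hx /IH h] /h. Qed.

Lemma thom_spl u a b : spl u a b -> thom u -> thom a /\ thom b.
Proof. by elim=> //= x u' a' b' _ IH [hx /IH [? ?]]. Qed.

Section TaggedFun.
Variable U : lmodType K.
Implicit Type c : seq (int * W) -> U.

Definition tml c : Prop := forall u1 d a x y u2,
  c (u1 ++ (d, a *: x + y) :: u2) = a *: c (u1 ++ (d, x) :: u2) + c (u1 ++ (d, y) :: u2).

Definition tl c : Prop := tml c /\ forall u1 d e z u2,
  gdeg e z -> e <> d -> c (u1 ++ (d, z) :: u2) = 0.

Lemma tmlD c u1 d x y u2 : tml c ->
  c (u1 ++ (d, x + y) :: u2) = c (u1 ++ (d, x) :: u2) + c (u1 ++ (d, y) :: u2).
Proof. by move=> h; rewrite -{1}[x]scale1r h scale1r. Qed.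

Lemma tml0 c u1 d u2 : tml c -> c (u1 ++ (d, 0) :: u2) = 0.
Proof. by move=> h; have /eqP := tmlD u1 d 0 0 u2 h; rewrite addr0 eq_sym -subr_eq0 addrK => /eqP. Qed.

Lemma tmlZ c u1 d a x u2 : tml c -> c (u1 ++ (d, a *: x) :: u2) = a *: c (u1 ++ (d, x) :: u2).
Proof. by move=> h; rewrite -[a *: x]addr0 h tml0 // addr0. Qed.

Lemma tml_cons c x : tml c -> tml (fun u => c (x :: u)).
Proof. by move=> h u1; apply: (h (x :: u1)). Qed.

Lemma tl_cons c x : tl c -> tl (fun u => c (x :: u)).
Proof. by case=> h k; split; [exact: tml_cons | move=> u1; apply: (k (x :: u1))]. Qed.

Lemma tl_cat c u : tl c -> tl (fun u' => c (u ++ u')).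
Proof.
case=> h k; split=> [u1 d a x y u2|u1 d e z u2].
  by rewrite !catA h.
by rewrite catA; apply: k.
Qed.

Lemma tl_catr c u : tl c -> tl (fun u' => c (u' ++ u)).
Proof.
case=> h k; split=> [u1 d a x y u2|u1 d e z u2]; rewrite -!catA /=; first exact: h.
exact: k.
Qed.

Lemma tl_scale c a : tl c -> tl (fun u => a *: c u).
Proof.
case=> h k; split=> [u1 d b x y u2|u1 d e z u2 hz ne].
  by rewrite h scalerDr !scalerA mulrC.
by rewrite (k _ _ e) // scaler0.
Qed.

Lemma tl_add c c' : tl c -> tl c' -> tl (fun u => c u + c' u).
Proof.
case=> h k [h' k']; split=> [u1 d b x y u2|u1 d e z u2 hz ne].
  by rewrite h h' scalerDr addrACA.
by rewrite (k _ _ e) // (k' _ _ e) // addr0.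
Qed.

Lemma tl_opp c : tl c -> tl (fun u => - c u).
Proof.
move=> h; have := tl_scale (-1) h.
by rewrite (_ : (fun u => -1 *: c u) = (fun u => - c u)) //; apply/funext => u; rewrite scaleN1r.
Qed.

Local Notation degw := (degw (@fst int W)).

Lemma degw_letter u1 d (x y : W) u2 : degw (u1 ++ (d, x) :: u2) = degw (u1 ++ (d, y) :: u2).
Proof. by rewrite !degw_cat !degw_cons. Qed.

Lemma tl_scalew c e : tl c -> tl (fun u => sg K e (degw u) *: c u).
Proof.
case=> h k; split=> [u1 d b x y u2|u1 d e' z u2 hz ne].
  rewrite h (degw_letter _ _ _ x) (degw_letter _ _ y x).
  by rewrite scalerDr !scalerA [b * _]mulrC.
by rewrite (k _ _ e') // scaler0.
Qed.

Lemma tl_unsh (G : seq (int * W) -> seq (int * W) -> U) :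
  (forall b, tl (G^~ b)) -> (forall a, tl (G a)) -> tl (fun w => unsh (@fst int W) w G).
Proof.
move=> G1 G2; split.
  move=> w1 d a x y; elim: w1 G G1 G2 => [|t w1 IH] G G1 G2 w2 /=.
    rewrite scalerDr addrACA; congr (_ + _); rewrite -unshZ -unshD; apply: eq_unsh => a' b' _.
      by have [h _] := G1 b'; exact: (h [::]).
    by have [h _] := G2 a'; rewrite (h [::]) scalerDr !scalerA mulrC.
  rewrite scalerDr addrACA; congr (_ + _); apply: IH => b'.
  - exact: (tl_cons t (G1 b')).
  - exact: G2.
  - exact: tl_scalew.
  - apply: tl_scale; exact: (tl_cons t (G2 b')).
move=> w1 d e z; elim: w1 G G1 G2 => [|t w1 IH] G G1 G2 w2 hz ne /=.
  rewrite !unsh0 ?addr0 // => a' b' _.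
    by have [_ h] := G2 a'; rewrite (h [::] _ e) ?scaler0.
  by have [_ h] := G1 b'; rewrite (h [::] _ e).
rewrite (IH (fun a b => G (t :: a) b)) ?add0r //.
- apply: (IH (fun a b => sg K t.1 (degw a) *: G a (t :: b))) => // b'.
  + exact: tl_scalew.
  + apply: tl_scale; exact: (tl_cons t (G2 b')).
- by move=> b'; exact: (tl_cons t (G1 b')).
Qed.

(** Graded symmetry of a map is given only at homogeneous arguments, so the exchange is demanded
    only where the declared degrees are correct. The unconditional [swap] becomes available once
    letters are cut down to their declared components, as in [swap_vs]. *)
Definition hswap c : Prop := forall u1 x y u2, thom u1 -> thom [:: x; y] -> thom u2 ->
  c (u1 ++ x :: y :: u2) = sg K x.1 y.1 *: c (u1 ++ y :: x :: u2).

Lemma hswap_cons c x : gdeg x.1 x.2 -> hswap c -> hswap (fun u => c (x :: u)).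
Proof. by move=> hx h u1 y z u2 h1; apply: (h (x :: u1)). Qed.

End TaggedFun.

End Graded.

Notation degt := (degw fst).
Notation unsht := (unsh fst).
Arguments comp {K W} d v.
Arguments supp {K W} v.

Lemma unsh_hd (K : fieldType) (T : Type) (deg : T -> int) (U : gvect K) e w
    (G : seq T -> seq T -> U) :
  (forall a b, spl w a b -> gdeg e (G a b)) -> gdeg e (unsh deg w G).
Proof.
elim: w G => [|t w IH] G h /=; first by apply: h; constructor.
apply: gdegD; apply: IH => a b s; last apply: gdegZ; apply: h; by constructor.
Qed.

Lemma comp_morph (K : fieldType) (W W' : gvect K) (phi : W -> W') (s : int) :
  (forall a u v, phi (a *: u + v) = a *: phi u + phi v) ->
  (forall d v, gdeg d v -> gdeg (d + s) (phi v)) ->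
  forall d v, comp (d + s) (phi v) = phi (comp d v).
Proof.
move=> pl pd d v.
have p0 : phi 0 = 0.
  by have := pl (-1) 0 0; rewrite scaleN1r oppr0 addr0 scaleN1r addNr.
have pD x y : phi (x + y) = phi x + phi y by rewrite -[x]scale1r pl !scale1r.
have phi_sum (r : seq int) (u : int -> W) : phi (\sum_(x <- r) u x) = \sum_(x <- r) phi (u x).
  by elim: r => [|x r IH]; rewrite ?big_nil // !big_cons pD IH.
rewrite (@comp_unique _ _ [seq x + s | x <- supp v] (fun x => phi (comp (x - s) v))).
- rewrite addrK (mem_map (addIr s)).
  by case: ifP => // /negbT /comp_out ->.
- by rewrite map_inj_uniq; [exact: supp_uniq | exact: addIr].
- by move=> x; rewrite -{1}(subrK s x); apply: pd; exact: comp_deg.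
rewrite big_map {1}(comp_sum v) phi_sum.
by apply: eq_bigr => x _; rewrite addrK.
Qed.

(** * Sums over set partitions *)

Section Partitions.
Variables (K : fieldType) (T : Type) (deg : T -> int) (M : gvect K).
Local Notation degw := (degw deg).
Local Notation unshg := (unsh deg).
Local Notation sg := (sg K).
Implicit Type y : seq T -> M.

(** The block of the first letter is split off, and the rest [b] is not a syntactic subword of [w];
    hence the fuel [n]. By [psumn_size] any [n] at least [size w] gives the same value. *)
Fixpoint psumn (U : lmodType K) n y (H : seq (int * M) -> U) (w : seq T) : U :=
  match w, n with
  | [::], _ => H [::]
  | _, 0 => 0
  | t :: w', n'.+1 =>
      unshg w' (fun a b => psumn n' y (fun u => H ((degw (t :: a), y (t :: a)) :: u)) b)
  end.

(* The sum, over the set partitions of [w], of [H] at the values of [y] on the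
   blocks, each block being listed according to its first letter. *)
Definition psum (U : lmodType K) y (H : seq (int * M) -> U) w := psumn (size w) y H w.

Lemma spl_ltr (t : T) w a b n : spl w a b -> (size (t :: w) < n.+1)%N -> (size b < n)%N.
Proof. by move=> s; rewrite ltnS; apply: leq_trans; rewrite /= ltnS (spl_size s) leq_addl. Qed.

Section OneTarget.
Variable U : lmodType K.
Implicit Type H : seq (int * M) -> U.

Lemma psumn_size n m y H w : (size w <= n)%N -> (size w <= m)%N -> psumn n y H w = psumn m y H w.
Proof.
elim: n m H w => [|n IH] [|m] H [|t w] //= h1 h2.
apply: eq_unsh => a b /spl_size e.
have hb : (size b <= size w)%N by rewrite e leq_addl.
by apply: IH; apply: leq_trans hb _.
Qed.

Lemma psum_cons y H t w : psum y H (t :: w) =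
  unshg w (fun a b => psum y (fun u => H ((degw (t :: a), y (t :: a)) :: u)) b).
Proof.
apply: eq_unsh => a b /spl_size e; rewrite /psum; apply: psumn_size => //.
by change (size b <= size w)%N; rewrite e leq_addl.
Qed.

Lemma psum_nil y H : psum y H [::] = H [::]. Proof. by []. Qed.

Lemma eq_psumP (Q : int -> M -> Prop) y H H' w : (forall a, Q (degw a) (y a)) ->
  (forall u, degt u = degw w -> (size u <= size w)%N ->
     (forall i, (i < size u)%N -> Q (nth (0, 0) u i).1 (nth (0, 0) u i).2) -> H u = H' u) ->
  psum y H w = psum y H' w.
Proof.
move=> hy; have [n] := ubnP (size w); elim: n w H H' => // n IH [|t w] H H' hn e.
  by apply: e => //; rewrite !degw0.
rewrite !psum_cons; apply: eq_unsh => a b s.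
apply: IH => [|u du su qu].
  exact: spl_ltr s hn.
apply: e.
- by rewrite [LHS]degw_cons du /= !degw_cons (spl_degw deg s) addrA.
- by rewrite /= ltnS (leq_trans su) // (spl_size s) leq_addl.
- by case=> [|i] /= hi; [exact: hy | exact: qu].
Qed.

Lemma eq_psum y H H' w : (forall u, degt u = degw w -> H u = H' u) -> psum y H w = psum y H' w.
Proof. by move=> e; apply: (@eq_psumP (fun _ _ => True)) => // u du _ _; exact: e. Qed.

Lemma eq_psum_thom y H H' w : (forall a, gdeg (degw a) (y a)) ->
  (forall u, thom u -> degt u = degw w -> H u = H' u) -> psum y H w = psum y H' w.
Proof.
move=> hy e; apply: (@eq_psumP (fun d x => gdeg d x)) => // u du _ qu; apply: e => //.
by elim: u qu {du} => //= x u IH q; split; [exact: (q 0) | apply: IH => i; apply: (q i.+1)].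
Qed.

Lemma eq_psumn n y H H' w : (forall u, H u = H' u) -> psumn n y H w = psumn n y H' w.
Proof.
elim: n H H' w => [|n IH] H H' [|t w] e //=.
by apply: eq_unsh => a b _; apply: IH.
Qed.

Lemma eq_psumn_thom n y H H' w : (forall a, gdeg (degw a) (y a)) ->
  (forall u, thom u -> H u = H' u) -> psumn n y H w = psumn n y H' w.
Proof.
move=> hy; elim: n H H' w => [|n IH] H H' [|t w] e //=; try exact: (e [::] I).
apply: eq_unsh => a b _; apply: IH => u hu; apply: e; split => //; exact: hy.
Qed.

Lemma psumn_Z n y c H w : psumn n y (fun u => c *: H u) w = c *: psumn n y H w.
Proof.
elim: n H w => [|n IH] H [|t w] //=; first by rewrite scaler0.
by rewrite -unshZ; apply: eq_unsh => a b _; apply: IH.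
Qed.

Lemma psumn_D n y H H' w : psumn n y (fun u => H u + H' u) w = psumn n y H w + psumn n y H' w.
Proof.
elim: n H H' w => [|n IH] H H' [|t w] //=; first by rewrite addr0.
by rewrite -unshD; apply: eq_unsh => a b _; apply: IH.
Qed.

Lemma psum_D y H H' w : psum y (fun u => H u + H' u) w = psum y H w + psum y H' w.
Proof.
have [n] := ubnP (size w); elim: n w H H' => // n IH [|t w] H H' hn //.
rewrite !psum_cons -unshD; apply: eq_unsh => a b s; apply: IH.
exact: spl_ltr s hn.
Qed.

Lemma psum_Z y c H w : psum y (fun u => c *: H u) w = c *: psum y H w.
Proof.
have [n] := ubnP (size w); elim: n w H => // n IH [|t w] H hn //.
rewrite !psum_cons -unshZ; apply: eq_unsh => a b s; apply: IH.
exact: spl_ltr s hn.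
Qed.

Lemma psum_0 y w : psum y (fun _ => 0 : U) w = 0.
Proof.
have e : (fun _ => 0 : U) = (fun u : seq (int * M) => 0 *: (0 : U)).
  by apply/funext => u; rewrite scaler0.
by rewrite e psum_Z scale0r.
Qed.

Lemma psum_unsh (T' : Type) (deg' : T' -> int) y w w' (G : seq T' -> seq T' -> seq (int * M) -> U) :
  psum y (fun u => unsh deg' w' (fun a b => G a b u)) w
  = unsh deg' w' (fun a b => psum y (G a b) w).
Proof.
elim: w' G => [//|t w' IH] G /=; rewrite psum_D !IH; congr (_ + _).
by apply: eq_unsh => a b _; rewrite psum_Z.
Qed.

(** Multiplicativity of the exponential: distributing the blocks of a partition of [w] over two
    families amounts to splitting [w] and partitioning both parts. In the induction the block of the
    first letter joins one family or the other. *)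
Lemma psum_mult y (G : seq (int * M) -> seq (int * M) -> U) w :
  psum y (fun u => unsht u G) w = unshg w (fun w1 w2 => psum y (fun u1 => psum y (G u1) w2) w1).
Proof.
have [n] := ubnP (size w); elim: n w G => // n IH [|t w] G hn //.
have hb b a : spl w a b -> (size b < n)%N.
  by move=> s; exact: spl_ltr s hn.
rewrite psum_cons /=; under eq_unsh => a b s do rewrite psum_D !IH ?(hb b a) //.
rewrite unshD; congr (_ + _).
  rewrite -unsh_assoc; apply: eq_unsh => a b s; rewrite psum_cons.
  by apply: eq_unsh.
under [RHS]eq_unsh => a b s.
  under eq_psum => u1 du1 do rewrite psum_cons.
  rewrite psum_unsh -unshZ; over.
rewrite [RHS]unsh_swap12; apply: eq_unsh => a b s; apply: eq_unsh => b1 b2 s'.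
rewrite scalerA -psum_Z; apply: eq_psum => u1 du1.
rewrite psum_Z; congr (_ *: _); rewrite degw_cons du1.
by sign_cases.
Qed.

(** Chain rule for the exponential: the inserted letter stands in front, hence lies in the first
    block, and this block, with the further letters that it absorbs, becomes the derivative of
    [y]. *)
Lemma psum_ins y H (L : seq T -> T) w : tml H -> (forall a, deg (L a) = degw a + 1) ->
  unshg w (fun a b => psum y H (L a :: b)) =
  unshg w (fun a b => psum y (fun u => H ((degw a + 1, unshg a (fun a1 a2 => y (L a1 :: a2))) :: u)) b).
Proof.
move=> hH hL; under eq_unsh => a b s do rewrite psum_cons.
rewrite -unsh_assoc; apply: eq_unsh => a b s.
rewrite (@unsh_lin _ _ _ _ _ (fun z => psum y (fun u => H ((degw a + 1, z) :: u)) b)).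
- by apply: eq_unsh => a1 a2 s'; rewrite degw_cons hL (spl_degw deg s') addrAC.
- by move=> u v; rewrite -psum_D; apply: eq_psum => u' _; rewrite (tmlD [::]).
- by move=> c v; rewrite -psum_Z; apply: eq_psum => u' _; rewrite (tmlZ [::]).
Qed.

Lemma psum_swap y H : tml H -> hswap H -> (forall a, gdeg (degw a) (y a)) ->
  swap deg y -> swap deg (psum y H).
Proof.
move=> hH sH hy sy.
have SZ (G : seq T -> seq T -> U) : (forall b, swap deg (G^~ b)) -> (forall a, swap deg (G a))
  -> swap deg (fun w => unshg w G) by apply: unsh_swap.
(* Both words have the same size, so the exchange can be proved at a fixed fuel, by induction on
   it. *)
suff X n : swap deg (psumn n y H).
  move=> w1 t t' w2; rewrite /psum (X (size (w1 ++ t :: t' :: w2))).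
  by rewrite !size_cat.
elim: n H hH sH => [|n IH] H hH sH [|t0 w1] t t' w2; rewrite ?scaler0 //=; last first.
  apply: (SZ (fun a b => psumn n y (fun u => H ((degw (t0 :: a), y (t0 :: a)) :: u)) b)).
    move=> b u1 s s' u2; rewrite (sy (t0 :: u1)) (degw_swap deg (t0 :: u1)).
    rewrite -psumn_Z; apply: eq_psumn => u; exact: (tmlZ [::]).
  move=> a; apply: IH; first exact: tml_cons.
  by apply: hswap_cons => //; exact: hy.
rewrite scalerDr; congr (_ + _).
  rewrite -unshZ; apply: eq_unsh => a b _; rewrite -psumn_Z; apply: eq_psumn => u.
  by rewrite (sy [::]) (degw_swap deg [::]) (tmlZ [::]).
(* The two letters now lie in different blocks: the two blocks are chosen in the other order and
   exchanged through [sH]. *)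
case: n IH => [|n] IH.
  by rewrite !unsh0 ?scaler0 // => a b _; rewrite scaler0.
rewrite /=; under eq_unsh do rewrite -unshZ.
rewrite unsh_swap12 -unshZ; apply: eq_unsh => a b _; rewrite -!unshZ; apply: eq_unsh => b1 b2 _.
rewrite !scalerA -!psumn_Z; apply: eq_psumn_thom => // u hu.
rewrite (sH [::] (degw (t :: b1), y (t :: b1)) (degw (t' :: a), y (t' :: a))) //=.
  by rewrite scalerA; congr (_ *: _); rewrite !degw_cons; sign_cases.
Qed.

End OneTarget.

Lemma psum_hd (U : gvect K) y (H : seq (int * M) -> U) e w : (forall a, gdeg (degw a) (y a)) ->
  (forall u, thom u -> gdeg (degt u + e) (H u)) -> gdeg (degw w + e) (psum y H w).
Proof.
move=> hy; have [n] := ubnP (size w); elim: n w H e => // n IH [|t w] H e hn hH.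
  by rewrite psum_nil; have := hH [::] I; rewrite !degw0.
rewrite psum_cons; apply: unsh_hd => a b s.
have hb : (size b < n)%N by exact: spl_ltr s hn.
have := IH b (fun u => H ((degw (t :: a), y (t :: a)) :: u)) (degw (t :: a) + e) hb.
rewrite !degw_cons (spl_degw deg s) => h.
have -> : deg t + (degw a + degw b) + e = degw b + (deg t + degw a + e).
  by ring.
apply: h => u hu; have := hH ((deg t + degw a, y (t :: a)) :: u).
rewrite degw_cons /=.
have -> : degt u + (deg t + degw a + e) = deg t + degw a + degt u + e by ring.
by apply; split => //; rewrite -degw_cons; exact: hy.
Qed.
End Partitions.

Section LabelLinear.
Variables (K : fieldType) (W M : gvect K) (U : lmodType K).

Lemma tl_psum (y : seq (int * W) -> M) (H : seq (int * M) -> U) : tml H -> tl y -> tl (psum fst y H).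
Proof.
move=> hH hy.
suff X (n : nat) (H' : seq (int * M) -> U) : tml H' -> tl (psumn fst n y H').
  split=> [u1 d a x z u2|u1 d e z u2 hz ne].
    have [h _] := X (size (u1 ++ (d, x) :: u2)) H hH.
    by have := h u1 d a x z u2; rewrite /psum !size_cat.
  by have [_ h] := X (size (u1 ++ (d, z) :: u2)) H hH; apply: (h _ _ e).
elim: n H' => [|n IH] H' hH'.
  by split=> [[|x u1] d a z z' u2|[|x u1] d e z u2 _ _] //=; rewrite scaler0 addr0.
have S (G : seq (int * W) -> seq (int * W) -> U) :
  (forall b, tl (G^~ b)) -> (forall a, tl (G a)) -> tl (fun w => unsht w G) by apply: tl_unsh.
have Z c (d : int) (z : M) b :
    psumn fst n y (fun u => H' ((d, c *: z) :: u)) b = c *: psumn fst n y (fun u => H' ((d, z) :: u)) b.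
  by rewrite -psumn_Z; apply: eq_psumn => u; exact: (tmlZ [::]).
have D (d : int) (z z' : M) b :
    psumn fst n y (fun u => H' ((d, z + z') :: u)) b
    = psumn fst n y (fun u => H' ((d, z) :: u)) b + psumn fst n y (fun u => H' ((d, z') :: u)) b.
  by rewrite -psumn_D; apply: eq_psumn => u; exact: (tmlD [::]).
have Zr (d : int) b : psumn fst n y (fun u => H' ((d, 0) :: u)) b = 0.
  by rewrite -(scale0r 0) Z scale0r.
case: (hy) => hyl hyv.
have G1 t b : tl (fun a => psumn fst n y (fun u => H' ((degt (t :: a), y (t :: a)) :: u)) b).
  split=> [u1 d a x z u2|u1 d e z u2 hz ne].
    by rewrite !degw_cons !degw_cat !degw_cons (hyl (t :: u1)) D Z.
  by rewrite (hyv (t :: u1) _ e) // Zr.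
have G2 t a : tl (fun b => psumn fst n y (fun u => H' ((degt (t :: a), y (t :: a)) :: u)) b).
  by apply: IH; exact: tml_cons.
split=> [[|t u1] d a x z u2|[|t u1] d e z u2 hz ne] /=.
- rewrite -unshZ -unshD; apply: eq_unsh => a' b' _.
  by rewrite (hyl [::]) D Z !degw_cons.
- by have [h _] := S _ (G1 t) (G2 t); exact: h.
- by rewrite unsh0 // => a' b' _; rewrite (hyv [::] _ e) // Zr.
- by have [_ h] := S _ (G1 t) (G2 t); apply: h hz ne.
Qed.
End LabelLinear.

(** * Shuffles *)

Section InversionSign.
Variables (K : fieldType) (ds : seq int).
Local Notation sgp i j := (sg K ds`_i ds`_j).

(** The part of the Koszul sign due to inverted pairs with one position in [a] and the smaller one
    in [b], where [a] stands before [b]; [sgl] is the whole sign of a list of positions. *)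
Definition cross (a b : seq nat) : K := \prod_(i <- a) \prod_(j <- b | (j < i)%N) sgp i j.

Fixpoint sgl (s : seq nat) : K := if s is i :: s' then cross [:: i] s' * sgl s' else 1.

Lemma cross_cons i a b : cross (i :: a) b = cross [:: i] b * cross a b.
Proof. by rewrite /cross big_cons big_seq1. Qed.

Lemma cross_catr a b b' : cross a (b ++ b') = cross a b * cross a b'.
Proof. by rewrite /cross -big_split; apply: eq_bigr => i _; rewrite big_cat. Qed.

Lemma cross_perm a b b' : perm_eq b b' -> cross a b = cross a b'.
Proof. by move=> p; apply: eq_bigr => i _; apply: perm_big. Qed.

Lemma cross_lt a b : (forall i j, i \in a -> j \in b -> (i < j)%N) -> cross a b = 1.
Proof.
move=> h; rewrite /cross big_seq big1 // => i ia; rewrite big_seq_cond big1 // => j /andP[jb].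
by move/ltnW; rewrite leqNgt h.
Qed.

Lemma sgl_cat a b : sgl (a ++ b) = cross a b * sgl a * sgl b.
Proof.
elim: a => [|i a IH] /=; first by rewrite /cross big_nil !mul1r.
rewrite IH cross_catr [cross (i :: a) b]cross_cons; ring.
Qed.

Lemma sgl_sorted a : sorted ltn a -> sgl a = 1.
Proof.
elim: a => [//|i a IH] /= p; rewrite IH ?mulr1; last exact: path_sorted p.
apply: cross_lt => x j; rewrite inE => /eqP-> ja.
by move: p; rewrite (path_sortedE ltn_trans) => /andP[/allP /(_ _ ja)].
Qed.

Lemma koszul_sgl n (sigma : 'S_n) :
  koszul K ds sigma = sgl [seq nat_of_ord (sigma i) | i : 'I_n].
Proof.
have H (l : seq 'I_n) : sorted ltn (map val l) -> sgl [seq nat_of_ord (sigma i) | i <- l]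
    = \prod_(i <- l) \prod_(j <- l | (i < j)%N && (sigma j < sigma i)%N) sgp (sigma i) (sigma j).
  elim: l => [|x l IH] /= p; first by rewrite big_nil.
  have px y : y \in l -> (x < y)%N.
    move=> yl; move: p; rewrite (path_sortedE ltn_trans) => /andP[/allP h _].
    by apply: h; apply: map_f.
  rewrite big_cons big_cons ltnn /= IH; last exact: path_sorted p.
  congr (_ * _).
    rewrite /cross big_seq1 big_map; rewrite [LHS]big_seq_cond [RHS]big_seq_cond.
    apply: eq_bigl => y; case yl: (y \in l) => //=; by rewrite px.
  rewrite [LHS]big_seq [RHS]big_seq; apply: eq_bigr => y yl.
  by rewrite big_cons ltnNge ltnW // px.
rewrite /image_mem H; last first.
  by rewrite val_enum_ord; exact: iota_ltn_sorted.
under eq_bigr do rewrite big_enum_cond.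
by rewrite big_enum /= /koszul pair_big_dep /=; apply: eq_bigr => -[i j] _.
Qed.
End InversionSign.

Section ShuffleSum.
Variables (K : fieldType) (T : Type) (deg : T -> int) (U : lmodType K).

(* The signed sum over [Sh(bs)] by recursion on [bs]; see [shuffle_sum]. *)
Fixpoint shs (bs : seq nat) (w : seq T) (Phi : seq T -> U) : U :=
  if bs is b :: bs' then
    unsh deg w (fun a c => if size a == b then shs bs' c (fun u => Phi (a ++ u)) else 0)
  else if w is [::] then Phi [::] else 0.

Lemma eq_shs bs w Phi Psi : (forall u, Phi u = Psi u) -> shs bs w Phi = shs bs w Psi.
Proof.
elim: bs w Phi Psi => [|b bs IH] [|t w] Phi Psi e //=; first by case: eqP => // _; apply: IH.
by congr (_ + _); apply: eq_unsh => a c _; case: eqP => // _; [|congr (_ *: _)]; apply: IH.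
Qed.

End ShuffleSum.

Fixpoint splits (A : Type) (s : seq A) : seq (seq A * seq A) :=
  if s is x :: s' then
    [seq (x :: p.1, p.2) | p <- splits s'] ++ [seq (p.1, x :: p.2) | p <- splits s']
  else [:: ([::], [::])].

(** The shuffles in one-line notation, enumerated by the recursion of [shs] so that the two sums can
    be compared term by term. *)
Fixpoint Lsh (bs : seq nat) (s : seq nat) : seq (seq nat) :=
  if bs is b :: bs' then
    flatten [seq [seq p.1 ++ u | u <- Lsh bs' p.2] | p <- [seq p <- splits s | size p.1 == b]]
  else if s is [::] then [:: [::]] else [::].

Lemma path_ltn_all x s : path ltn x s = all (ltn x) s && sorted ltn s.
Proof. exact: (path_sortedE ltn_trans). Qed.

Lemma mem_splits_cons (x : nat) s a b : (a, b) \in splits (x :: s) =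
  (if a is x' :: a' then (x' == x) && ((a', b) \in splits s) else false)
  || (if b is x' :: b' then (x' == x) && ((a, b') \in splits s) else false).
Proof.
rewrite /= mem_cat; congr (_ || _).
  apply/mapP/idP => [[[a' b'] h [-> ->]]|]; first by rewrite eqxx.
  by case: a => // x' a /andP[/eqP-> h]; exists (a, b).
apply/mapP/idP => [[[a' b'] h [-> ->]]|]; first by rewrite eqxx.
by case: b => // x' b /andP[/eqP-> h]; exists (a, b).
Qed.

(** The smallest entry [x] must head whichever of the two sorted words contains it, which is the
    recursion of [splits]. *)
Lemma mem_splits (s : seq nat) a b : sorted ltn s ->
  ((a, b) \in splits s) = [&& perm_eq (a ++ b) s, sorted ltn a & sorted ltn b].
Proof.
elim: s a b => [|x s IH] a b p.
  rewrite inE; apply/eqP/and3P => [[-> ->] //|[/perm_nilP]].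
  by case: a => //=; case: b.
move: p; rewrite /= path_ltn_all => /andP[/allP xs ss].
have xs' y : y \in s -> (x < y)%N by move=> /xs.
rewrite mem_splits_cons; apply/orP/and3P => [[]|[pe sa sb]].
- case: a => // x' a /andP[/eqP-> ]; rewrite IH // => /and3P[pe sa sb].
  split; rewrite ?cat_cons ?perm_cons //= path_ltn_all sa andbT.
  by apply/allP => y ya; apply: xs; rewrite -(perm_mem pe) mem_cat ya.
- case: b => // x' b /andP[/eqP-> ]; rewrite IH // => /and3P[pe sa sb].
  split; rewrite ?(perm_catCA a [:: x] b) /= ?perm_cons // path_ltn_all sb andbT.
  by apply/allP => y ya; apply: xs; rewrite -(perm_mem pe) mem_cat ya orbT.
have xab : x \in a ++ b by rewrite (perm_mem pe) mem_head.
have le y : y \in a ++ b -> (x <= y)%N.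
  by rewrite (perm_mem pe) inE => /predU1P[->|/xs' /ltnW].
have hd c : sorted ltn c -> {subset c <= a ++ b} -> x \in c -> exists c', c = x :: c'.
  case: c => // y c; rewrite /= path_ltn_all => /andP[/allP yc _] sc.
  rewrite inE => /predU1P[->|/yc]; first by exists c.
  by rewrite /= ltnNge le // sc ?mem_head.
move: xab; rewrite mem_cat => /orP[xa|xb]; [left|right].
  have [|a' ea] := hd a sa _ xa; first by move=> y ya; rewrite mem_cat ya.
  rewrite ea eqxx /= IH // sb -(perm_cons x) -cat_cons -ea pe /= andbT.
  by move: sa; rewrite ea => /path_sorted.
have [|b' eb] := hd b sb _ xb; first by move=> y yb; rewrite mem_cat yb orbT.
rewrite eb eqxx /= IH // sa -(perm_cons x) -[x :: a ++ b']/([:: x] ++ a ++ b').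
rewrite perm_catCA /= -eb pe /=.
by move: sb; rewrite eb => /path_sorted.
Qed.

Lemma uniq_splits (s : seq nat) : sorted ltn s -> uniq (splits s).
Proof.
elim: s => [//|x s IH] p; rewrite /= cat_uniq !map_inj_uniq; first last.
- by move=> [a b] [a' b'] /= [-> ->].
- by move=> [a b] [a' b'] /= [-> ->].
move: p; rewrite /= path_ltn_all => /andP[/allP xs ss].
rewrite IH //= andbT; apply/hasPn => _ /mapP[[a b] h ->]; apply/mapP => -[[a' b'] _ [ea _]].
move: h; rewrite mem_splits // ea => /and3P[/perm_mem /(_ x)].
by rewrite mem_head => /esym /xs; rewrite /= ltnn.
Qed.

Lemma mem_Lsh bs s u : sorted ltn s ->
  (u \in Lsh bs s) = [&& perm_eq u s, sumn bs == size s & all (sorted ltn) (reshape bs u)].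
Proof.
elim: bs s u => [|b bs IH] s u ss /=.
  case: s ss => [|x s] _; last by rewrite in_nil andbF.
  rewrite inE /= andbT; apply/eqP/idP => [-> //|]; exact: perm_nilP.
apply/flatten_mapP/and3P => [[[a c]]|[pe sz /andP[s1 s2]]].
  rewrite mem_filter /= => /andP[/eqP sa]; rewrite mem_splits // => /and3P[pac sta stc].
  case/mapP=> u'; rewrite IH // => /and3P[pu' szu' al] ->.
  split.
  - by rewrite -(permPr pac) perm_cat2l.
  - by rewrite (eqP szu') -(perm_size pac) size_cat sa.
  by rewrite -sa take_size_cat // drop_size_cat // sta.
have szu : size u = (b + sumn bs)%N by rewrite (perm_size pe) (eqP sz).
(* The witness for the complement of the first block: the remaining positions in increasing order,
   from which the later blocks are chosen. *)
pose c := sort leq (drop b u).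
have stc : sorted ltn c.
  rewrite ltn_sorted_uniq_leq sort_uniq sort_sorted ?andbT; last exact: leq_total.
  by rewrite drop_uniq // (perm_uniq pe) (sorted_uniq ltn_trans ltnn).
exists (take b u, c).
  rewrite mem_filter /= size_take_min szu (minn_idPl (leq_addr _ _)) eqxx /=.
  rewrite mem_splits // s1 stc !andbT -(permPr pe) -{2}(cat_take_drop b u) perm_cat2l.
  by rewrite perm_sort.
apply/mapP; exists (drop b u); last by rewrite cat_take_drop.
rewrite IH // s2 andbT perm_sym perm_sort perm_refl /= size_sort size_drop szu.
by rewrite addKn eqxx.
Qed.

Lemma uniq_Lsh bs s : sorted ltn s -> uniq (Lsh bs s).
Proof.
elim: bs s => [|b bs IH] s ss /=; first by case: s ss.
have : all (fun p => sorted ltn p.2) (splits s).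
  by apply/allP => -[a c]; rewrite mem_splits // => /and3P[].
have := uniq_splits ss.
elim: (splits s) => [//|[a c] l IHl] /= /andP[nl ul] /andP[sc sl].
case: ifP => /= [/eqP sa|_]; last exact: IHl.
rewrite cat_uniq IHl // map_inj_uniq ?IH //=; last first.
  by move=> u v /eqP; rewrite eqseq_cat // eqxx /= => /eqP.
rewrite andbT; apply/hasPn => x /flatten_mapP[[a' c']]; rewrite mem_filter /= => /andP[/eqP sa' hl].
case/mapP=> v hv ->; apply/mapP => -[v' hv' /eqP]; rewrite eqseq_cat ?sa // => /andP[/eqP ea /eqP ev].
move/allP: sl => /(_ _ hl) /= sc'.
move: hv hv'; rewrite !mem_Lsh // ev => /and3P[p1 _ _] /and3P[p2 _ _].
have ec : c = c'.
  apply: (irr_sorted_eq ltn_trans ltnn) => // z.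
  by rewrite -(perm_mem p2) (perm_mem p1).
by move: nl; rewrite ec -ea hl.
Qed.

Section ShuffleSums.
Variables (K : fieldType) (U : lmodType K).

Lemma unsh_splits (ds : seq int) (s : seq nat) (G : seq nat -> seq nat -> U) : sorted ltn s ->
  unsh (nth 0 ds) s G = \sum_(p <- splits s) cross K ds p.1 p.2 *: G p.1 p.2.
Proof.
elim: s G => [|x s IH] G; first by rewrite /= big_seq1 /cross big_nil scale1r.
rewrite /= path_ltn_all => /andP[/allP xs ss].
rewrite big_cat !big_map !IH //=; congr (_ + _); apply: eq_big_seq => -[a b];
  rewrite mem_splits //= => /and3P[/perm_mem pe _ _].
  rewrite cross_cons; have -> : cross K ds [:: x] b = 1; last by rewrite mul1r.
  apply: cross_lt => i j; rewrite inE => /eqP-> jb.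
  by apply: xs; rewrite -pe mem_cat jb orbT.
rewrite scalerA; congr (_ *: _); rewrite -cat1s cross_catr mulrC; congr (_ * _).
have : {subset a <= s} by move=> i ia; rewrite -pe mem_cat ia.
elim: a {pe} => [|i a IHa] sa; first by rewrite degw0 sg0 /cross big_nil.
rewrite degw_cons sgDr IHa => [|j ja]; last by apply: sa; rewrite inE ja orbT.
rewrite [RHS]cross_cons; congr (_ * _).
have xi : (x < i)%N by apply: xs; apply: sa; exact: mem_head.
by rewrite /cross big_seq1 big_cons big_nil xi mulr1 sgC.
Qed.

Lemma shs_Lsh (ds : seq int) bs s (Phi : seq nat -> U) : sorted ltn s ->
  shs (nth 0 ds) bs s Phi = \sum_(u <- Lsh bs s) sgl K ds u *: Phi u.
Proof.
elim: bs s Phi => [|b bs IH] s Phi ss /=.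
  by case: s ss => [|x s] _; rewrite ?big_seq1 ?scale1r // big_nil.
rewrite unsh_splits // big_flatten big_map big_filter [RHS]big_mkcond /=.
apply: eq_big_seq => -[a c]; rewrite mem_splits // => /and3P[pe sa sc] /=.
case: eqP => _; last by rewrite scaler0.
rewrite IH // big_map scaler_sumr; apply: eq_big_seq => u.
rewrite mem_Lsh // => /and3P[pu _ _].
by rewrite scalerA sgl_cat (sgl_sorted _ _ sa) mulr1 (cross_perm _ _ _ pu).
Qed.

Lemma shs_map (T T' : Type) (deg : T -> int) (deg' : T' -> int) (f : T -> T') bs w (Phi : seq T' -> U) :
  (forall t, deg' (f t) = deg t) ->
  shs deg' bs (map f w) Phi = shs deg bs w (fun u => Phi (map f u)).
Proof.
move=> e; elim: bs w Phi => [|b bs IH] w Phi /=; first by case: w.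
rewrite (unsh_map _ _ e); apply: eq_unsh => a c _; rewrite size_map; case: eqP => // _.
by rewrite IH; apply: eq_shs => u; rewrite map_cat.
Qed.

Definition plist n (tau : 'S_n) : seq nat := [seq nat_of_ord (tau i) | i : 'I_n].

Lemma shuffle_perm n (bs : seq nat) :
  perm_eq [seq plist tau | tau <- enum {perm 'I_n} & shuffle bs tau] (Lsh bs (iota 0 n)).
Proof.
have st := iota_ltn_sorted 0 n.
have inj : injective (@plist n) => [tau tau'|].
  move/eq_in_map => h; apply/permP => i; apply/val_inj; apply: h.
  by rewrite mem_enum.
apply: uniq_perm.
- by rewrite map_inj_uniq // filter_uniq // enum_uniq.
- exact: uniq_Lsh.
move=> u; rewrite mem_Lsh // size_iota; apply/mapP/and3P => [[tau]|[pu sz al]].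
  rewrite mem_filter /shuffle => /andP[/andP[sz al] _] ->; split=> //.
  apply: uniq_perm; rewrite ?iota_uniq //.
    by rewrite map_inj_uniq ?enum_uniq // => i j /val_inj /perm_inj.
  move=> k; rewrite mem_iota add0n /=; apply/mapP/idP => [[i _ ->]|kn]; first exact: ltn_ord.
  by exists ((tau^-1)%g (Ordinal kn)); rewrite ?mem_enum // permKV.
have su : size u = n by rewrite (perm_size pu) size_iota.
have uu : uniq u by rewrite (perm_uniq pu) iota_uniq.
have lu (i : 'I_n) : (nth 0%N u i < n)%N.
  have : nth 0%N u i \in u by rewrite mem_nth // su.
  by rewrite (perm_mem pu) mem_iota.
have fi : injective (fun i : 'I_n => Ordinal (lu i)).
  move=> i j [/eqP]; rewrite nth_uniq ?su // => /eqP; exact: val_inj.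
have e : u = [seq nat_of_ord (perm fi i) | i : 'I_n].
  apply: (@eq_from_nth _ 0%N); first by rewrite size_map size_enum_ord.
  move=> i; rewrite su => hi; rewrite (nth_map (Ordinal hi)) ?size_enum_ord // permE /=.
  by rewrite nth_enum_ord.
exists (perm fi) => //; rewrite mem_filter mem_enum inE andbT /shuffle sz.
by rewrite -e.
Qed.

(** The bridge from sums over permutations to sums over splittings. Positions serve as letters: the
    shuffles are enumerated on [iota 0 n], and the result is transported to [w] along [nth t0 w]. *)
Lemma shuffle_sum (T : Type) (deg : T -> int) (t0 : T) n bs (w : seq T) (Phi : seq T -> U) :
  size w = n ->
  \sum_(tau : 'S_n | shuffle bs tau)
     koszul K (map deg w) tau *: Phi [seq nth t0 w (tau i) | i : 'I_n]
  = shs deg bs w Phi.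
Proof.
move=> sw.
transitivity (shs (nth 0 (map deg w)) bs (iota 0 n) (fun u => Phi (map (nth t0 w) u))).
  rewrite shs_Lsh ?iota_ltn_sorted // -(perm_big _ (shuffle_perm n bs)) /=.
  rewrite big_map big_filter big_enum_cond /=; apply: eq_bigr => tau _.
  by rewrite koszul_sgl -map_comp.
(* Beyond [n] the default degree of [map deg w] is 0 while [nth t0 w] defaults to [t0]; the two
   degree functions agree only on positions below [n], hence the condition carried by [eS]. *)
pose dg k := if (k < n)%N then deg (nth t0 w k) else 0.
have dgE k : (map deg w)`_k = dg k.
  rewrite /dg; case: ltnP => h; first by rewrite (nth_map t0) ?sw.
  by rewrite nth_default // size_map sw.
have e : w = map (nth t0 w) (iota 0 n) by rewrite -sw map_nth_iota0 ?take_size.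
have eS bs' s (Phi' : seq nat -> U) : all (fun i => i < n)%N s ->
  shs (nth 0 (map deg w)) bs' s Phi' = shs (fun i => deg (nth t0 w i)) bs' s Phi'.
  have S s' (G G' : seq nat -> seq nat -> U) : all (fun i => i < n)%N s' ->
     (forall a b, all (fun i => i < n)%N a -> all (fun i => i < n)%N b -> G a b = G' a b) ->
     unsh (nth 0 (map deg w)) s' G = unsh (fun i => deg (nth t0 w i)) s' G'.
    elim: s' G G' => [|i s' IH] G G' /= hs hG; first exact: hG.
    case/andP: hs => hi hs; congr (_ + _); apply: IH => // a b ha hb.
      by apply: hG => //=; rewrite hi.
    rewrite dgE /dg hi hG //= ?hi //; congr (sg K _ _ *: _).
    rewrite /degw; elim: a ha {hG} => [|j a IHa] /=; first by rewrite !big_nil.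
    by case/andP=> hj ha; rewrite !big_cons IHa // dgE /dg hj.
  elim: bs' s Phi' => [|b bs' IH] s Phi' hs //=.
  by apply: S => // a c ha hc; case: eqP => // _; exact: IH.
rewrite eS; last by apply/allP => i; rewrite mem_iota.
by rewrite [in RHS]e (shs_map (deg := fun i => deg (nth t0 w i))).
Qed.

(* Insertion sort uses adjacent transpositions only. *)
Lemma swap_sort (T : Type) (deg : T -> int) (t0 : T) (w : seq T) (c : seq T -> U) u s :
  swap deg c -> uniq s -> all (fun i => i < size w)%N s ->
  c (u ++ map (nth t0 w) s) = sgl K (map deg w) s *: c (u ++ map (nth t0 w) (sort leq s)).
Proof.
move=> sc.
have ins u' x t : sorted ltn t -> x \notin t -> all (fun i => i < size w)%N (x :: t) ->
  exists2 t', perm_eq t' (x :: t) && sorted ltn t' &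
    c (u' ++ map (nth t0 w) (x :: t))
    = cross K (map deg w) [:: x] t *: c (u' ++ map (nth t0 w) t').
  elim: t u' => [|y t IH] u' /= st xt.
    by exists [:: x]; rewrite ?perm_refl // /cross big_seq1 big_nil scale1r.
  move: st xt; rewrite path_ltn_all inE negb_or => /andP[/allP yt st] /andP[xy xt].
  case/and3P=> hx hy ht.
  have [lxy|lyx] := ltnP x y.
    exists [:: x, y & t]; rewrite ?cross_lt ?scale1r //.
      rewrite perm_refl /= lxy path_ltn_all st andbT; exact/allP.
    move=> i j; rewrite inE => /eqP->; rewrite inE => /predU1P[->//|/yt].
    exact: ltn_trans.
  have {}lyx : (y < x)%N by rewrite ltn_neqAle eq_sym xy.
  have [|t' /andP[pt st'] e] := IH (rcons u' (nth t0 w y)) st xt; first by rewrite /= hx.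
  exists (y :: t').
    apply/andP; split.
      have /permPl -> : perm_eq (y :: t') (y :: x :: t) by rewrite perm_cons.
      exact: (permEl (perm_catCA [:: y] [:: x] t)).
    rewrite /= path_ltn_all st' andbT; apply/allP => z; rewrite (perm_mem pt) inE.
    by move=> /predU1P[->|/yt].
  rewrite sc -[in LHS]cat_rcons -[nth t0 w x :: _]/(map _ (x :: t)) e scalerA /= cat_rcons.
  congr (_ *: _).
  rewrite -[y :: t]cat1s cross_catr; congr (_ * _).
  rewrite /cross !big_seq1 big_cons big_nil lyx mulr1.
  by rewrite !(nth_map t0).
elim: s u => [|x s IH] u /=; first by rewrite scale1r.
case/andP=> xs us /andP[hx hs].
rewrite -cat_rcons IH // cat_rcons.
have [||| t' /andP[pt st'] e] := ins u x (sort leq s).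
- by rewrite ltn_sorted_uniq_leq sort_uniq us sort_sorted //; exact: leq_total.
- by rewrite mem_sort.
- by rewrite /= hx all_sort.
have et : t' = sort leq (x :: s).
  apply: (irr_sorted_eq ltn_trans ltnn) => // [|z].
    by rewrite ltn_sorted_uniq_leq sort_uniq /= xs us sort_sorted //; exact: leq_total.
  by rewrite mem_sort (perm_mem pt) !inE mem_sort.
rewrite /= in e; rewrite e scalerA et mulrC; congr (_ * _ *: _).
by apply: cross_perm; rewrite perm_sort.
Qed.

End ShuffleSums.

(** * Koszul signs of permutations from adjacent exchanges *)

Section GradedSymmetry.
Variables (K : fieldType) (W : gvect K).
Implicit Types (ds : seq int) (v : seq W).

Lemma size_permute (A : nmodType) n (sigma : 'S_n) (v : seq A) : size (permute sigma v) = n.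
Proof. by rewrite size_map size_enum_ord. Qed.

Lemma nth_permute (A : nmodType) n (sigma : 'S_n) (v : seq A) (i : 'I_n) :
  (permute sigma v)`_i = v`_(sigma i).
Proof. by rewrite /permute /image_mem (nth_map i) ?size_enum_ord ?nth_ord_enum. Qed.

Lemma homog_permute ds v (sigma : 'S_(size v)) :
  homog ds v -> homog (permute sigma ds) (permute sigma v).
Proof.
case=> hs hv; split; first by rewrite !size_permute.
move=> i; rewrite size_permute => hi.
by rewrite -[i]/(nat_of_ord (Ordinal hi)) !nth_permute; apply: hv; exact: ltn_ord.
Qed.

Lemma degt_zip ds v : size ds = size v ->
  degt (zip ds v) = \sum_(d <- ds) d.
Proof.
by move=> e; rewrite /degw -[in RHS](unzip1_zip (s := ds) (t := v)) ?e // big_map.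
Qed.

Lemma zip_permute n ds v (sigma : 'S_n) : size ds = size v ->
  zip (permute sigma ds) (permute sigma v) = map (nth (0, 0) (zip ds v)) (plist sigma).
Proof.
move=> e; rewrite /permute /plist /image_mem -map_comp.
elim: (enum _) => //= i l ->; by rewrite nth_zip.
Qed.

Lemma homog_thom ds v : homog ds v -> thom (zip ds v).
Proof.
case=> e h; elim: v ds e h => [|x v IH] [|d ds] //= [e] h; split; first exact: (h 0%N).
by apply: IH => // i hi; apply: (h i.+1).
Qed.

Lemma thom_homog (w : seq (int * W)) : thom w -> homog (map fst w) (map snd w).
Proof.
elim: w => [|x w IH] //= [hx /IH [e h]]; split; first by rewrite /= e.
by case=> [|i] //=; rewrite ltnS => /h.
Qed.

Lemma zip_fst_snd (w : seq (int * W)) : zip (map fst w) (map snd w) = w.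
Proof. by elim: w => //= -[a b] w ->. Qed.

Lemma swap_gsym (U : lmodType K) (c : seq (int * W) -> U) ds v (sigma : 'S_(size v)) :
  swap fst c -> size ds = size v ->
  c (zip (permute sigma ds) (permute sigma v)) = koszul K ds sigma *: c (zip ds v).
Proof.
move=> sc e; have sz : size (zip ds v) = size v by rewrite size_zip e minnn.
have pl : perm_eq (plist sigma) (iota 0 (size v)).
  apply: uniq_perm; rewrite ?iota_uniq //.
    by rewrite map_inj_uniq ?enum_uniq // => i j /val_inj /perm_inj.
  move=> k; rewrite mem_iota add0n /=; apply/mapP/idP => [[i _ ->]|kn]; first exact: ltn_ord.
  by exists ((sigma^-1)%g (Ordinal kn)); rewrite ?mem_enum // permKV.
have := @swap_sort K U _ fst (0, 0) (zip ds v) c [::] (plist sigma) sc.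
rewrite (perm_uniq pl) iota_uniq => /(_ isT) /= H.
rewrite zip_permute // H; last first.
  by rewrite (perm_all _ pl) sz; apply/allP => k; rewrite mem_iota.
rewrite -koszul_sgl -/(unzip1 _) unzip1_zip ?e //; congr (_ *: c _).
have -> : sort leq (plist sigma) = iota 0 (size v).
  apply: (sorted_eq leq_trans anti_leq) => //.
  - exact: (sort_sorted leq_total).
  - exact: iota_sorted.
  - by rewrite perm_sort.
by rewrite -sz map_nth_iota0 // take_size.
Qed.

(** An adjacent exchange is the action of one transposition, and its only inverted pair consists of
    the two letters, so its Koszul sign reduces to theirs. *)
Lemma gsym_hswap (W' : gvect K) (F : seq W -> W') : gsymmetric F ->
  hswap (fun u : seq (int * W) => F (map snd u)).
Proof.
move=> gF u1 x y u2 h1 [hx [hy _]] h2.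
pose w := u1 ++ y :: x :: u2; pose v := map snd w; pose ds := map fst w.
have hv : homog ds v by apply: thom_homog; apply: thom_cat.
pose k := size u1.
have sv : size v = (k + (size u2).+2)%N by rewrite size_map size_cat.
have hk : (k < size v)%N by rewrite sv -addSnnS leq_addr.
have hk1 : (k.+1 < size v)%N by rewrite sv -!addSnnS leq_addr.
pose sigma := tperm (Ordinal hk) (Ordinal hk1).
have ep : plist sigma = iota 0 k ++ [:: k.+1; k] ++ iota k.+2 (size u2).
  apply: (@eq_from_nth _ 0%N) => [|i].
    by rewrite size_map size_enum_ord !size_cat !size_iota sv.
  rewrite size_map size_enum_ord => hi.
  rewrite (nth_map (Ordinal hi)) ?size_enum_ord // (_ : nth _ _ _ = Ordinal hi); last first.
    by apply: val_inj; rewrite /= nth_enum_ord.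
  rewrite nth_cat size_iota; case: ltnP => h1i.
    rewrite nth_iota // tpermD // -val_eqE /= ?gtn_eqF //; exact: leqW.
  move: (i - k)%N (subnKC h1i) => [|[|j]] ej.
  - by rewrite (_ : Ordinal hi = Ordinal hk) ?tpermL //; apply: val_inj; rewrite /= -ej addn0.
  - by rewrite (_ : Ordinal hi = Ordinal hk1) ?tpermR //; apply: val_inj; rewrite /= -ej addn1.
  rewrite /= nth_iota; last by move: hi; rewrite -ej sv ltn_add2l.
  rewrite tpermD // -?val_eqE /= -?ej ?addnS ?addSn //.
    by rewrite ltn_eqF // ltnS -addnS leq_addr.
  by rewrite eqSS ltn_eqF // ltnS leq_addr.
have -> : map snd (u1 ++ x :: y :: u2) = permute sigma v.
  have -> : permute sigma v = map (nth 0 v) (plist sigma).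
    by rewrite /permute /plist /image_mem -map_comp.
  have ku : k = size (map snd u1) by rewrite size_map.
  rewrite ep [RHS]map_cat [X in _ = _ ++ X]map_cat map_nth_iota0; last by exact: ltnW.
  rewrite map_nth_iota; last by rewrite sv -!addSnnS addKn.
  rewrite /v !map_cat /= ku take_size_cat // !nth_cat ltnn subnn ltnNge leqnSn /= subSnn /=.
  congr (_ ++ [:: _, _ & _]); set A := map snd u1.
  rewrite (_ : A ++ _ = (A ++ [:: y.2; x.2]) ++ map snd u2) -?catA // catA drop_size_cat.
    by rewrite take_oversize // size_map.
  by rewrite size_cat addn2.
rewrite (gF ds) // koszul_sgl -/(plist _) ep; congr (_ *: _).
rewrite sgl_cat (sgl_sorted _ _ (iota_ltn_sorted _ _)) mulr1 cross_lt ?mul1r; last first.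
  move=> i j; rewrite mem_iota /= add0n => ik; rewrite !inE mem_iota.
  case/or3P => [/eqP->|/eqP->|/andP[h _]] //; first exact: leqW.
  by apply: leq_trans h; rewrite ltnS ltnW // ltnW.
rewrite sgl_cat (sgl_sorted _ _ (iota_ltn_sorted _ _)) mulr1 cross_lt ?mul1r; last first.
  move=> i j; rewrite !inE mem_iota => /orP[/eqP->|/eqP->] /andP[h _] //.
  exact: ltnW.
rewrite /= /cross !big_seq1 big_cons !big_nil ltnSn !mulr1 /ds /w map_cat /= !nth_cat.
by rewrite /k !size_map ltnn subnn ltnNge leqnSn /= subSnn.
Qed.
End GradedSymmetry.

Section ShuffleTwo.
Variables (K : fieldType) (T : Type) (deg : T -> int) (U : lmodType K).

Lemma shs1 m w (Phi : seq T -> U) :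
  shs deg [:: m] w Phi = if size w == m then Phi w else 0.
Proof.
rewrite /= unsh_nilr => [|t a b _]; last by case: eqP.
by rewrite cats0.
Qed.

Lemma shs2 m k w (Phi : seq T -> U) : shs deg [:: m; k] w Phi =
  unsh deg w (fun a b => if (size a == m) && (size b == k) then Phi (a ++ b) else 0).
Proof.
rewrite -[LHS]/(unsh deg w (fun a c => if size a == m then
  shs deg [:: k] c (fun u => Phi (a ++ u)) else 0)).
by apply: eq_unsh => a b _; rewrite shs1; case: eqP.
Qed.

Lemma unsh_sum (I : Type) (r : seq I) w (G : I -> seq T -> seq T -> U) :
  \sum_(i <- r) unsh deg w (G i) = unsh deg w (fun a b => \sum_(i <- r) G i a b).
Proof.
elim: r => [|i r IH]; first by rewrite big_nil unsh0 // => a b _; rewrite big_nil.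
by rewrite big_cons IH -unshD; apply: eq_unsh => a b _; rewrite big_cons.
Qed.
End ShuffleTwo.

Section MoreShuffles.
Variables (K : fieldType) (T : Type) (deg : T -> int) (U : lmodType K).

Lemma shs_size bs w (Phi Psi : seq T -> U) :
  (forall u, size u = sumn bs -> Phi u = Psi u) -> shs deg bs w Phi = shs deg bs w Psi.
Proof.
elim: bs w Phi Psi => [|b bs IH] w Phi Psi e; first by case: w => //=; rewrite e.
apply: eq_unsh => a c _; case: eqP => // sa; apply: IH => u su; apply: e.
by rewrite size_cat sa su.
Qed.

Lemma shs_Z bs w a (Phi : seq T -> U) :
  shs deg bs w (fun u => a *: Phi u) = a *: shs deg bs w Phi.
Proof.
elim: bs w Phi => [|b bs IH] w Phi; first by case: w => //= t w; rewrite scaler0.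
rewrite -unshZ; apply: eq_unsh => x c _; case: eqP => // _; last by rewrite scaler0.
Qed.

Lemma shs_0 bs w : shs deg bs w (fun _ => 0 : U) = 0.
Proof.
elim: bs w => [[]|b bs IH w] //=; apply: unsh0 => a c _.
by rewrite IH; case: eqP.
Qed.

Lemma shs_cat bs1 bs2 w (Phi : seq T -> U) : shs deg (bs1 ++ bs2) w Phi =
  unsh deg w (fun c d => shs deg bs1 c (fun a => shs deg bs2 d (fun b => Phi (a ++ b)))).
Proof.
elim: bs1 w Phi => [|b bs1 IH] w Phi.
  by rewrite unsh_nill.
rewrite /= unsh_assoc; apply: eq_unsh => a c _; case: eqP => _; last by rewrite unsh0.
rewrite IH; apply: eq_unsh => c1 d _; apply: eq_shs => s; apply: eq_shs => s'.
by rewrite catA.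
Qed.
End MoreShuffles.

Section HomSFacts.
Variables (K : fieldType) (V : gvect K).
Implicit Type h : homS V.

Lemma homS_sumE h : exists (s : seq int) (G : int -> (seq V -> V)),
  (forall d, homS_homog d (G d)) /\ forall v, h v = \sum_(d <- s) G d v.
Proof.
have /asboolP[s [G [_ hG e]]] := valP h.
by exists s, G; split=> // v; rewrite -sum_fctE -e.
Qed.

Lemma homS_nil h : h [::] = 0.
Proof.
by have [s [G [hG ->]]] := homS_sumE h; apply: big1 => d _; have [] := hG d.
Qed.

Lemma homS_ml h : multilinear h.
Proof.
have [s [G [hG e]]] := homS_sumE h => s1 s2 a x y; rewrite !e scaler_sumr -big_split /=.
by apply: eq_bigr => d _; have [_ -> _ _] := hG d.
Qed.

Lemma homS0 v : (0 : homS V) v = 0. Proof. by []. Qed.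

Lemma homS_hd d (h : seq V -> V) u : homS_homog d h -> thom u -> gdeg (degt u + d) (h (map snd u)).
Proof.
case=> h0 _ _ hh hu; case: u hu => [|x u] hu; first by rewrite h0; exact: gdeg0.
have := hh _ (map snd (x :: u)) _ (thom_homog hu).
by rewrite big_map; apply.
Qed.

Lemma homS_hswap d (h : seq V -> V) : homS_homog d h -> hswap (fun u : seq (int * V) => h (map snd u)).
Proof. by case=> _ _ g _; exact: gsym_hswap. Qed.
End HomSFacts.

Section LinearPost.
Variables (K : fieldType) (W : gvect K) (U U' : lmodType K) (phi : U -> U').
Hypothesis pl : forall a x y, phi (a *: x + y) = a *: phi x + phi y.

Lemma lin0 : phi 0 = 0.
Proof. by have := pl (-1) 0 0; rewrite scaleN1r oppr0 addr0 scaleN1r addNr. Qed.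
Lemma linD x y : phi (x + y) = phi x + phi y.
Proof. by rewrite -{1}[x]scale1r pl scale1r. Qed.
Lemma linZ a x : phi (a *: x) = a *: phi x.
Proof. by rewrite -[a *: x]addr0 pl lin0 addr0. Qed.

Lemma tl_lin (c : seq (int * W) -> U) : tl c -> tl (fun w => phi (c w)).
Proof.
case=> h k; split=> [u1 d a x y u2|u1 d e z u2 hz ne]; first by rewrite h pl.
by rewrite (k _ _ e) // lin0.
Qed.

Lemma swap_lin (T : Type) (deg : T -> int) (c : seq T -> U) :
  swap deg c -> swap deg (fun w => phi (c w)).
Proof. by move=> h w1 t t' w2; rewrite h linZ. Qed.

Lemma psum_lin (T : Type) (deg : T -> int) (M : gvect K) (y : seq T -> M)
    (H : seq (int * M) -> U) w : phi (psum deg y H w) = psum deg y (fun u => phi (H u)) w.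
Proof.
have [n] := ubnP (size w); elim: n w H => // n IH [|t w] H hn //.
rewrite !psum_cons (@unsh_lin _ _ _ _ _ phi _ _ linD linZ); apply: eq_unsh => a b s; apply: IH.
exact: spl_ltr s hn.
Qed.

Lemma unsh_linf (T : Type) (deg : T -> int) w (G : seq T -> seq T -> U) :
  phi (unsh deg w G) = unsh deg w (fun a b => phi (G a b)).
Proof. exact: unsh_lin linD linZ. Qed.
End LinearPost.

Section TaggedLemmas.
Variables (K : fieldType) (W : gvect K) (U : lmodType K).
Implicit Type c : seq (int * W) -> U.

Definition degree_shift (U' : gvect K) (e : int) (c : seq (int * W) -> U') : Prop :=
  forall w, gdeg (degt w + e) (c w).

Lemma tl_comp c u1 d z u2 : tl c ->
  c (u1 ++ (d, z) :: u2) = c (u1 ++ (d, comp d z) :: u2).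
Proof.
case=> h k; have S (s : seq int) (f : int -> W) :
    c (u1 ++ (d, \sum_(x <- s) f x) :: u2) = \sum_(x <- s) c (u1 ++ (d, f x) :: u2).
  elim: s => [|x s IH]; first by rewrite !big_nil tml0.
  by rewrite !big_cons tmlD // IH.
rewrite {1}(comp_sum z) S; have [ds|nds] := boolP (d \in supp z).
  rewrite (bigD1_seq d) ?supp_uniq //= big1 ?addr0 // => e ne.
  by apply: k (comp_deg e z) _; apply/eqP.
rewrite big1_seq => [|e /andP[_ es]]; first by rewrite (comp_out nds) tml0.
by apply: k (comp_deg e z) _ => ed; rewrite -ed es in nds.
Qed.

Lemma swap_move c t u1 u2 : swap fst c ->
  c (t :: u1 ++ u2) = sg K t.1 (degt u1) *: c (u1 ++ t :: u2).
Proof.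
move=> sc; have X u0 : c (u0 ++ t :: u1 ++ u2) = sg K t.1 (degt u1) *: c (u0 ++ u1 ++ t :: u2).
  elim: u1 u0 => [|x u1 IH] u0 /=; first by rewrite degw0 sg0 scale1r.
  by rewrite sc -cat_rcons IH cat_rcons scalerA degw_cons sgDr.
exact: (X [::]).
Qed.
End TaggedLemmas.

Section ShsLinear.
Variables (K : fieldType) (T : Type) (deg : T -> int) (U U' : lmodType K) (phi : U -> U').
Hypothesis pl : forall a x y, phi (a *: x + y) = a *: phi x + phi y.

Lemma shs_lin bs w (Phi : seq T -> U) :
  phi (shs deg bs w Phi) = shs deg bs w (fun u => phi (Phi u)).
Proof.
elim: bs w Phi => [|b bs IH] w Phi; first by case: w => //= t w; exact: lin0 pl.
rewrite /= (unsh_linf pl); apply: eq_unsh => a c _; case: eqP => // _.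
exact: lin0 pl.
Qed.
End ShsLinear.

Lemma shuffle_sum_zip (K : fieldType) (V : gvect K) (U : lmodType K) bs (dv : seq int)
    (v : seq V) (Psi : seq int -> seq V -> U) : size dv = size v ->
  \sum_(tau : 'S_(size v) | shuffle bs tau)
     koszul K dv tau *: Psi (permute tau dv) (permute tau v)
  = shs fst bs (zip dv v) (fun s => Psi (map fst s) (map snd s)).
Proof.
move=> e; have sz : size (zip dv v) = size v by rewrite size_zip e minnn.
rewrite -(shuffle_sum fst (0, 0) _ _ sz); apply: eq_bigr => tau _.
rewrite -/(unzip1 _) unzip1_zip ?e //; congr (_ *: _).
by congr Psi; rewrite /permute /image_mem -[RHS]map_comp; apply: eq_map => i /=; rewrite nth_zip.
Qed.

Lemma omit_map (A B : Type) (f : A -> B) k s : omit k (map f s) = map f (omit k s).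
Proof. by rewrite /omit map_cat map_take map_drop. Qed.

Section PolyExpansion.
Variables (K : fieldType) (W : gvect K) (U : lmodType K).
Implicit Type c : seq (int * W) -> U.

(* The value at arbitrary vectors of a map known on words with declared degrees. *)
Fixpoint expand c (zs : seq W) : U :=
  if zs is z :: zs' then \sum_(d <- supp z) expand (fun u => c ((d, z) :: u)) zs' else c [::].

Lemma eq_expand c c' zs : (forall u, c u = c' u) -> expand c zs = expand c' zs.
Proof.
elim: zs c c' => [|z zs IH] c c' e /=; first exact: e.
by apply: eq_bigr => d _; apply: IH.
Qed.

Lemma expand_eq0 c zs : (forall ds, size ds = size zs -> c (zip ds zs) = 0) -> expand c zs = 0.
Proof.
elim: zs c => [|z zs IH] c e /=; first exact: (e [::]).
apply: big1 => d _; apply: IH => ds h; apply: (e (d :: ds)).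
by rewrite /= h.
Qed.

Lemma expand_D c c' zs : expand (fun u => c u + c' u) zs = expand c zs + expand c' zs.
Proof.
elim: zs c c' => [//|z zs IH] c c' /=; rewrite -big_split.
by apply: eq_bigr => d _; rewrite IH.
Qed.

Lemma expand_Z a c zs : expand (fun u => a *: c u) zs = a *: expand c zs.
Proof.
by elim: zs c => [//|z zs IH] c /=; rewrite scaler_sumr; apply: eq_bigr => d _; rewrite IH.
Qed.

Lemma expand_homog c ds zs : tl c -> homog ds zs -> expand c zs = c (zip ds zs).
Proof.
elim: zs c ds => [|z zs IH] c [|d ds] //= hc [] //= [e] h.
have hz : gdeg d z := h 0%N isT.
have hzs : homog ds zs by split=> // i hi; apply: (h i.+1).
rewrite (eq_bigr (fun x => c ((x, z) :: zip ds zs))) => [|x _]; last first.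
  by apply: IH => //; exact: tl_cons.
have [dsz|nds] := boolP (d \in supp z).
  rewrite (bigD1_seq d) ?supp_uniq //= big1 ?addr0 // => x ne.
  by have [_ k] := hc; apply: (k [::]) hz _ => xd; rewrite xd eqxx in ne.
rewrite big1_seq => [|x /andP[_ xs]].
  by rewrite -(comp_id hz) (comp_out nds) (tml0 [::]) //; case: hc.
by have [_ k] := hc; apply: (k [::]) hz _ => xd; rewrite xd xs in nds.
Qed.

(** The chosen supports of [a *: x + y], [x] and [y] are unrelated. Since [c] only sees the declared
    component, all three sums can be taken over the union of the supports. *)
Lemma expand_ml c s1 s2 a x y : tl c ->
  expand c (s1 ++ (a *: x + y) :: s2) = a *: expand c (s1 ++ x :: s2) + expand c (s1 ++ y :: s2).
Proof.
elim: s1 c => [|z s1 IH] c hc /=; last first.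
  rewrite scaler_sumr -big_split; apply: eq_bigr => d _; apply: IH; exact: tl_cons.
have [hm k] := hc.
pose g d z := expand (fun u => c ((d, z) :: u)) s2.
have g0 d z : d \notin supp z -> g d z = 0.
  move=> nd; apply: expand_eq0 => ds _; rewrite (tl_comp [::]) // (comp_out nd).
  exact: (tml0 [::]).
have gl d b z z' : g d (b *: z + z') = b *: g d z + g d z'.
  by rewrite -expand_Z -expand_D; apply: eq_expand => u; exact: (hm [::]).
pose s := undup (supp (a *: x + y) ++ supp x ++ supp y).
have S z : {subset supp z <= s} -> \sum_(d <- supp z) g d z = \sum_(d <- s) g d z.
  move=> sz; rewrite -(@big_rmcond_in _ _ _ _ s (fun d => d \in supp z)) /=; last first.
    by move=> d _; exact: g0.
  rewrite -[RHS]big_filter; apply: perm_big; apply: uniq_perm.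
  - exact: supp_uniq.
  - by rewrite filter_uniq // undup_uniq.
  by move=> d; rewrite mem_filter; case: (boolP (d \in supp z)) => // /sz.
rewrite -/(g _ _) !S; first by rewrite scaler_sumr -big_split; apply: eq_bigr => d _; exact: gl.
all: by move=> d hd; rewrite mem_undup !mem_cat hd ?orbT.
Qed.
End PolyExpansion.

Section ExpandLinear.
Variables (K : fieldType) (W : gvect K) (U U' : lmodType K) (phi : U -> U').
Hypothesis pl : forall a x y, phi (a *: x + y) = a *: phi x + phi y.

Lemma expand_lin (c : seq (int * W) -> U) zs : phi (expand c zs) = expand (fun u => phi (c u)) zs.
Proof.
elim: zs c => [//|z zs IH] c /=; elim: (supp z) => [|d s IHs].
  by rewrite !big_nil (lin0 pl).
by rewrite !big_cons (linD pl) IHs IH.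
Qed.
End ExpandLinear.

(** * The structure maps *)

Section Structure.
Variables (K : fieldType) (mu lam : K) (V : gvect K).

(* [V (x) R] for [R = K[s] / (s^2 - mu s + lam)], the pair [(a, b)] standing for
   [a + s b]. *)
Definition VR : gvect K := dsum V V.

Definition smul (p : VR) : VR := (- (lam *: p.2), p.1 + mu *: p.2).
Definition iota_R (v : V) : VR := (v, 0).

Lemma smulD p q : smul (p + q) = smul p + smul q.
Proof.
by rewrite /smul /=; congr pair; rewrite /= scalerDr ?opprD // addrACA.
Qed.

Lemma smulZ c p : smul (c *: p) = c *: smul p.
Proof.
rewrite /smul /=; congr pair; rewrite /= ?scalerN ?scalerDr !scalerA;
  by rewrite [c * _]mulrC.
Qed.

Lemma smul0 : smul 0 = 0.
Proof. by rewrite -(scale0r 0) smulZ !scale0r. Qed.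

Lemma smul_smul p : smul (smul p) = mu *: smul p - lam *: p.
Proof.
rewrite /smul; congr pair => /=; last by rewrite addrC.
by rewrite scalerN scalerDr opprD !scalerA mulrC addrC.
Qed.

Lemma smul_deg d p : gdeg d p -> gdeg d (smul p).
Proof.
case=> h1 h2; split; first by apply: gdegN; exact: gdegZ.
by apply: gdegD => //; exact: gdegZ.
Qed.

Lemma iotaD u v : iota_R (u + v) = iota_R u + iota_R v.
Proof. by rewrite /iota_R; congr pair; rewrite /= addr0. Qed.

Lemma iotaZ c v : iota_R (c *: v) = c *: iota_R v.
Proof. by rewrite /iota_R; congr pair; rewrite /= scaler0. Qed.

Lemma iota0 : iota_R 0 = 0. Proof. by []. Qed.

Lemma iota_deg d v : gdeg d v -> gdeg d (iota_R v).
Proof. by split=> //; exact: gdeg0. Qed.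

Lemma VR_eta (p : VR) : p = iota_R p.1 + smul (iota_R p.2).
Proof.
case: p => a b; rewrite /iota_R /smul; congr pair => /=.
  by rewrite scaler0 oppr0 addr0.
by rewrite scaler0 addr0 add0r.
Qed.

(** Extension of scalars to [R]: each argument [a + s b] is split into its two parts, and [s] is
    pulled out as [smul]. The values of [c] lie in [VR] so that lifts can be nested, as in
    [Rlift_unsh]. *)
Fixpoint Rlift (c : seq (int * V) -> VR) (u : seq (int * VR)) : VR :=
  if u is x :: u' then
    Rlift (fun v => c ((x.1, x.2.1) :: v)) u' + smul (Rlift (fun v => c ((x.1, x.2.2) :: v)) u')
  else c [::].

Lemma eq_Rlift c c' u : (forall v, degt v = degt u -> c v = c' v) -> Rlift c u = Rlift c' u.
Proof.
elim: u c c' => [|x u IH] c c' e /=; first by apply: e; rewrite !degw0.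
by congr (_ + smul _); apply: IH => v dv; apply: e; rewrite !degw_cons dv.
Qed.

Lemma eq_Rlift_thom c c' u : thom u -> (forall v, thom v -> degt v = degt u -> c v = c' v) ->
  Rlift c u = Rlift c' u.
Proof.
elim: u c c' => [|x u IH] c c' /= hu e; first by apply: e; rewrite ?degw0.
case: hu => [[h1 h2] hu].
by congr (_ + smul _); apply: IH => // v hv dv; apply: e; rewrite ?degw_cons ?dv.
Qed.

Lemma Rlift_D c c' u : Rlift (fun v => c v + c' v) u = Rlift c u + Rlift c' u.
Proof. by elim: u c c' => //= x u IH c c'; rewrite !IH smulD addrACA. Qed.

Lemma Rlift_Z a c u : Rlift (fun v => a *: c v) u = a *: Rlift c u.
Proof. by elim: u c => //= x u IH c; rewrite !IH smulZ scalerDr. Qed.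

Lemma Rlift_sm c u : Rlift (fun v => smul (c v)) u = smul (Rlift c u).
Proof. by elim: u c => //= x u IH c; rewrite !IH smulD. Qed.

Lemma Rlift_unsh_out (T : Type) (deg : T -> int) w (G : seq T -> seq T -> seq (int * V) -> VR) u :
  Rlift (fun v => unsh deg w (fun a b => G a b v)) u = unsh deg w (fun a b => Rlift (G a b) u).
Proof.
elim: w G => [//|t w IH] G /=; rewrite Rlift_D !IH; congr (_ + _).
by apply: eq_unsh => a b _; rewrite Rlift_Z.
Qed.

Lemma Rlift_unsh (G : seq (int * V) -> seq (int * V) -> VR) u :
  Rlift (fun v => unsht v G) u = unsht u (fun u1 u2 => Rlift (fun v1 => Rlift (G v1) u2) u1).
Proof.
elim: u G => [//|x u IH] G /=; rewrite !Rlift_D !IH smulD addrACA.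
congr (_ + _); rewrite (@unsh_lin _ _ _ _ _ smul _ _ smulD smulZ) -unshD; apply: eq_unsh => a b _ //.
rewrite -Rlift_sm -Rlift_D -Rlift_Z; apply: eq_Rlift => v dv.
by rewrite dv !Rlift_Z smulZ scalerDr.
Qed.

Lemma Rlift_tml c : tml c -> tml (Rlift c).
Proof.
move=> hc u1; elim: u1 c hc => [|x u1 IH] c hc d a y z u2 /=.
  have S p q : Rlift (fun v => c ((d, a *: p + q) :: v)) u2
      = a *: Rlift (fun v => c ((d, p) :: v)) u2 + Rlift (fun v => c ((d, q) :: v)) u2.
    by rewrite -Rlift_Z -Rlift_D; apply: eq_Rlift => v _; exact: (hc [::]).
  by rewrite !S smulD smulZ scalerDr addrACA.
rewrite (IH _ (tml_cons _ hc)) (IH _ (tml_cons _ hc)) smulD smulZ scalerDr addrACA //.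
Qed.

Lemma Rlift_hswap c : hswap c -> hswap (Rlift c).
Proof.
move=> hc u1; elim: u1 c hc => [|x u1 IH] c hc y z u2 /= h1 [hy [hz _]] h2.
  case: hy hz => [hy1 hy2] [hz1 hz2].
  have S a b : gdeg y.1 a -> gdeg z.1 b ->
      Rlift (fun v => c ((y.1, a) :: (z.1, b) :: v)) u2
      = sg K y.1 z.1 *: Rlift (fun v => c ((z.1, b) :: (y.1, a) :: v)) u2.
    move=> ha hb; rewrite -Rlift_Z; apply: eq_Rlift_thom => // v hv _.
    by rewrite (hc [::] (y.1, a) (z.1, b)).
  rewrite !S // !(smulZ, smulD, scalerDr) -!addrA; congr (_ + _).
  by rewrite !addrA; congr (_ + _); rewrite addrC.
case: h1 => [[hx1 hx2] h1].
rewrite (IH _ (hswap_cons _ hc)) // (IH _ (@hswap_cons _ _ _ _ (x.1, x.2.2) _ hc)) //.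
by rewrite smulZ scalerDr.
Qed.

Lemma Rlift_hd c e u : thom u -> (forall v, thom v -> gdeg (degt v + e) (c v)) ->
  gdeg (degt u + e) (Rlift c u).
Proof.
elim: u c e => [|x u IH] c e /=; first by move=> _ /(_ [::] I); rewrite !degw0.
move=> [[h1 h2] hu] hc; rewrite degw_cons.
have -> : x.1 + degt u + e = degt u + (x.1 + e) by ring.
have H a : gdeg x.1 a -> gdeg (degt u + (x.1 + e)) (Rlift (fun v => c ((x.1, a) :: v)) u).
  move=> ha; apply: IH => // v hv.
  have := hc ((x.1, a) :: v); rewrite degw_cons /=.
  have -> : x.1 + degt v + e = degt v + (x.1 + e) by ring.
  by apply.
by apply: (@gdegD _ VR); [|apply: smul_deg]; apply: H.
Qed.

Definition Rext (h : seq V -> V) : seq (int * VR) -> VR :=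
  Rlift (fun v => iota_R (h (map snd v))).

Lemma Rext_zero h u : (forall v, size v = size u -> h v = 0) -> Rext h u = 0.
Proof.
rewrite /Rext; elim: u h => [|x u IH] k e /=; first by rewrite e.
have H a : Rlift (fun v => iota_R (k (map snd ((x.1, a) :: v)))) u = 0.
  by apply: (IH (fun v => k (a :: v))) => v sv; apply: e; rewrite /= sv.
by rewrite !H smul0 addr0.
Qed.

Section OneMap.
Variable h : seq V -> V.
Hypothesis hl : multilinear h.

Lemma ml_0 u1 u2 : h (u1 ++ 0 :: u2) = 0.
Proof.
have := hl u1 u2 1 0 0; rewrite !scale1r addr0 => /eqP.
by rewrite eq_sym -subr_eq0 addrK => /eqP.
Qed.

Lemma Rext_tml : tml (Rext h).
Proof.
apply: Rlift_tml => u1 d a x y u2.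
by rewrite !map_cat /= hl iotaD iotaZ.
Qed.

Lemma Rext_cons d x u :
  Rext h ((d, x) :: u) = Rext (fun v => h (x.1 :: v)) u + smul (Rext (fun v => h (x.2 :: v)) u).
Proof. by []. Qed.

Lemma Rext_iota d a u : Rext h ((d, iota_R a) :: u) = Rext (fun v => h (a :: v)) u.
Proof.
rewrite Rext_cons [X in smul X]Rext_zero ?smul0 ?addr0 // => v _.
exact: (ml_0 [::]).
Qed.

Lemma Rext_smiota d a u : Rext h ((d, smul (iota_R a)) :: u) = smul (Rext (fun v => h (a :: v)) u).
Proof.
have e : smul (iota_R a) = (0, a) by rewrite /smul /= !scaler0 oppr0 addr0.
rewrite e Rext_cons /= [X in X + _]Rext_zero ?add0r // => v _.
exact: (ml_0 [::]).
Qed.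
End OneMap.

Lemma Rext_D h h' u : Rext (fun v => h v + h' v) u = Rext h u + Rext h' u.
Proof. by rewrite /Rext -Rlift_D; apply: eq_Rlift => v _; rewrite iotaD. Qed.

Lemma Rext_Z c h u : Rext (fun v => c *: h v) u = c *: Rext h u.
Proof. by rewrite /Rext -Rlift_Z; apply: eq_Rlift => v _; rewrite iotaZ. Qed.

Lemma Rlift_lin (phi : V -> VR) (k : seq (int * V) -> V) u :
  (forall a x y, phi (a *: x + y) = a *: phi x + phi y) ->
  Rlift (fun v => phi (k v)) u
  = phi (Rlift (fun v => iota_R (k v)) u).1 + smul (phi (Rlift (fun v => iota_R (k v)) u).2).
Proof.
move=> pl.
have p0 := lin0 pl; have pD := linD pl; have pZ := linZ pl.
(* The [R]-linear extension of [phi]. It commutes with [smul] because of [s^2 = mu s - lam], and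
   then both sides satisfy the recursion of [Rlift]. *)
pose psi (p : VR) := phi p.1 + smul (phi p.2).
have psiD p q : psi (p + q) = psi p + psi q by rewrite /psi /= !pD smulD addrACA.
have psism p : psi (smul p) = smul (psi p).
  rewrite /psi /= pD -scaleNr !pZ !smulD smulZ smul_smul scaleNr.
  by rewrite addrC -addrA.
rewrite -[RHS]/(psi _); elim: u k => [|x u IH] k /=; first by rewrite /psi /= p0 smul0 addr0.
by rewrite !IH psiD psism.
Qed.

Lemma Rext_comp (h k : seq V -> V) u : multilinear h ->
  Rlift (fun v => unsht v (fun v1 v2 => iota_R (h (k (map snd v1) :: map snd v2)))) u
  = unsht u (fun u1 u2 => Rext h ((degt u1 + 1, Rext k u1) :: u2)).
Proof.
move=> hl; rewrite Rlift_unsh; apply: eq_unsh => u1 u2 _.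
have := @Rlift_lin (fun z => Rext (fun v => h (z :: v)) u2) (fun v => k (map snd v)) u1.
rewrite -/(Rext k) Rext_cons => <- // a x y.
rewrite -Rext_Z -Rext_D; apply: eq_Rlift => v _; congr iota_R; exact: (hl [::]).
Qed.

(* A letter [(d, (z, v))] of degree [d] carries an argument [z] of the structure
   maps and a point [v] of [V]. *)
Definition ZV : gvect K := dsum (CRBA V) V.
Definition letter := (int * ZV)%type.

Implicit Types (w : seq letter) (t : letter).

Definition vc t : V := comp t.1 (t.2.2 : V).
Definition vs w : seq V := map vc w.
Definition vt w : seq (int * V) := map (fun t => (t.1, vc t)) w.

Lemma vs_vt w : vs w = map snd (vt w).
Proof. by rewrite /vs /vt -map_comp. Qed.

Lemma vt_thom w : thom (vt w).
Proof. by elim: w => //= t w IH; split=> //; exact: comp_deg. Qed.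

Lemma vt_deg w : degt (vt w) = degt w.
Proof. exact: degw_map. Qed.

Lemma vs_cat w w' : vs (w ++ w') = vs w ++ vs w'.
Proof. exact: map_cat. Qed.

(** Labels enter one at a time and linearly. The shift [e] is 1 for [Fh], an element of degree d of
    the shifted space being a map of degree d + 1, and 0 for [Xh]. *)
Definition single (Hh : seq letter -> homS V) (e : int) : Prop :=
  [/\ forall w, size w <> 1%N -> Hh w = 0, forall w, homS_homog (degt w + e) (Hh w) & tl Hh].

Definition Fh w : homS V :=
  if w is [:: t] then comp (t.1 + 1) (t.2.1.1 : HomSV V) else 0.
Definition Xh w : homS V := if w is [:: t] then comp t.1 (t.2.1.2 : HomSV V) else 0.

Lemma Fh_single : single Fh 1.
Proof.
split=> [[|t [|t' w]]|[|t [|t' w]]|] //; try exact: homS_homog0.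
- by rewrite degw1; exact: (comp_deg (t.1 + 1) (t.2.1.1 : HomSV V)).
- split=> [[|t [|t' u1]] d a x y [|t2 u2]|[|t [|t' u1]] d e z [|t2 u2]] //=;
    try by rewrite scaler0 addr0.
  + exact: (@compZD _ (HomSV V)).
  + move=> [[h1 _] _] ne; apply: (@comp_ne _ (HomSV V) _ _ _ h1).
    by move/addIr.
Qed.

Lemma Xh_single : single Xh 0.
Proof.
split=> [[|t [|t' w]]|[|t [|t' w]]|] //; try exact: homS_homog0.
- by rewrite degw1 addr0; exact: (comp_deg t.1 (t.2.1.2 : HomSV V)).
- split=> [[|t [|t' u1]] d a x y [|t2 u2]|[|t [|t' u1]] d e z [|t2 u2]] //=;
    try by rewrite scaler0 addr0.
  + exact: (@compZD _ (HomSV V)).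
  + by move=> [[_ h1] _] ne; apply: (@comp_ne _ (HomSV V) _ _ _ h1).
Qed.

Lemma swap_single (U : lmodType K) Hh e (phi : homS V -> U) : single Hh e -> phi 0 = 0 ->
  swap fst (fun w => phi (Hh w)).
Proof.
case=> h _ _ p0 w1 t t' w2; rewrite !h ?p0 ?scaler0 //; by case: w1 => [|x [|]].
Qed.

Lemma tl_vs (h : homS V) : tl (fun b => h (vs b)).
Proof.
have hl := homS_ml h.
split=> [u1 d a x y u2|u1 d e z u2 [_ hz] ne]; rewrite !vs_cat /= /vc /=.
  by rewrite compZD hl.
by rewrite (comp_ne hz) // ml_0.
Qed.

Lemma swap_vs d (h : homS V) : homS_homog d h -> swap fst (fun b => h (vs b)).
Proof.
move=> hh w1 t t' w2; have := homS_hswap hh (u1 := vt w1) (x := (t.1, vc t))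
  (y := (t'.1, vc t')) (u2 := vt w2).
rewrite !vs_vt /vt !map_cat /=; apply; try exact: vt_thom.
by split; [exact: comp_deg | split; [exact: comp_deg|]].
Qed.

(** The polarization of [h(x)] in the map and the point together: one letter supplies the map, all
    the others its arguments. *)
Definition Hx (Hh : seq letter -> homS V) w : V := unsht w (fun a b => Hh a (vs b)).

Section HxFacts.
Variables (Hh : seq letter -> homS V) (e : int).
Hypothesis hH : single Hh e.

Lemma Hx_tl : tl (Hx Hh).
Proof.
have [_ _ ht] := hH; apply: tl_unsh => [b|a]; last exact: tl_vs.
exact: (tl_lin (phi := fun h : homS V => h (vs b))).
Qed.

Lemma Hx_swap : swap fst (Hx Hh).
Proof.
apply: unsh_swap => [b|a]; last by have [_ h _] := hH; exact: (swap_vs (h a)).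
exact: (@swap_single _ _ e (fun h : homS V => h (vs b)) hH).
Qed.

Lemma Hx_hd : degree_shift e (Hx Hh).
Proof.
move=> w; apply: unsh_hd => a b s; have [_ h _] := hH.
rewrite vs_vt (spl_degw fst s) -(vt_deg b) addrC addrCA addrA addrC addrCA addrA.
rewrite [X in gdeg X _](_ : _ = degt (vt b) + (degt a + e)); last by ring.
by apply: homS_hd => //; exact: vt_thom.
Qed.
End HxFacts.

(** The polarized derivative of [c] along a vector field [S] of degree 1. With the value of [S] in
    front of the remaining letters, the only sign is that of the splitting. *)
Definition ins (U : lmodType K) (S : seq letter -> ZV) (c : seq letter -> U) w : U :=
  unsht w (fun a b => c ((degt a + 1, S a) :: b)).

Section Ins.
Variable S : seq letter -> ZV.

Lemma eq_ins (U : lmodType K) (c c' : seq letter -> U) w :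
  (forall w, c w = c' w) -> ins S c w = ins S c' w.
Proof. by move=> e; apply: eq_unsh. Qed.

Lemma ins_lin (U U' : lmodType K) (phi : U -> U') (c : seq letter -> U) w :
  (forall a x y, phi (a *: x + y) = a *: phi x + phi y) ->
  ins S (fun w => phi (c w)) w = phi (ins S c w).
Proof. by move=> pl; rewrite /ins (unsh_linf pl). Qed.

Lemma insD (U : lmodType K) (c c' : seq letter -> U) w :
  ins S (fun w => c w + c' w) w = ins S c w + ins S c' w.
Proof. exact: unshD. Qed.

Lemma insN (U : lmodType K) (c : seq letter -> U) w :
  ins S (fun w => - c w) w = - ins S c w.
Proof. exact: unshN. Qed.

(* [ins S] is an odd derivation. *)
Lemma ins_unsh (U : lmodType K) (G : seq letter -> seq letter -> U) w :
  ins S (fun w => unsht w G) w =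
  unsht w (fun a b => unsht a (fun a1 a2 => G ((degt a1 + 1, S a1) :: a2) b))
  + unsht w (fun a b => sg K (degt a) 1 *: ins S (G a) b).
Proof.
rewrite /ins /= unshD; congr (_ + _).
  by rewrite unsh_assoc.
rewrite unsh_swap12; apply: eq_unsh => a b _; rewrite -unshZ; apply: eq_unsh => b1 b2 _.
by rewrite scalerA; congr (_ *: _); sign_cases.
Qed.

Lemma ins_tl (U : lmodType K) (c : seq letter -> U) : tl S -> tl c -> tl (ins S c).
Proof.
move=> hS hc; apply: tl_unsh => [b|a]; last exact: tl_cons.
have [hm _] := hc; have [hSm hSv] := hS.
split=> [u1 d a x y u2|u1 d e z u2 hz ne].
  by rewrite hSm (degw_letter _ _ _ x) (degw_letter _ _ y x) (hm [::]).
by rewrite (hSv _ _ e) // (tml0 [::]).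
Qed.

Lemma ins_swap (U : lmodType K) (c : seq letter -> U) : swap fst S -> tl c ->
  swap fst c -> swap fst (ins S c).
Proof.
move=> hS [hm _] hc; apply: unsh_swap => [b|a].
  by move=> w1 t t' w2; rewrite hS (degw_swap fst) (tmlZ [::]).
by move=> w1; exact: (hc ((degt a + 1, S a) :: w1)).
Qed.

Lemma ins_hd (U : gvect K) (c : seq letter -> U) e : degree_shift e c -> degree_shift (e + 1) (ins S c).
Proof.
move=> hc w; apply: unsh_hd => a b s; have := hc ((degt a + 1, S a) :: b).
by rewrite degw_cons (spl_degw fst s) /=; congr gdeg; ring.
Qed.
End Ins.

Definition inV (u : seq letter -> V) : seq letter -> ZV := fun w => (0, u w).
Definition delta (U : lmodType K) (u : seq letter -> V) (c : seq letter -> U) := ins (inV u) c.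

Lemma inV_tl u : tl u -> tl (inV u).
Proof.
move=> hu; apply: (tl_lin (phi := fun v : V => (0, v) : ZV)) hu => a x y.
by rewrite /GRing.scale /GRing.add; congr pair; rewrite /= scaler0 addr0.
Qed.

(** * From functions of words to multilinear maps on V *)

Definition inX (t : int * CRBA V) : letter := (t.1, (t.2, 0)).
Definition inv (t : int * V) : letter := (t.1, (0, t.2)).
Definition Lt t : letter := (t.1, (t.2.1, 0)).
Definition Rt t : letter := (t.1, (0, t.2.2)).
Definition fsts w : seq (int * CRBA V) := map (fun t => (t.1, t.2.1)) w.

Lemma inX_fsts w : map inX (fsts w) = map Lt w.
Proof. by rewrite /fsts -map_comp. Qed.

(** Every letter is the sum of a label and a point; multilinearity expands the word and graded
    symmetry moves the labels to the front. So a function is determined by its values at labels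
    followed by points, the form in which [part] turns it into a map. *)
Lemma separate (U : lmodType K) (c : seq letter -> U) w : tl c -> swap fst c ->
  c w = unsht w (fun a b => c (map Lt a ++ map Rt b)).
Proof.
elim: w c => [//|t w IH] c hc sc.
have et : t = (t.1, (Lt t).2 + (Rt t).2).
  by case: t => d [x v]; rewrite /Lt /Rt /GRing.add /=; congr (_, (_, _)); rewrite ?addr0 ?add0r.
have [hm _] := hc; rewrite {1}et (tmlD [::]) //.
have sx x : swap fst (fun u => c (x :: u)) by move=> w1; exact: (sc (x :: w1)).
have e1 := IH _ (tl_cons (Lt t) hc) (sx (Lt t)).
have e2 := IH _ (tl_cons (Rt t) hc) (sx (Rt t)).
rewrite /= in e1 e2; rewrite [X in X + _]e1 [X in _ + X]e2 /=.
congr (_ + _); apply: eq_unsh => a b _; rewrite (swap_move _ _ _ sc); congr (sg K _ _ *: _).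
exact: degw_map.
Qed.

Lemma tl_inv (U : lmodType K) (c : seq letter -> U) : tl c -> tl (fun v => c (map inv v)).
Proof.
case=> h k; split=> [u1 d a x y u2|u1 d e z u2 hz ne]; rewrite !map_cat /=.
  rewrite -h; congr (c (_ ++ (d, _) :: _)).
  by rewrite /GRing.scale /GRing.add /=; congr pair; rewrite /= scaler0 addr0.
by apply: k ne; split=> //; exact: (@gdeg0 _ (CRBA V)).
Qed.

Lemma tl_inX (U : lmodType K) (c : seq letter -> U) : tl c -> tl (fun v => c (map inX v)).
Proof.
case=> h k; split=> [u1 d a x y u2|u1 d e z u2 hz ne]; rewrite !map_cat /=.
  rewrite -h; congr (c (_ ++ (d, _) :: _)).
  by rewrite /GRing.scale /GRing.add /=; congr pair; rewrite /= scaler0 addr0.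
by apply: k ne; split=> //; exact: gdeg0.
Qed.

Lemma comp_inv (U : lmodType K) (c : seq letter -> U) w : tl c ->
  c (map inv (vt w)) = c (map Rt w).
Proof.
elim: w c => [//|t w IH] c hc; rewrite [LHS](IH (fun u => c (inv (t.1, vc t) :: u))); last exact: tl_cons.
rewrite [RHS](tl_comp [::]) // [LHS](tl_comp [::]) //; congr (c ((t.1, _) :: _)).
have H v : comp t.1 ((0, v) : ZV) = (0, comp t.1 v).
  have := @comp_morph _ V (ZV) (fun v => (0, v)) 0.
  move=> h; rewrite -[in LHS](addr0 t.1) h //.
    by move=> a x y; rewrite /GRing.scale /GRing.add /=; congr pair; rewrite /= scaler0 addr0.
  by move=> d v' hv; rewrite addr0; split=> //; exact: (@gdeg0 _ (CRBA V)).
by rewrite !H /= /vc comp_comp.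
Qed.

(** The labels [a] are fixed and the points become the arguments. Vanishing of [c] on labels alone,
    assumed in the section below, provides the value 0 that elements of [homS] have at arity
    zero. *)
Definition partf (c : seq letter -> V) (a : seq (int * CRBA V)) (v : seq V) : V :=
  expand (fun u => c (map inX a ++ map inv u)) v.

Definition mkhom (F : seq V -> V) : homS V := insubd 0 F.

Lemma mkhomE F : F \in homS_pred (V := V) -> mkhom F = F :> (seq V -> V).
Proof. by move=> h; rewrite /mkhom -[LHS]/(val _) insubdK. Qed.

Section Part.
Variables (c : seq letter -> V) (e : int).
Hypotheses (hc : tl c) (sc : swap fst c) (dc : degree_shift e c) (c0 : forall a, c (map inX a) = 0).

Lemma part_tl a : tl (fun u => c (map inX a ++ map inv u)).
Proof. exact: (tl_inv (tl_cat _ hc)). Qed.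

Lemma partf_homog a : homS_homog (degt a + e) (partf c a).
Proof.
split.
- by rewrite /partf /= cats0.
- by move=> s1 s2 b x y; apply: expand_ml; exact: part_tl.
- move=> ds v sigma hv; rewrite /partf.
  rewrite (expand_homog (part_tl a) (homog_permute sigma hv)) (expand_homog (part_tl a) hv).
  apply: (swap_gsym (c := fun u => c (map inX a ++ map inv u))); last by case: hv.
  by move=> w1 t t' w2; rewrite !map_cat /= !catA sc.
- move=> ds v v0 hv; rewrite /partf (expand_homog (part_tl a) hv).
  have := dc (map inX a ++ map inv (zip ds v)); rewrite degw_cat !(degw_map (deg := fst)) //.
  rewrite degt_zip; last by case: hv.
  by congr gdeg; ring.
Qed.

Definition part a : homS V := mkhom (partf c a).

Lemma partE a v : part a v = partf c a v.
Proof.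
rewrite /part mkhomE //; apply/asboolP.
exists [:: degt a + e], (fun d => if d == degt a + e then partf c a else 0); split=> //.
- by move=> d; case: eqP => [->|_]; [exact: partf_homog | exact: homS_homog0].
- by rewrite big_seq1 eqxx.
Qed.

Lemma part_homog a : homS_homog (degt a + e) (part a).
Proof.
have -> : (part a : seq V -> V) = partf c a by apply/funext => v; rewrite partE.
exact: partf_homog.
Qed.

Lemma part_thom a u : thom u -> part a (map snd u) = c (map inX a ++ map inv u).
Proof.
by move=> hu; rewrite partE /partf (expand_homog (part_tl a) (thom_homog hu)) zip_fst_snd.
Qed.

Lemma part_linear : tl part.
Proof.
have h v := tl_inX (tl_catr v hc).
split=> [u1 d a x y u2|u1 d e' z u2 hz ne]; apply/val_inj/funext => v.
  rewrite -[LHS]/(part _ v) -[RHS]/(a *: part _ v + part _ v) !partE /partf -expand_Z -expand_D.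
  by apply: eq_expand => u; have [hm _] := h (map inv u); apply: hm.
rewrite -[LHS]/(part _ v) -[RHS]/(0 : V) partE; apply: expand_eq0 => ds _.
by have [_ k] := h (map inv (zip ds v)); apply: k ne.
Qed.
End Part.

(* [xi w] and [Fx w] are [xi(x)] and [F(x)], and [Fy w] is [F(y) = P + s U] for
   [y = xi(x) + s x]; [delta Uy xi] is the derivative of [xi] along [U]. *)
Definition vh w : V := if w is [:: t] then vc t else 0.
Definition xi : seq letter -> V := Hx Xh.
Definition Fx : seq letter -> V := Hx Fh.
Definition yR w : VR := iota_R (xi w) + smul (iota_R (vh w)).
Definition Fy w : VR := unsht w (fun a b => psum fst yR (Rext (Fh a)) b).
Definition Py w : V := (Fy w).1.
Definition Uy w : V := (Fy w).2.
Definition rho w : V := Py w - delta Uy xi w.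
Definition lie w : V := - delta Fx Fx w.

Lemma iota_lin a (x y : V) : iota_R (a *: x + y) = a *: iota_R x + iota_R y.
Proof. by rewrite iotaD iotaZ. Qed.
Lemma smul_lin a (x y : VR) : smul (a *: x + y) = a *: smul x + smul y.
Proof. by rewrite smulD smulZ. Qed.
Lemma fst_lin a (x y : VR) : (a *: x + y).1 = a *: x.1 + y.1. Proof. by []. Qed.
Lemma snd_lin a (x y : VR) : (a *: x + y).2 = a *: x.2 + y.2. Proof. by []. Qed.
Hint Resolve iota_lin smul_lin fst_lin snd_lin : core.

Lemma smi_lin a (x y : V) : smul (iota_R (a *: x + y)) = a *: smul (iota_R x) + smul (iota_R y).
Proof. by rewrite iota_lin smul_lin. Qed.

Lemma vh_tl : tl vh.
Proof.
split=> [[|t [|t' u1]] d a x y [|t2 u2]|[|t [|t' u1]] d e z [|t2 u2]] //=;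
  try by rewrite scaler0 addr0.
- exact: compZD.
- by move=> [_ hz] ne; exact: (comp_ne hz).
Qed.

Lemma vh_swap : swap fst vh.
Proof. by move=> [|t [|t1 w1]] t' t2 w2 /=; rewrite scaler0. Qed.

Lemma xi_tl : tl xi. Proof. exact: Hx_tl Xh_single. Qed.
Lemma xi_swap : swap fst xi. Proof. exact: Hx_swap Xh_single. Qed.
Lemma xi_hd w : gdeg (degt w) (xi w).
Proof. by have := Hx_hd Xh_single w; rewrite addr0. Qed.
Lemma Fx_tl : tl Fx. Proof. exact: Hx_tl Fh_single. Qed.
Lemma Fx_swap : swap fst Fx. Proof. exact: Hx_swap Fh_single. Qed.
Lemma Fx_hd : degree_shift 1 Fx. Proof. exact: Hx_hd Fh_single. Qed.

Lemma yR_tl : tl yR.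
Proof. apply: tl_add; [exact: tl_lin xi_tl | exact: (tl_lin smi_lin vh_tl)]. Qed.

Lemma yR_swap : swap fst yR.
Proof.
move=> w1 t t' w2; rewrite /yR scalerDr; congr (_ + _).
  exact: (swap_lin iota_lin xi_swap).
exact: (swap_lin smi_lin vh_swap).
Qed.

Lemma yR_hd w : gdeg (degt w) (yR w).
Proof.
apply: gdegD; first by apply: iota_deg; exact: xi_hd.
apply: smul_deg; apply: iota_deg; case: w => [|t [|t' w]]; try exact: gdeg0.
by rewrite degw1; exact: comp_deg.
Qed.

Lemma Rext_hswap h d : homS_homog d h -> hswap (Rext h).
Proof.
move=> hh; apply: Rlift_hswap => u1 x y u2 h1 h2 h3.
rewrite -iotaZ; congr iota_R; exact: (homS_hswap hh h1 h2 h3).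
Qed.

Lemma Rext_hd (h : seq V -> V) d u : homS_homog d h -> thom u -> gdeg (degt u + d) (Rext h u).
Proof.
move=> hh hu; apply: Rlift_hd => // v hv; apply: iota_deg; exact: homS_hd.
Qed.

Lemma Rext_linh u a (h h' : homS V) : Rext (a *: h + h' : homS V) u = a *: Rext h u + Rext h' u.
Proof. by rewrite -Rext_Z -Rext_D. Qed.

Lemma psum_Rext_lin b a (h h' : homS V) :
  psum fst yR (Rext (a *: h + h' : homS V)) b = a *: psum fst yR (Rext h) b + psum fst yR (Rext h') b.
Proof. by rewrite -psum_Z -psum_D; apply: eq_psum => u _; exact: Rext_linh. Qed.

Lemma Fy_tl : tl Fy.
Proof.
apply: tl_unsh => [b|a]; last by apply: tl_psum; [apply: Rext_tml; exact: homS_ml | exact: yR_tl].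
have [_ _ ht] := Fh_single; exact: (tl_lin (psum_Rext_lin b) ht).
Qed.

Lemma Fy_swap : swap fst Fy.
Proof.
apply: unsh_swap => [b|a].
  apply: (@swap_single _ _ _ (fun h : homS V => psum fst yR (Rext h) b) Fh_single).
  exact: (lin0 (psum_Rext_lin b)).
have [_ hh _] := Fh_single.
apply: psum_swap; [apply: Rext_tml; exact: homS_ml | exact: (Rext_hswap (hh a)) | exact: yR_hd|].
exact: yR_swap.
Qed.

Lemma Fy_hd : degree_shift 1 Fy.
Proof.
move=> w; apply: (@unsh_hd _ _ _ VR) => a b s; have [_ hh _] := Fh_single.
rewrite (spl_degw fst s) [X in gdeg X](_ : _ = degt b + (degt a + 1)); last by ring.
by apply: (@psum_hd _ _ _ _ VR) => [|u hu]; [exact: yR_hd | exact: Rext_hd].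
Qed.

Lemma Py_tl : tl Py. Proof. exact: (@tl_lin _ _ VR V (fun p => p.1) fst_lin _ Fy_tl). Qed.
Lemma Uy_tl : tl Uy. Proof. exact: (@tl_lin _ _ VR V (fun p => p.2) snd_lin _ Fy_tl). Qed.
Lemma Py_swap : swap fst Py. Proof. exact: (@swap_lin _ VR V (fun p => p.1) fst_lin _ _ _ Fy_swap). Qed.
Lemma Uy_swap : swap fst Uy. Proof. exact: (@swap_lin _ VR V (fun p => p.2) snd_lin _ _ _ Fy_swap). Qed.
Lemma Py_hd : degree_shift 1 Py. Proof. by move=> w; have [] := Fy_hd w. Qed.
Lemma Uy_hd : degree_shift 1 Uy. Proof. by move=> w; have [] := Fy_hd w. Qed.

Lemma inV_swap u : swap fst u -> swap fst (inV u).
Proof.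
move=> hu w1 t t' w2; rewrite /inV hu /GRing.scale /=; congr pair.
by rewrite /= scaler0.
Qed.

Lemma delta_tl u (c : seq letter -> V) : tl u -> tl c -> tl (delta u c).
Proof. by move=> hu hc; apply: ins_tl => //; exact: inV_tl. Qed.

Lemma rho_tl : tl rho.
Proof. apply: tl_add; [exact: Py_tl | apply: tl_opp; apply: delta_tl; [exact: Uy_tl | exact: xi_tl]]. Qed.

Lemma rho_swap : swap fst rho.
Proof.
move=> w1 t t' w2; rewrite /rho Py_swap scalerBr; congr (_ - _).
by apply: ins_swap; [exact: inV_swap Uy_swap | exact: xi_tl | exact: xi_swap].
Qed.

Lemma rho_hd : degree_shift 1 rho.
Proof.
move=> w; apply: gdegD; first exact: Py_hd.
apply: gdegN; have := @ins_hd (inV Uy) V xi 0; rewrite add0r; apply.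
by move=> w'; rewrite addr0; exact: xi_hd.
Qed.

Lemma lie_tl : tl lie.
Proof. by apply: tl_opp; apply: delta_tl; exact: Fx_tl. Qed.

Lemma lie_swap : swap fst lie.
Proof.
move=> w1 t t' w2; rewrite /lie scalerN; congr (- _).
by apply: ins_swap; [exact: inV_swap Fx_swap | exact: Fx_tl | exact: Fx_swap].
Qed.

Lemma lie_hd : degree_shift 2 lie.
Proof. by move=> w; apply: gdegN; exact: (@ins_hd (inV Fx) V Fx 1 Fx_hd w). Qed.

(** * Continuity *)

Definition null N (h : homS V) : Prop := forall v, (size v <= N)%N -> h v = 0.

(** At homogeneous arguments the values of the components of [h] lie in different degrees, so they
    vanish together with their sum. Multilinearity of [F], the component cut off above arity [N],
    extends this to all arguments. *)
Lemma null_comp N h d : null N h -> null N (comp d (h : HomSV V) : homS V).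
Proof.
move=> h0; pose F v : V := if (size v <= N)%N then (comp d (h : HomSV V) : homS V) v else 0.
suff F0 : F = 0 by move=> v sv; have := congr1 (fun f => f v) F0; rewrite /F sv.
apply: multilinear_homog0.
- by rewrite /F /= homS_nil.
- move=> s1 s2 a x y; rewrite /F !size_cat /=; case: ifP => _; first exact: homS_ml.
  by rewrite scaler0 addr0.
move=> ds v v0 hv; rewrite /F; case: ifP => // sv.
have [_ _ _ hi] := gdegP V; pose D := \sum_(x <- ds) x.
have [dS|nd] := boolP (d \in supp (h : HomSV V)); last by rewrite (comp_out nd).
have := hi [seq D + x | x <- supp (h : HomSV V)]
  (fun x => (comp (x - D) (h : HomSV V) : homS V) v) _ _ _ (D + d).
rewrite addrAC subrr add0r; apply.
- by rewrite map_inj_uniq; [exact: supp_uniq | exact: addrI].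
- move=> x; have [_ _ _ wd] := comp_deg (x - D) (h : HomSV V).
  by have := wd ds v v0 hv; rewrite -/D addrC subrK.
- rewrite big_map -[RHS](h0 v sv) [in RHS](comp_sum (h : HomSV V)) homS_val_sum sum_fctE.
  by apply: eq_bigr => x _; rewrite addrAC subrr add0r.
exact: map_f.
Qed.

Definition nvl t : bool := t.2.2 != 0.
Definition isnull N t : Prop := [/\ t.2.2 = 0, null N t.2.1.1 & null N t.2.1.2].
Fixpoint hasnull N w : Prop := if w is t :: w' then isnull N t \/ hasnull N w' else False.

Lemma spl_hasnull N w a b : spl w a b -> hasnull N w -> hasnull N a \/ hasnull N b.
Proof.
by elim=> //= t w' a' b' _ IH [h|/IH[h|h]]; tauto.
Qed.

Lemma vs_nv (h : homS V) b : ~~ all nvl b -> h (vs b) = 0.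
Proof.
elim: b (h : seq V -> V) (homS_ml h) => [//|t b IH] F hF /=.
rewrite negb_and negbK => /orP[/eqP t0|hb].
  by rewrite /vc t0 comp0; exact: (ml_0 hF [::]).
by apply: (IH (fun v => F (vc t :: v))) => // s1 s2 a x y; exact: (hF (vc t :: s1)).
Qed.

Lemma hasnull_nv N b : hasnull N b -> ~~ all nvl b.
Proof.
elim: b => //= t b IH; rewrite negb_and => -[[t0 _ _]|/IH->]; last by rewrite orbT.
by rewrite negbK t0 eqxx.
Qed.

(** Continuity is a count: letters with nonzero point bound the number of arguments. A null letter
    either supplies the map, which then receives at most [N] arguments, or occupies an argument with
    the point zero. *)
Lemma Hx_null Hh e N w : single Hh e -> (forall t, isnull N t -> null N (Hh [:: t])) ->
  hasnull N w -> (count nvl w <= N)%N -> Hx Hh w = 0.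
Proof.
move=> [hs _ _] hN hw nw; apply: unsh0 => a b s.
case: (spl_hasnull s hw) => [ha|hb]; last by rewrite vs_nv // (hasnull_nv hb).
case: a ha s => [//|t [|t' a]] /= ha s; last by rewrite hs.
case: ha => // ht; have [hb|hb] := boolP (all nvl b); last by rewrite vs_nv.
apply: (hN t ht); rewrite size_map; move: hb; rewrite all_count => /eqP <-.
by apply: leq_trans nw; rewrite (spl_count nvl s) leq_addl.
Qed.

Lemma xi_null N w : hasnull N w -> (count nvl w <= N)%N -> xi w = 0.
Proof.
apply: (Hx_null Xh_single) => t [_ _ h]; exact: null_comp.
Qed.

Lemma Fx_null N w : hasnull N w -> (count nvl w <= N)%N -> Fx w = 0.
Proof.
apply: (Hx_null Fh_single) => t [_ h _]; exact: null_comp.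
Qed.

Lemma yR_null N w : hasnull N w -> (count nvl w <= N)%N -> yR w = 0.
Proof.
move=> hw nw; rewrite /yR (xi_null hw nw).
case: w hw {nw} => [//|t [|t' w]] /= hw; last by rewrite iota0 smul0 addr0.
by case: hw => // -[t0 _ _]; rewrite /vc t0 comp0 iota0 smul0 addr0.
Qed.

(** All maps vanish at arity zero, so a letter without point is null for [N = 0]; the vanishing of
    expressions without points thus becomes a case of continuity. *)
Lemma noV_hasnull w : w <> [::] -> count nvl w = 0%N -> hasnull 0 w.
Proof.
case: w => //= t w _; rewrite /nvl; case: eqP => //= t0 _; left; split=> //.
  by move=> [|x v] // _; exact: homS_nil.
by move=> [|x v] // _; exact: homS_nil.
Qed.

Lemma yR_noV w : count nvl w = 0%N -> yR w = 0.
Proof.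
case: w => [|t w] nw; last by apply: (yR_null (N := 0)); rewrite ?nw //; exact: noV_hasnull.
by rewrite /yR (homS_nil (0 : homS V) : xi [::] = 0) iota0 smul0 addr0.
Qed.

(** A block without a nonzero point has value 0 by [yR_noV], so in the surviving terms [h] receives
    at most [N] arguments. *)
Lemma psum_null N (h : seq V -> V) b : multilinear h ->
  (forall v, (size v <= N)%N -> h v = 0) -> (count nvl b <= N)%N -> psum fst yR (Rext h) b = 0.
Proof.
have [n] := ubnP (size b); elim: n b N h => // n IH [|t b] N h hn hl hN nb.
  by rewrite psum_nil /Rext /= hN.
rewrite psum_cons; apply: unsh0 => a b' s.
have [ta|ta] := eqVneq (count nvl (t :: a)) 0%N.
  rewrite (yR_noV ta) -[RHS](psum_0 fst VR yR b'); apply: eq_psum => u _.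
  by apply: (tml0 [::]); exact: Rext_tml.
have nab : (count nvl b' < N)%N.
  apply: leq_trans nb; rewrite /= (spl_count nvl s) addnA -[(_ + count nvl a)%N]/(count nvl (t :: a)).
  by rewrite -addn1 addnC leq_add2r lt0n.
have hb' : (size b' < n)%N := spl_ltr s hn.
have Z z : psum fst yR (Rext (fun v => h (z :: v))) b' = 0.
  apply: (IH _ N.-1) => //; first by move=> s1; exact: (hl (z :: s1)).
    by move=> v sv; apply: hN; rewrite /= -(ltn_predK nab).
  by rewrite -ltnS (ltn_predK nab).
have -> : psum fst yR (fun u => Rext h ((degt (t :: a), yR (t :: a)) :: u)) b'
    = psum fst yR (Rext (fun v => h ((yR (t :: a)).1 :: v))) b'
      + smul (psum fst yR (Rext (fun v => h ((yR (t :: a)).2 :: v))) b').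
  by rewrite (psum_lin smul_lin) -psum_D.
by rewrite !Z smul0 addr0.
Qed.

Lemma psum_hasnull N (h : seq V -> V) b : multilinear h -> hasnull N b ->
  (count nvl b <= N)%N -> psum fst yR (Rext h) b = 0.
Proof.
move=> hl; move: {h hl} (Rext h) (Rext_tml hl) => H hH.
have [n] := ubnP (size b); elim: n b H hH => // n IH [|t b] H hH hn hb nb //.
rewrite psum_cons; apply: unsh0 => a b' s.
have nab : (count nvl (t :: a) <= N)%N /\ (count nvl b' <= N)%N.
  move: nb; rewrite /= (spl_count nvl s) addnA => nb.
  by split; apply: leq_trans nb; rewrite ?leq_addr ?leq_addl.
have [ha|hb'] : hasnull N (t :: a) \/ hasnull N b'.
  exact: (spl_hasnull (spll t s)).
  rewrite (yR_null ha) ?nab.1 // -[RHS](psum_0 fst VR yR b'); apply: eq_psum => u _.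
  exact: (tml0 [::]).
apply: (IH b') => //; [exact: tml_cons | exact: spl_ltr s hn | exact: nab.2].
Qed.

Lemma Fy_null N w : hasnull N w -> (count nvl w <= N)%N -> Fy w = 0.
Proof.
move=> hw nw; apply: unsh0 => a b s.
have nb : (count nvl b <= N)%N by apply: leq_trans nw; rewrite (spl_count nvl s) leq_addl.
case: (spl_hasnull s hw) => [ha|hb]; last by apply: (psum_hasnull _ hb nb); exact: homS_ml.
apply: (psum_null (N := N)) => //; first exact: homS_ml.
case: a ha s => [//|t [|t' a]] /= ha s v sv //.
by case: ha => // -[_ h _]; exact: (@null_comp N _ (t.1 + 1) h v sv).
Qed.

Lemma delta_null u (c : seq letter -> V) N w : tl c -> u [::] = 0 ->
  (forall N w, hasnull N w -> (count nvl w <= N)%N -> u w = 0) ->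
  (forall N w, hasnull N w -> (count nvl w <= N)%N -> c w = 0) ->
  hasnull N w -> (count nvl w <= N)%N -> delta u c w = 0.
Proof.
move=> hc u0 hu hcn hw nw; apply: unsh0 => a b s.
have [ua|ua] := eqVneq (u a) 0.
  by rewrite /inV ua; apply: (tml0 [::]); case: hc.
(* The inserted letter counts as a new point, but the letters of [a] take away at least one, so the
   bound [N] is kept. *)
have na : (0 < count nvl a)%N.
  rewrite lt0n; apply/eqP => na; move: ua; case: a s na => [|t a] s na; first by rewrite u0 eqxx.
  by rewrite (hu 0%N) ?na ?eqxx //; exact: noV_hasnull.
have [ha|hb] := spl_hasnull s hw.
  by move: ua; rewrite (hu N) ?eqxx //; apply: leq_trans nw; rewrite (spl_count nvl s) leq_addr.
apply: (hcn N); first by right.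
rewrite /= /nvl /inV /= ua; apply: leq_trans nw; rewrite (spl_count nvl s).
by rewrite leq_add2r.
Qed.

Lemma Fy_nil : Fy [::] = 0. Proof. by rewrite /Fy /=. Qed.

Lemma rho_null N w : hasnull N w -> (count nvl w <= N)%N -> rho w = 0.
Proof.
move=> hw nw; rewrite /rho /Py (Fy_null hw nw) (delta_null xi_tl _ _ _ hw nw) ?subr0 //.
- by move=> N' w' h1 h2; rewrite /Uy (Fy_null h1 h2).
- exact: xi_null.
Qed.

Lemma lie_null N w : hasnull N w -> (count nvl w <= N)%N -> lie w = 0.
Proof.
move=> hw nw; rewrite /lie (delta_null Fx_tl _ _ _ hw nw) ?oppr0 //; exact: Fx_null.
Qed.

Lemma nvl_inX a : count nvl (map inX a) = 0%N.
Proof. by elim: a => //= t a ->; rewrite /nvl /= eqxx. Qed.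

Lemma rho_inX a : rho (map inX a) = 0.
Proof.
case: a => [|t a]; last by apply: (rho_null (N := 0)); rewrite ?nvl_inX //; exact: noV_hasnull (nvl_inX (t :: a)).
rewrite /rho /Py Fy_nil /delta /ins /= /inV /Uy Fy_nil.
by have [h _] := xi_tl; rewrite (tml0 [::]) ?subr0.
Qed.

Lemma lie_inX a : lie (map inX a) = 0.
Proof.
case: a => [|t a]; last by apply: (lie_null (N := 0)); rewrite ?nvl_inX //; exact: noV_hasnull (nvl_inX (t :: a)).
rewrite /lie /delta /ins /= /inV.
by have [h _] := Fx_tl; rewrite (homS_nil (0 : homS V) : Fx [::] = 0) (tml0 [::]) ?oppr0.
Qed.

Definition lX (a : seq (int * CRBA V)) : CRBA V := (part lie a, part rho a).

Local Notation sgn1 a := (sg K (degt a) 1).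

Hypothesis two_neq0 : (2%:R : K) != 0.

Definition lpart w : homS V := part lie (fsts w).
Definition rpart w : homS V := part rho (fsts w).

(** Two Lie labels of shifted degrees [df - 1] and [dg - 1] produce a map of degree [df + dg],
    whence the 2. In the shifted space its degree is one lower, so [lX] still has degree 1. *)
Lemma lie_part_homog a : homS_homog (degt a + 2) (part lie a).
Proof. by apply: part_homog; [exact: lie_tl | exact: lie_swap | exact: lie_hd | exact: lie_inX]. Qed.

Lemma rho_part_homog a : homS_homog (degt a + 1) (part rho a).
Proof. by apply: part_homog; [exact: rho_tl | exact: rho_swap | exact: rho_hd | exact: rho_inX]. Qed.

Lemma lX_tl : tl lX.
Proof.
have [h1 k1] := part_linear lie_tl lie_swap lie_hd lie_inX.
have [h2 k2] := part_linear rho_tl rho_swap rho_hd rho_inX.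
split=> [u1 d a x y u2|u1 d e z u2 hz ne]; rewrite /lX.
  by rewrite h1 h2.
by rewrite (k1 _ _ e) // (k2 _ _ e).
Qed.

Lemma lX_hd a : gdeg (degt a + 1) (lX a).
Proof.
split; last exact: rho_part_homog.
by rewrite /= /shift_deg -addrA; exact: lie_part_homog.
Qed.

Definition lZ w : ZV := (lX (fsts w), 0).
Definition DD (U : lmodType K) (c : seq letter -> U) := ins lZ c.

Lemma fsts_deg w : degt (fsts w) = degt w.
Proof. exact: degw_map. Qed.

Lemma fsts_cat w w' : fsts (w ++ w') = fsts w ++ fsts w'.
Proof. exact: map_cat. Qed.

Lemma lX_0 w t w' : t.2.1 = 0 -> lX (fsts (w ++ t :: w')) = 0.
Proof. by move=> t0; rewrite fsts_cat /= t0; have [h _] := lX_tl; exact: (tml0 (fsts w) t.1 (fsts w') h). Qed.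

Lemma Fh_lZ w : Fh [:: (degt w + 1, lZ w)] = lpart w.
Proof.
rewrite /= /lpart -addrA -fsts_deg; apply: (@comp_id _ (HomSV V)); exact: lie_part_homog.
Qed.

Lemma Xh_lZ w : Xh [:: (degt w + 1, lZ w)] = rpart w.
Proof.
rewrite /= /rpart -fsts_deg; exact: (@comp_id _ (HomSV V) _ _ (rho_part_homog (fsts w))).
Qed.

Lemma unsh_single (U : lmodType K) Hh e (S : seq letter -> ZV) (phi : homS V -> U) a :
  single Hh e -> phi 0 = 0 ->
  unsht a (fun a1 a2 => phi (Hh ((degt a1 + 1, S a1) :: a2))) = phi (Hh [:: (degt a + 1, S a)]).
Proof. by case=> h _ _ p0; rewrite unsh_nilr // => t a1 b1 s; rewrite h ?p0. Qed.

(** * The Jacobi identities *)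

Section InsertionSquare.
Variables (Hh : seq letter -> homS V) (e : int).
Hypothesis hH : single Hh e.
Hypothesis hHV : forall d v, Hh [:: (d, (0, v))] = 0.
Let Dh w := Hh [:: (degt w + 1, lZ w)].

Lemma vs_lab (h : homS V) b d x b' : h (vs b ++ vs ((d, (x, 0)) :: b')) = 0.
Proof. by rewrite /= /vc comp0; apply: ml_0; exact: homS_ml. Qed.

Lemma DD_vs (h : homS V) b0 w : DD (fun b => h (vs (b0 ++ b))) w = 0.
Proof. by apply: unsh0 => a b _; rewrite vs_cat vs_lab. Qed.

Lemma DD_Hx w : DD (Hx Hh) w = unsht w (fun a b => Dh a (vs b)).
Proof.
rewrite /DD /Hx ins_unsh [X in _ + X]unsh0 ?addr0 => [|a b _]; last first.
  by rewrite [ins _ _ _](DD_vs (Hh a) [::] b) scaler0.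
apply: eq_unsh => a b _; exact: (@unsh_single _ _ e lZ (fun h : homS V => h (vs b)) a hH).
Qed.

Variable u : seq letter -> V.
Hypotheses (ut : tl u) (us : swap fst u) (uh : degree_shift 1 u).

Lemma delta_vs (h : homS V) b : delta u (fun b => h (vs b)) b = unsht b (fun b1 b2 => h (u b1 :: vs b2)).
Proof. by apply: eq_unsh => b1 b2 _; rewrite /= /vc /= comp_id //; exact: uh. Qed.

Lemma delta_Hx w : delta u (Hx Hh) w =
  unsht w (fun a b => sgn1 a *: unsht b (fun b1 b2 => Hh a (u b1 :: vs b2))).
Proof.
rewrite /delta /Hx ins_unsh unsh0 ?add0r => [|a b _].
  by apply: eq_unsh => a b _; rewrite -delta_vs.
by rewrite (@unsh_single _ _ e _ (fun h : homS V => h (vs b)) a hH) // hHV.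
Qed.

Lemma lin_cons (h : homS V) v a x y : h ((a *: x + y) :: v) = a *: h (x :: v) + h (y :: v).
Proof. exact: (homS_ml h [::]). Qed.

Lemma ins_arg S (h : homS V) b :
  unsht b (fun b1 b2 => unsht b1 (fun a1 a2 => h (u ((degt a1 + 1, S a1) :: a2) :: vs b2)))
  = unsht b (fun b1 b2 => h (ins S u b1 :: vs b2)).
Proof.
apply: eq_unsh => b1 b2 _; symmetry.
exact: (unsh_linf (phi := fun x => h (x :: vs b2)) (lin_cons h (vs b2))).
Qed.

Lemma DD_arg (h : homS V) b : DD (fun b => unsht b (fun b1 b2 => h (u b1 :: vs b2))) b
  = unsht b (fun b1 b2 => h (DD u b1 :: vs b2)).
Proof.
rewrite /DD ins_unsh ins_arg [X in _ + X]unsh0 ?addr0 // => b1 b2 _.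
rewrite [ins _ _ _](_ : _ = 0) ?scaler0 //; apply: unsh0 => c1 c2 _.
by rewrite /= /vc comp0; apply: (ml_0 (homS_ml h) [:: u b1]).
Qed.

Lemma delta_arg a b : delta u (fun b => unsht b (fun b1 b2 => Hh a (u b1 :: vs b2))) b
  = unsht b (fun b1 b2 => Hh a (delta u u b1 :: vs b2)).
Proof.
rewrite /delta ins_unsh ins_arg -[RHS]addr0; congr (_ + _).
(* In [X] both copies of [u] are arguments of the map. Exchanging the subwords costs the sign of
   |b1||c1|, exchanging the values that of (|b1| + 1)(|c1| + 1); together with the change from
   [sgn1 c1] to [sgn1 b1] this leaves -1. *)
set X := unsht b _; suff XN : X = - X.
  have : (2%:R : K) *: X = 0 by rewrite scaler_nat mulr2n {1}XN addNr.
  by move/eqP; rewrite scaler_eq0 (negbTE two_neq0) => /eqP.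
have EX : X = unsht b (fun b1 b2 => unsht b2 (fun c1 c2 => sgn1 b1 *: Hh a [:: u b1, u c1 & vs c2])).
  apply: eq_unsh => b1 b2 _; rewrite unshZ; congr (_ *: _).
  by apply: eq_unsh => c1 c2 _; rewrite /= /vc /= comp_id //; exact: uh.
rewrite {1}EX unsh_swap12 EX -unshN; apply: eq_unsh => b1 b2 _; rewrite -unshN.
apply: eq_unsh => c1 c2 _; have [_ hh _] := hH.
have := homS_hswap (hh a) (u1 := [::]) (x := (degt c1 + 1, u c1)) (y := (degt b1 + 1, u b1))
  (u2 := vt c2).
rewrite /= -vs_vt => ->; [|by []|by split; [exact: uh | split; [exact: uh|]]|exact: vt_thom].
by rewrite !scalerA -scaleNr; congr (_ *: _); sign_cases.
Qed.

Hypothesis Duu : forall w, DD u w + delta u u w = 0.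

(* With [Dh] the image of [Hh] under [D], the left hand side reduces to [Hh] applied
   to [D u + delta u u = 0]: the terms with two copies of [u] cancel because [u] is
   odd, [Hh a] is symmetric and 2 is invertible. *)
Lemma insertion_square w :
  DD (delta u (Hx Hh)) w + delta u (DD (Hx Hh)) w + delta u (delta u (Hx Hh)) w = 0.
Proof.
have e1 : DD (delta u (Hx Hh)) w =
    - unsht w (fun a b => sgn1 a *: unsht b (fun b1 b2 => Dh a (u b1 :: vs b2)))
    + unsht w (fun a b => unsht b (fun b1 b2 => Hh a (DD u b1 :: vs b2))).
  rewrite /DD (eq_ins _ _ delta_Hx) ins_unsh -unshN; congr (_ + _); apply: eq_unsh => a b _.
    rewrite unsh_nilr => [|t a1 a2 s]; last first.
      by case: hH => h _ _; rewrite unsh0 ?scaler0 // => b1 b2 _; rewrite h.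
    by rewrite -scaleNr degw1; congr (_ *: _) => /=; sign_cases.
  rewrite -DD_arg /DD -(@ins_lin lZ _ _ (fun x => sgn1 a *: x)); last first.
    by move=> c x y; rewrite scalerDr !scalerA mulrC.
  by apply: eq_ins => w'; rewrite scalerA sg_sq scale1r.
have e2 : delta u (DD (Hx Hh)) w =
    unsht w (fun a b => sgn1 a *: unsht b (fun b1 b2 => Dh a (u b1 :: vs b2))).
  rewrite /delta (eq_ins _ _ DD_Hx) ins_unsh unsh0 ?add0r => [|a b _].
    by apply: eq_unsh => a b _; rewrite -delta_vs.
  apply: unsh0 => a1 a2 _; rewrite /Dh /lZ (lX_0 [::]) // -[(0, 0)]/(0 : ZV).
  by rewrite hHV.
have e3 : delta u (delta u (Hx Hh)) w =
    unsht w (fun a b => unsht b (fun b1 b2 => Hh a (delta u u b1 :: vs b2))).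
  rewrite {1}/delta (eq_ins _ _ delta_Hx) ins_unsh unsh0 ?add0r => [|a b _].
    apply: eq_unsh => a b _; rewrite -delta_arg -(@ins_lin (inV u) _ _ (fun x => sgn1 a *: x)).
      by apply: eq_ins => w'; rewrite scalerA sg_sq scale1r.
    by move=> c x y; rewrite scalerDr !scalerA mulrC.
  apply: unsh0 => a1 a2 _; case: a2 => [|t a2]; last first.
    by case: hH => h _ _; rewrite unsh0 ?scaler0 // => b1 b2 _; rewrite h.
  by rewrite unsh0 ?scaler0 // => b1 b2 _; rewrite hHV.
rewrite e1 e2 e3 [- _ + _]addrC subrK -unshD; apply: unsh0 => a b _.
rewrite -unshD; apply: unsh0 => b1 b2 _.
have := lin_cons (Hh a) (vs b2) 1 (DD u b1) (delta u u b1).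
by rewrite !scale1r Duu => <-; exact: (ml_0 (homS_ml _) [::]).
Qed.
End InsertionSquare.

Lemma part_vs c e (a b : seq letter) : tl c -> swap fst c -> degree_shift e c ->
  (forall a, c (map inX a) = 0) ->
  part c (fsts a) (vs b) = c (map Lt a ++ map Rt b).
Proof.
move=> h1 h2 h3 h4; rewrite vs_vt (part_thom h1 h2 h3 h4); last exact: vt_thom.
rewrite inX_fsts; exact: (comp_inv b (tl_cat (map Lt a) h1)).
Qed.

(** The inserted letter carries the map [part rho] of the labels that it absorbs; its evaluation at
    the other points reassembles [rho] in the form given by [separate]. *)
Lemma DD_xi w : DD xi w = rho w.
Proof.
rewrite (DD_Hx Xh_single) (separate _ rho_tl rho_swap).
apply: eq_unsh => a b _; rewrite Xh_lZ /rpart.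
exact: part_vs rho_tl rho_swap rho_hd rho_inX.
Qed.

Lemma DD_Fx w : DD Fx w = lie w.
Proof.
rewrite (DD_Hx Fh_single) (separate _ lie_tl lie_swap).
apply: eq_unsh => a b _; rewrite Fh_lZ /lpart.
exact: part_vs lie_tl lie_swap lie_hd lie_inX.
Qed.

Lemma ins_vh S w : ins S vh w = comp (degt w + 1) ((S w).2 : V).
Proof. by rewrite /ins unsh_nilr. Qed.

Lemma ins_yR S w : ins S yR w = iota_R (ins S xi w) + smul (iota_R (comp (degt w + 1) ((S w).2 : V))).
Proof.
rewrite insD; congr (_ + _); first exact: ins_lin iota_lin.
rewrite -ins_vh; exact: ins_lin smi_lin.
Qed.

(** This is what the correction term of [rho] is made for: the [xi] part of [y] changes by
    [rho + (d xi)(U) = P]. The [s x] part changes only under [delta], because [lZ] has no point. *)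
Lemma nabla_yR w : DD yR w + delta Uy yR w = Fy w.
Proof.
have e : DD xi w + delta Uy xi w = Py w by rewrite DD_xi /rho subrK.
rewrite /DD /delta !ins_yR /= comp0 iota0 smul0 addr0 (comp_id (Uy_hd w)).
by rewrite addrA -iotaD e [RHS]VR_eta.
Qed.

Lemma Fh_V d v : Fh [:: (d, (0, v))] = 0. Proof. exact: (@comp0 _ (HomSV V)). Qed.
Lemma Xh_V d v : Xh [:: (d, (0, v))] = 0. Proof. exact: (@comp0 _ (HomSV V)). Qed.

Definition noX : pred letter := fun t => t.2.1 == 0.
Definition noV : pred letter := fun t => t.2.2 == 0.

Lemma Fh_noX a t c : noX t -> Fh (a ++ t :: c) = 0.
Proof.
move=> /eqP t0; case: a => [|t' [|t2 a]]; case: c => [|t3 c] //=.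
by rewrite t0; exact: (@comp0 _ (HomSV V)).
Qed.

Lemma Xh_noX a t c : noX t -> Xh (a ++ t :: c) = 0.
Proof.
move=> /eqP t0; case: a => [|t' [|t2 a]]; case: c => [|t3 c] //=.
by rewrite t0; exact: (@comp0 _ (HomSV V)).
Qed.

Lemma vs_noV (h : homS V) v t b : noV t -> h (v ++ vs (t :: b)) = 0.
Proof. by move=> /eqP t0; rewrite /= /vc t0 comp0 (ml_0 (homS_ml h)). Qed.

Lemma noX_inv u : all noX (map inv u).
Proof. by elim: u => //= t u ->; rewrite /noX eqxx. Qed.

Lemma noV_Lt a : all noV (map Lt a).
Proof. by elim: a => //= t u ->; rewrite /noV eqxx. Qed.

Lemma vs_inv u : thom u -> vs (map inv u) = map snd u.
Proof. by elim: u => //= t u IH [ht /IH ->]; rewrite /vc comp_id. Qed.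

Lemma spl_hd (q : pred letter) w t a b : all q w -> spl w (t :: a) b -> q t.
Proof. by move=> aw /spl_all /(_ aw) /andP[/= /andP[]]. Qed.

Lemma spl_hdr (q : pred letter) w t a b : all q w -> spl w a (t :: b) -> q t.
Proof. by move=> aw /spl_all /(_ aw) /andP[_ /= /andP[]]. Qed.

Lemma Hx_cat Hh p q : (forall a t c, noX t -> Hh (a ++ t :: c) = 0) ->
  all noV p -> all noX q -> Hx Hh (p ++ q) = Hh p (vs q).
Proof.
move=> hk hp hq; apply: unsh_cat_both => [a b t c d s|a b t d s].
  by rewrite hk //; exact: spl_hd hq s.
exact: (vs_noV _ [::] _ (spl_hdr hp s)).
Qed.

Lemma lie_comp (a : seq letter) u : thom u -> lie (map Lt a ++ map inv u) =
  - unsht a (fun a1 a2 => sgn1 a1 *: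
      unsht u (fun u1 u2 => Fh a1 (Fh a2 (map snd u1) :: map snd u2))).
Proof.
move=> hu; rewrite /lie (delta_Hx Fh_single Fh_V Fx_hd); congr (- _).
have FL p : Fh (map Lt p) = Fh p by case: p => [|t [|t' p]].
rewrite unsh_catl => [|p q t c d s]; last first.
  by rewrite unsh0 ?scaler0 // => b1 b2 _; rewrite Fh_noX //; exact: spl_hd (noX_inv u) s.
rewrite (unsh_map _ _ (deg := fst)) //; apply: eq_unsh => a1 a2 _.
rewrite (degw_map (deg := fst)) //; congr (_ *: _); rewrite FL.
rewrite unsh_catr => [|p t q c d s]; last first.
  exact: (vs_noV _ [:: _] _ (spl_hdr (noV_Lt _) s)).
rewrite (unsh_map _ _ (deg := fst)) //; apply: eq_unsh => u1 u2 s.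
have [h1 h2] := thom_spl s hu.
by rewrite /Fx (Hx_cat Fh_noX) ?noV_Lt ?noX_inv // FL !vs_inv.
Qed.

Lemma Rext_lpart (a : seq letter) u : thom u -> Rext (lpart a) u =
  - unsht a (fun a1 a2 => sgn1 a1 *:
      unsht u (fun u1 u2 => Rext (Fh a1) ((degt u1 + 1, Rext (Fh a2) u1) :: u2))).
Proof.
move=> hu; rewrite /Rext.
rewrite (eq_Rlift_thom (c' := fun v => - 1 *: unsht a (fun a1 a2 => sgn1 a1 *:
   unsht v (fun v1 v2 => iota_R (Fh a1 (Fh a2 (map snd v1) :: map snd v2)))))) //; last first.
  move=> v hv _; rewrite scaleN1r.
  rewrite (part_thom lie_tl lie_swap lie_hd lie_inX) //.
  rewrite inX_fsts lie_comp // -scaleN1r iotaZ scaleN1r; congr (- _).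
  rewrite (unsh_linf iota_lin); apply: eq_unsh => a1 a2 _.
  by rewrite iotaZ (unsh_linf iota_lin).
rewrite Rlift_Z scaleN1r; congr (- _); rewrite Rlift_unsh_out; apply: eq_unsh => a1 a2 _.
by rewrite Rlift_Z (Rext_comp _ _ (homS_ml _)).
Qed.

Lemma Rext_hom_lin h u d a (x z : VR) : multilinear h ->
  Rext h ((d, a *: x + z) :: u) = a *: Rext h ((d, x) :: u) + Rext h ((d, z) :: u).
Proof. by move=> hl; exact: (Rext_tml hl [::]). Qed.

Lemma psum_arg_lin (h : homS V) d b a (x z : VR) :
  psum fst yR (fun u => Rext h ((d, a *: x + z) :: u)) b
  = a *: psum fst yR (fun u => Rext h ((d, x) :: u)) b + psum fst yR (fun u => Rext h ((d, z) :: u)) b.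
Proof. by rewrite -psum_Z -psum_D; apply: eq_psum => u _; apply: Rext_hom_lin; exact: homS_ml. Qed.

(* [D F (y) = - F (y; F (y))]. *)
Lemma lpart_yR w :
  unsht w (fun a b => psum fst yR (Rext (lpart a)) b) =
  - unsht w (fun a b => sgn1 a *: unsht b (fun b1 b2 =>
      psum fst yR (fun u => Rext (Fh a) ((degt b1 + 1, Fy b1) :: u)) b2)).
Proof.
(* [Rext] ignores the declared degrees of its letters, so 0 can stand for the degree of the inner
   value; this makes the expression independent of the splitting. *)
have e a b : psum fst yR (Rext (lpart a)) b = - unsht a (fun a1 a2 => sgn1 a1 *:
    unsht b (fun b1 b2 => psum fst yR (fun u =>
      Rext (Fh a1) ((0, psum fst yR (Rext (Fh a2)) b1) :: u)) b2)).
  rewrite (eq_psum_thom (H' := fun u => -1 *: unsht a (fun a1 a2 => sgn1 a1 *: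
      unsht u (fun u1 u2 => Rext (Fh a1) ((0, Rext (Fh a2) u1) :: u2))))); first last.
  - by move=> u hu _; rewrite Rext_lpart // scaleN1r.
  - exact: yR_hd.
  rewrite psum_Z scaleN1r; congr (- _); rewrite psum_unsh; apply: eq_unsh => a1 a2 _.
  rewrite psum_Z; congr (_ *: _); rewrite psum_mult; apply: eq_unsh => b1 b2 _.
  by rewrite (psum_lin (phi := fun x => psum fst yR (fun u => Rext (Fh a1) ((0, x) :: u)) b2)
    (psum_arg_lin (Fh a1) 0 b2)).
under eq_unsh do rewrite e.
rewrite unshN; congr (- _); rewrite unsh_assoc; apply: eq_unsh => a b _; rewrite unshZ; congr (_ *: _).
rewrite -unsh_assoc; apply: eq_unsh => c b2 _.
rewrite (unsh_linf (phi := fun x => psum fst yR (fun u => Rext (Fh a) ((degt c + 1, x) :: u)) b2)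
  (psum_arg_lin (Fh a) _ b2)).
by [].
Qed.

Lemma ins_Fy S w : ins S Fy w =
  unsht w (fun a b => psum fst yR (Rext (Fh [:: (degt a + 1, S a)])) b)
  + unsht w (fun a b => sgn1 a *: unsht b (fun b1 b2 =>
      psum fst yR (fun u => Rext (Fh a) ((degt b1 + 1, ins S yR b1) :: u)) b2)).
Proof.
rewrite /Fy ins_unsh; congr (_ + _); apply: eq_unsh => a b _.
  apply: (@unsh_single VR _ _ S (fun h : homS V => psum fst yR (Rext h) b) a Fh_single).
  exact: (lin0 (psum_Rext_lin b)).
congr (_ *: _); apply: psum_ins => //; apply: Rext_tml; exact: homS_ml.
Qed.

(** The product rule yields [(D F)(y)] and the derivative of [F] at [y] along [nabla y], which is
    [F(y)] by [nabla_yR]; these cancel by [lpart_yR]. Under [delta] the label term is absent, as an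
    inserted point carries no map. *)
Lemma nabla_Fy w : DD Fy w + delta Uy Fy w = 0.
Proof.
rewrite /DD /delta !ins_Fy [X in _ + (X + _)]unsh0 ?add0r => [|a b _]; last first.
  by rewrite Fh_V; exact: (lin0 (psum_Rext_lin b)).
under eq_unsh do rewrite Fh_lZ.
rewrite lpart_yR -addrA -unshD addrC; apply/eqP; rewrite subr_eq0; apply/eqP.
apply: eq_unsh => a b _; rewrite -scalerDr -unshD; congr (_ *: _); apply: eq_unsh => b1 b2 _.
rewrite -nabla_yR; have := psum_arg_lin (Fh a) (degt b1 + 1) b2 1 (DD yR b1) (delta Uy yR b1).
by rewrite !scale1r => ->.
Qed.

Lemma nabla_Py w : DD Py w + delta Uy Py w = 0.
Proof.
have := congr1 (fun p : VR => p.1) (nabla_Fy w).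
by rewrite /DD /delta /= -!(ins_lin _ (phi := fun p : VR => p.1)).
Qed.

Lemma nabla_Uy w : DD Uy w + delta Uy Uy w = 0.
Proof.
have := congr1 (fun p : VR => p.2) (nabla_Fy w).
by rewrite /DD /delta /= -!(ins_lin _ (phi := fun p : VR => p.2)).
Qed.

(** Substituting [Py = D xi + delta Uy xi] into [nabla Py = 0] turns [D Py] into the last two terms
    of [insertion_square], whose hypothesis is [nabla Uy = 0]. *)
Lemma DD_rho w : DD rho w = 0.
Proof.
have C := insertion_square Xh_single Xh_V Uy_hd nabla_Uy w.
have e1 : DD rho w = DD Py w - DD (delta Uy xi) w by rewrite /DD insD insN.
have e2 : delta Uy Py w = delta Uy (DD xi) w + delta Uy (delta Uy xi) w.
  by rewrite /delta -insD; apply: eq_ins => w'; rewrite DD_xi /rho subrK.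
have := nabla_Py w; rewrite e1 e2 => P.
apply/eqP; rewrite subr_eq0; apply/eqP.
have {P} := etrans P (esym C); rewrite -addrA => /addIr.
exact.
Qed.

(** The same square along the field [Fx] itself: its hypothesis [D Fx + delta Fx Fx = 0] is the
    definition of [lie], and its last two terms cancel for the same reason. *)
Lemma DD_lie w : DD lie w = 0.
Proof.
have D0 w' : DD Fx w' + delta Fx Fx w' = 0 by rewrite DD_Fx /lie addNr.
have C := insertion_square Fh_single Fh_V Fx_hd D0 w.
have e1 : DD lie w = - DD (delta Fx Fx) w by rewrite /DD insN.
have e2 : delta Fx (DD Fx) w = - delta Fx (delta Fx Fx) w.
  by rewrite /delta -insN; apply: eq_ins => w'; rewrite DD_Fx.
by move: C; rewrite e1 e2 subrK => ->; rewrite oppr0.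
Qed.

(** * The bracket on vectors and the axioms *)

Definition lrba (xs : seq (CRBA V)) : CRBA V := expand lX xs.

Lemma lrba_homog ds xs : homog ds xs -> lrba xs = lX (zip ds xs).
Proof. by move=> h; apply: expand_homog => //; exact: lX_tl. Qed.

Lemma lrba_thom a : thom a -> lrba (map snd a) = lX a.
Proof. by move=> h; rewrite (lrba_homog (thom_homog h)) zip_fst_snd. Qed.

Lemma lrba_ml : multilinear lrba.
Proof. by move=> s1 s2 a x y; apply: expand_ml; exact: lX_tl. Qed.

Lemma lrba_degree : has_degree 1 lrba.
Proof.
move=> ds v _ hv; rewrite (lrba_homog hv) -(degt_zip (v := v)); last by case: hv.
exact: lX_hd.
Qed.

Lemma part_swap (c : seq letter -> V) (e : int) : tl c -> swap fst c -> degree_shift e c ->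
  (forall a, c (map inX a) = 0) -> swap fst (part c).
Proof.
move=> h1 h2 h3 h4 w1 t t' w2; apply/val_inj/funext => v.
rewrite -[LHS]/(part c _ v) -[RHS]/(_ *: part c _ v) !(partE h1 h2 h3 h4) -expand_Z.
by apply: eq_expand => u; rewrite !map_cat -!catA /= h2.
Qed.

Lemma lX_swap : swap fst lX.
Proof.
move=> w1 t t' w2; rewrite /lX.
rewrite (part_swap lie_tl lie_swap lie_hd lie_inX).
by rewrite (part_swap rho_tl rho_swap rho_hd rho_inX).
Qed.

Lemma lrba_gsym : gsymmetric lrba.
Proof.
move=> ds v sigma hv; rewrite (lrba_homog (homog_permute sigma hv)) (lrba_homog hv).
by apply: swap_gsym; [exact: lX_swap | case: hv].
Qed.

Lemma Fy_noX w : all noX w -> Fy w = 0.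
Proof.
move=> hw; apply: unsh0 => a b s.
have -> : Fh a = 0.
  case: a s => [//|t a] s; apply: (Fh_noX [::]); exact: spl_hd hw s.
exact: (lin0 (psum_Rext_lin b)).
Qed.

Lemma Fx_noX w : all noX w -> Fx w = 0.
Proof.
move=> hw; apply: unsh0 => a b s.
have -> : Fh a = 0; last exact: homS0.
by case: a s => [//|t a] s; apply: (Fh_noX [::]); exact: spl_hd hw s.
Qed.

Lemma part_eq0 (c : seq letter -> V) (e : int) a : tl c -> swap fst c -> degree_shift e c ->
  (forall a, c (map inX a) = 0) -> (forall u, c (map inX a ++ map inv u) = 0) -> part c a = 0.
Proof.
move=> h1 h2 h3 h4 h; apply/val_inj/funext => v.
rewrite -[LHS]/(part c _ v) (partE h1 h2 h3 h4) -[RHS]/(0 : V).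
by apply: expand_eq0 => ds _; exact: h.
Qed.

Lemma lie_part0 a : (forall u, lie (map inX a ++ map inv u) = 0) -> part lie a = 0.
Proof. exact: part_eq0 lie_tl lie_swap lie_hd lie_inX. Qed.

Lemma rho_part0 a : (forall u, rho (map inX a ++ map inv u) = 0) -> part rho a = 0.
Proof.
exact: part_eq0 rho_tl rho_swap rho_hd rho_inX.
Qed.

Lemma ins0_arg (c : seq letter -> V) d (b : seq letter) : tl c -> c ((d, (0, 0)) :: b) = 0.
Proof. by case=> h _; exact: (tml0 [::] d b h). Qed.

Lemma lX_nil : lX [::] = 0.
Proof.
rewrite /lX lie_part0 ?rho_part0 // => u.
  rewrite /= /rho /Py Fy_noX ?noX_inv // sub0r; apply/eqP; rewrite oppr_eq0; apply/eqP.
  apply: unsh0 => a b s; rewrite /inV /Uy Fy_noX; first exact: (ins0_arg _ _ xi_tl).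
  by have /andP[] := spl_all s (noX_inv u).
rewrite /= /lie; apply/eqP; rewrite oppr_eq0; apply/eqP.
apply: unsh0 => a b s; rewrite /inV (Fx_noX (w := a)); first exact: (ins0_arg _ _ Fx_tl).
by have /andP[] := spl_all s (noX_inv u).
Qed.

Lemma fsts_inX a : fsts (map inX a) = a.
Proof. by rewrite /fsts -map_comp -[RHS]map_id; apply: eq_map => -[]. Qed.

(** At labels followed by points [DD c] inserts only brackets of labels, because [lX] vanishes as
    soon as one of its letters is a mere point. So the Jacobi sum, evaluated on V, is an expansion
    of [DD c]. *)
Lemma part_jacobi (c : seq letter -> V) (e : int) (w0 : seq (int * CRBA V)) : tl c -> swap fst c -> degree_shift e c ->
  (forall a, c (map inX a) = 0) -> (forall w, DD c w = 0) ->
  unsht w0 (fun a b => part c ((degt a + 1, lX a) :: b)) = 0.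
Proof.
move=> h1 h2 h3 h4 h; apply/val_inj/funext => v.
rewrite -[LHS]/((fun f : homS V => f v) _) -[RHS]/(0 : V).
rewrite (unsh_linf (phi := fun f : homS V => f v)) //.
transitivity (expand (fun u => DD c (map inX w0 ++ map inv u)) v); last first.
  by apply: expand_eq0 => ds _; exact: h.
pose G a b u := c ((degt a + 1, lZ (map inX a)) :: map inX b ++ map inv u).
transitivity (unsht w0 (fun a b => expand (G a b) v)).
  apply: eq_unsh => a b _; rewrite (partE h1 h2 h3 h4); apply: eq_expand => u.
  by rewrite /G /lZ fsts_inX.
have PS (w1 : seq (int * CRBA V)) (G' : seq (int * CRBA V) -> seq (int * CRBA V) -> seq (int * V) -> V) :
    unsht w1 (fun a b => expand (G' a b) v) = expand (fun u => unsht w1 (fun a b => G' a b u)) v.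
  elim: w1 G' => [//|t w1 IH] G' /=; rewrite expand_D -!IH; congr (_ + _).
  by apply: eq_unsh => a b _; rewrite expand_Z.
rewrite PS; apply: eq_expand => u; rewrite /DD /ins unsh_catl => [|a b t c' d s].
  rewrite (unsh_map _ _ (deg := fst)) //; apply: eq_unsh => a b _.
  by rewrite /G (degw_map (deg := fst)).
rewrite /lZ (lX_0 _ _ (t := t)); first exact: ins0_arg.
by have := spl_hd (noX_inv u) s => /eqP.
Qed.

Lemma lrba_jacobi ds x : (0 < size x)%N -> homog ds x ->
  \sum_(1 <= i < (size x).+1)
    \sum_(sigma : 'S_(size x) | shuffle [:: i; (size x - i)%N] sigma)
      koszul K ds sigma *:
        lrba (lrba (take i (permute sigma x)) :: drop i (permute sigma x)) = 0.
Proof.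
move=> x0 hx; pose w := zip ds x; have hw : thom w := homog_thom hx.
have [sz _] := hx; have sw : size w = size x by rewrite size_zip sz minnn.
pose Phi i (s : seq (int * CRBA V)) := lrba (lrba (take i (map snd s)) :: drop i (map snd s)).
transitivity (\sum_(1 <= i < (size x).+1) shs fst [:: i; (size x - i)%N] w (Phi i)).
  apply: eq_bigr => i _; rewrite -(shuffle_sum fst (0, 0) _ _ sw).
  apply: eq_bigr => sigma _; rewrite -/(unzip1 w) unzip1_zip ?sz //; congr (_ *: _).
  rewrite /Phi (_ : permute sigma x = map snd [seq nth (0, 0) w (sigma i) | i : 'I__]) //.
  rewrite /permute /image_mem -map_comp; apply: eq_map => j /=.
  by rewrite nth_zip.
under eq_bigr do rewrite shs2.
rewrite unsh_sum.
transitivity (unsht w (fun a b => lX ((degt a + 1, lX a) :: b))).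
  apply: eq_unsh => a b s; have [ha hb] := thom_spl s hw.
  rewrite (eq_bigr (fun i => if i == size a then Phi i (a ++ b) else 0)); last first.
    move=> i _; rewrite [size a == i]eq_sym; case: eqP => //= ->.
    by rewrite -sw (spl_size s) addKn eqxx.
  rewrite -big_mkcond big_nat1_eq /= ltnS -sw (spl_size s) leq_addr andbT.
  (* The splitting with [a] empty corresponds to no index [i >= 1]; it contributes nothing because
     [lX [::] = 0]. *)
  case: a s ha => [|t a] s ha; first by rewrite lX_nil (tml0 [::]) //; case: lX_tl.
  rewrite /Phi map_cat take_size_cat ?size_map // drop_size_cat ?size_map //.
  rewrite lrba_thom // -[lX _ :: _]/(map snd ((degt (t :: a) + 1, lX (t :: a)) :: b)).
  by rewrite lrba_thom //; split=> //; exact: lX_hd.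
rewrite [unsht _ _]surjective_pairing -[0]/((0, 0) : CRBA V); congr pair.
  rewrite (unsh_linf (phi := fun p : CRBA V => p.1)) //=.
  apply: part_jacobi lie_tl lie_swap lie_hd lie_inX _.
  exact: DD_lie.
rewrite (unsh_linf (phi := fun p : CRBA V => p.2)) //=.
apply: part_jacobi rho_tl rho_swap rho_hd rho_inX _.
exact: DD_rho.
Qed.

Lemma lrba_Linfty : is_Linfty1 lrba.
Proof.
split; [exact: lrba_ml | exact: lrba_degree | exact: lrba_gsym | exact: lrba_jacobi].
Qed.

Definition nullX N (x : CRBA V) : Prop := null N x.1 /\ null N x.2.

Lemma lrba_null N p z s : nullX N z -> nullX N (lrba (p ++ z :: s)).
Proof.
move=> [n1 n2].
have H (c : seq letter -> V) (e : int) v : tl c -> swap fst c -> degree_shift e c ->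
    (forall a, c (map inX a) = 0) ->
    (forall w, hasnull N w -> (count nvl w <= N)%N -> c w = 0) -> (size v <= N)%N ->
    expand (fun a => part c a v) (p ++ z :: s) = 0.
  move=> h1 h2 h3 h4 h sv; apply: expand_eq0 => ds sds; rewrite (partE h1 h2 h3 h4).
  apply: expand_eq0 => es ses; apply: h.
    suff Hn q : forall ds', size ds' = size (q ++ z :: s) ->
        hasnull N (map inX (zip ds' (q ++ z :: s)) ++ map inv (zip es v)) by exact: Hn.
    by elim: q => [|y q IH] [|d ds'] //= [e']; [left | right; exact: IH].
  rewrite count_cat nvl_inX add0n; apply: leq_trans (count_size _ _) _.
  by rewrite size_map size_zip ses minnn.
split=> v sv.
  apply: etrans (expand_lin (phi := fun f : CRBA V => (f.1 : homS V) v) (fun _ _ _ => erefl) lX _) _.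
  exact: H lie_tl lie_swap lie_hd lie_inX (@lie_null N) sv.
apply: etrans (expand_lin (phi := fun f : CRBA V => (f.2 : homS V) v) (fun _ _ _ => erefl) lX _) _.
exact: H rho_tl rho_swap rho_hd rho_inX (@rho_null N) sv.
Qed.

(** Arguments are replaced one at a time. Each replacement changes the value by [lrba] at a list
    containing [x - y], which is null up to arity [N]. *)
Lemma lrba_cont : arity_continuous lrba.
Proof.
move=> N xs ys e h.
have H p : agree_upto N (lrba (p ++ xs)) (lrba (p ++ ys)); last exact: (H [::]).
elim: xs ys e h p => [|x xs IH] [|y ys] //= [e] h p.
have h0 := h 0%N isT.
have nz : nullX N (x - y).
  split=> v sv; have [h1 h2] := h0 v sv.
    by rewrite -[LHS]/((x.1 : homS V) v - (y.1 : homS V) v); apply/eqP; rewrite subr_eq0; apply/eqP.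
  by rewrite -[LHS]/((x.2 : homS V) v - (y.2 : homS V) v); apply/eqP; rewrite subr_eq0; apply/eqP.
have := IH ys e _ (rcons p y); rewrite !cat_rcons => H v sv.
have [//|k1 k2] := H _ v sv; first by move=> j hj; exact: (h j.+1).
have [n1 n2] := lrba_null p xs nz.
have ex : lrba (p ++ x :: xs) = lrba (p ++ (x - y) :: xs) + lrba (p ++ y :: xs).
  by rewrite -[lrba (p ++ (x - y) :: xs)]scale1r -lrba_ml scale1r subrK.
rewrite -k1 -k2 ex; split.
  by rewrite -[LHS]/((lrba (p ++ (x - y) :: xs)).1 v + (lrba (p ++ y :: xs)).1 v) n1 // add0r.
by rewrite -[LHS]/((lrba (p ++ (x - y) :: xs)).2 v + (lrba (p ++ y :: xs)).2 v) n2 // add0r.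
Qed.

Lemma homS_eqh (h h' : homS V) :
  (forall u, thom u -> h (map snd u) = h' (map snd u)) -> h = h'.
Proof.
move=> e; apply/val_inj/funext => v.
have F0 : (h - h' : homS V) = 0 :> (seq V -> V).
  apply: multilinear_homog0; [exact: homS_nil | exact: homS_ml |] => ds v' _ hv.
  have := e _ (homog_thom hv); rewrite -/(unzip2 _) unzip2_zip; last by case: hv => ->.
  by move=> e'; apply/eqP; rewrite -[X in X == _]/(h v' - h' v') subr_eq0 e'.
have := congr1 (fun f => f v) F0; rewrite -[X in X = _ -> _]/(h v - h' v) => /eqP.
by rewrite subr_eq0 => /eqP.
Qed.

(** * The components of the structure *)

Definition noF : pred letter := fun t => t.2.1.1 == 0.
(** Pure Lie labels, and [isR] the pure Rota-Baxter ones, zero letters included. Such a letter can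
    contribute only through its map, so counting these letters detects the vanishing components. *)
Definition isF : pred letter := fun t => (t.2.1.2 == 0) && (t.2.2 == 0).
Definition isR : pred letter := fun t => (t.2.1.1 == 0) && (t.2.2 == 0).

Lemma Fh_noF a t c : noF t -> Fh (a ++ t :: c) = 0.
Proof.
move=> /eqP t0; case: a => [|t' [|t2 a]]; case: c => [|t3 c] //=.
by rewrite t0; exact: (@comp0 _ (HomSV V)).
Qed.

Lemma Fh_all_noF a : all noF a -> Fh a = 0.
Proof. by case: a => // t a /andP[ht _]; exact: (Fh_noF [::]). Qed.

Lemma has_notall_nvl (q : pred letter) w : (forall t, q t -> noV t) -> has q w ->
  ~~ all nvl w.
Proof.
move=> h /hasP[t tw qt]; apply/allPn; exists t => //; rewrite /nvl negbK; exact: h.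
Qed.

Lemma has_spl (q : pred letter) w a b : spl w a b -> has q w -> has q a \/ has q b.
Proof. by move=> s; rewrite !has_count (spl_count q s) addn_gt0 => /orP. Qed.

Lemma Hx_kill Hh e (q : pred letter) w : single Hh e -> (forall t, q t -> noV t) ->
  (forall t, q t -> Hh [:: t] = 0) -> has q w -> Hx Hh w = 0.
Proof.
move=> [hs _ _] qv qh hw; apply: unsh0 => a b s.
case: (has_spl s hw) => [ha|hb]; last by rewrite (vs_nv _ (has_notall_nvl qv hb)).
case: a s ha => [|t [|t' a]] //= s; last by rewrite hs.
by rewrite orbF => /qh ->.
Qed.

Lemma Hx_two Hh e w : single Hh e -> (1 < count noV w)%N -> Hx Hh w = 0.
Proof.
move=> [hs _ _] hw; apply: unsh0 => a b s; case: a s => [|t [|t' a]] s; [by rewrite hs | | by rewrite hs].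
rewrite (@vs_nv (Hh [:: t])) //; apply: (@has_notall_nvl noV) => //.
rewrite has_count; move: hw; rewrite (spl_count noV s) /= addn0.
by case: (noV t); case: (count noV b).
Qed.

Lemma xi_isF w : has isF w -> xi w = 0.
Proof.
apply: (Hx_kill Xh_single) => t /andP[/eqP h1 h2] //.
by rewrite /= h1; exact: (@comp0 _ (HomSV V)).
Qed.

Lemma Fx_isR w : has isR w -> Fx w = 0.
Proof.
apply: (Hx_kill Fh_single) => t /andP[/eqP h1 h2] //.
by rewrite /= h1; exact: (@comp0 _ (HomSV V)).
Qed.

Lemma vh_noV w : has noV w -> vh w = 0.
Proof. by case: w => [|t [|t' w]] //=; rewrite orbF => /eqP h; rewrite /vc h comp0. Qed.

Lemma yR_isF w : has isF w -> yR w = 0.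
Proof.
move=> hw; rewrite /yR (xi_isF hw) vh_noV ?iota0 ?smul0 ?addr0 //.
by apply: sub_has hw => t /andP[].
Qed.

Lemma yR_two w : (1 < count noV w)%N -> yR w = 0.
Proof.
move=> hw; rewrite /yR /xi (Hx_two Xh_single hw) vh_noV ?iota0 ?smul0 ?addr0 //.
by rewrite has_count; exact: ltnW.
Qed.

Lemma psum_isF (h : homS V) b : has isF b -> psum fst yR (Rext h) b = 0.
Proof.
move: {h} (Rext h) (Rext_tml (homS_ml h)) => H hH.
have [n] := ubnP (size b); elim: n b H hH => // n IH [|t b] H hH hn hb //.
rewrite psum_cons; apply: unsh0 => a b' s.
have [ha|hb'] := has_spl (spll t s) hb.
  rewrite (yR_isF ha) -[RHS](psum_0 fst VR yR b'); apply: eq_psum => u _.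
  exact: (tml0 [::]).
by apply: (IH b') => //; [exact: tml_cons | exact: spl_ltr s hn].
Qed.

Lemma Fy_isF2 w : (1 < count isF w)%N -> Fy w = 0.
Proof.
move=> hw; apply: unsh0 => a b s; have [hs _ _] := Fh_single.
have z := lin0 (psum_Rext_lin b).
case: a s => [|t [|t' a]] s; [by rewrite hs | | by rewrite hs].
apply: psum_isF; rewrite has_count; move: hw; rewrite (spl_count isF s) /= addn0.
by case: (isF t); case: (count isF b).
Qed.

Lemma Fy_noF w : all noF w -> Fy w = 0.
Proof.
move=> hw; apply: unsh0 => a b s; have /andP[ha _] := spl_all s hw.
by rewrite Fh_all_noF //; exact: (lin0 (psum_Rext_lin b)).
Qed.

(** Each term of [Fy] uses one Lie map, and a pure Lie letter inside a block kills the block. In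
    [delta Uy xi] all such letters must fall to [Uy], since [xi] vanishes on them. *)
Lemma rho_isF2 w : (1 < count isF w)%N -> rho w = 0.
Proof.
move=> hw; rewrite /rho /Py (Fy_isF2 hw) sub0r; apply/eqP; rewrite oppr_eq0; apply/eqP.
apply: unsh0 => a b s; have [hb|hb] := boolP (has isF b).
  by apply: xi_isF => /=; rewrite hb orbT.
rewrite /inV /Uy Fy_isF2; first exact: (ins0_arg _ _ xi_tl).
by move: hw; rewrite (spl_count isF s); move: hb; rewrite has_count -leqNgt leqn0 => /eqP->; rewrite addn0.
Qed.

Lemma rho_noF w : all noF w -> rho w = 0.
Proof.
move=> hw; rewrite /rho /Py (Fy_noF hw) sub0r; apply/eqP; rewrite oppr_eq0; apply/eqP.
apply: unsh0 => a b s; have /andP[ha _] := spl_all s hw.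
by rewrite /inV /Uy Fy_noF //; exact: (ins0_arg _ _ xi_tl).
Qed.

Lemma lie_isR w : has isR w -> lie w = 0.
Proof.
move=> hw; apply/eqP; rewrite oppr_eq0; apply/eqP; apply: unsh0 => a b s.
have [ha|hb] := has_spl s hw; last by apply: Fx_isR => /=; rewrite hb orbT.
by rewrite /inV (Fx_isR ha); exact: (ins0_arg _ _ Fx_tl).
Qed.

Lemma lie_three w : (2 < count noV w)%N -> lie w = 0.
Proof.
move=> hw; apply/eqP; rewrite oppr_eq0; apply/eqP; apply: unsh0 => a b s.
have [ha|ha] := ltnP 1 (count noV a).
  by rewrite /inV (Hx_two Fh_single ha : Fx a = 0); exact: (ins0_arg _ _ Fx_tl).
apply: (Hx_two Fh_single) => /=; apply: leq_trans (leq_addl _ _).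
move: hw; rewrite (spl_count noV s) => hw; rewrite ltnNge; apply/negP => hb.
by have := leq_trans hw (leq_add ha hb).
Qed.

Lemma lie_one w : (count (predC noX) w <= 1)%N -> lie w = 0.
Proof.
move=> hw; apply/eqP; rewrite oppr_eq0; apply/eqP; apply: unsh0 => a b s.
have [ha|ha] := boolP (all noX a).
  by rewrite /inV (Fx_noX ha); exact: (ins0_arg _ _ Fx_tl).
apply: Fx_noX => /=; rewrite {1}/noX eqxx /= -[all _ b]negbK -has_predC has_count.
move: hw ha; rewrite (spl_count _ s) -has_predC has_count => hw ha.
by rewrite -leqNgt -(leq_add2l 1); apply: leq_trans hw; rewrite leq_add2r.
Qed.

Definition rb (x : int * HomSV V) : letter := inX (x.1, of_RB x.2).

Lemma Fy_lie t w : all noF w -> Fy (t :: w) = psum fst yR (Rext (Fh [:: t])) w.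
Proof.
move=> hw; have z b := lin0 (psum_Rext_lin b); have [hs _ _] := Fh_single.
rewrite /Fy /= [X in _ + X]unsh0 ?addr0 => [|a b s]; last first.
  by have /andP[ha _] := spl_all s hw; rewrite Fh_all_noF // z scaler0.
rewrite (@unsh_nill _ _ _ _ _ (fun a b => psum fst yR (Rext (Fh (t :: a))) b)) //.
Qed.

(** For [k = 0] this is [s^0 = 1], which forces the value -1 of [A] at -1. Multiplying by [s] turns
    the coefficients (-A_(k-1), B_k) into (-lam B_k, mu B_k - A_(k-1)), and the second entry is the
    recursion of [B]. *)
Lemma smul_iter k (x : V) :
  iter k smul (iota_R x) = (- (Acoef mu lam (k%:Z - 1) *: x), Bcoef mu lam k *: x).
Proof.
elim: k => [|k IH]; first by rewrite /= scaleN1r opprK scale0r.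
rewrite iterS IH /smul /=; congr pair.
  by rewrite subn1 /= scalerA.
rewrite -scaleNr scalerA -scalerDl; congr (_ *: _); case: k {IH} => [|k].
  by rewrite /= opprK mulr0 addr0.
by rewrite -[k.+1]addn1 PoszD addrK addn1 /= addrC.
Qed.

Lemma psum_zero_arg (h : seq V -> V) d b : multilinear h ->
  psum fst yR (fun u => Rext h ((d, 0) :: u)) b = 0.
Proof.
move=> hl; rewrite -[RHS](psum_0 fst VR yR b); apply: eq_psum => u _.
by apply: (tml0 [::]); exact: Rext_tml.
Qed.

Lemma xi_noX w : all noX w -> xi w = 0.
Proof.
move=> hw; apply: unsh0 => a b s; case: a s => [|t a] s; first exact: homS0.
by rewrite (@Xh_noX [::]) ?homS0 //; exact: spl_hd hw s.
Qed.

(** On points alone [xi] vanishes and [vh] accepts only words of length one; only the partition into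
    singletons survives, and each argument contributes a factor [s]. *)
Lemma psum_vec (h : seq V -> V) u : multilinear h -> thom u ->
  psum fst yR (Rext h) (map inv u) = iter (size u) smul (iota_R (h (map snd u))).
Proof.
elim: u h => [|x u IH] h hl /=; first by rewrite psum_nil /Rext.
case=> hx hu; have hl' v : multilinear (fun u => h (v :: u)) by move=> s1; exact: (hl (v :: s1)).
rewrite psum_cons unsh_nill => [|t a b s]; last first.
  have -> : yR (inv x :: t :: a) = 0; last exact: psum_zero_arg.
  have /andP[ha _] := spl_all s (noX_inv u).
  by rewrite /yR xi_noX ?iota0 ?smul0 ?addr0 //= /noX eqxx.
have -> : yR [:: inv x] = smul (iota_R x.2).
  rewrite /yR xi_noX /= ?/noX ?eqxx // iota0 add0r /vc /= comp_id //.
under eq_psum do rewrite Rext_smiota //.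
by rewrite -(psum_lin smul_lin) IH.
Qed.

(* The insertion of the maps [xs] into the first arguments of [h], the remaining
   ones being multiplied by the generator of the quadratic extension. *)
Fixpoint tree (xs : seq (int * HomSV V)) (h : seq V -> V) (u : seq (int * V)) : VR :=
  if xs is x :: xs' then
    unsht u (fun a b => sg K (degt xs') (degt a) *:
             tree xs' (fun v => h ((x.2 : homS V) (map snd a) :: v)) b)
  else iter (size u) smul (iota_R (h (map snd u))).

Lemma yR_rb x u : gdeg x.1 x.2 -> thom u ->
  yR (rb x :: map inv u) = iota_R ((x.2 : homS V) (map snd u)).
Proof.
move=> hx hu; rewrite /yR vh_noV; last by rewrite /= /noV eqxx.
rewrite iota0 smul0 addr0; congr iota_R.
rewrite /xi -[rb x :: _]/([:: rb x] ++ _) (Hx_cat Xh_noX) ?noX_inv //; last first.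
  by rewrite /= /noV eqxx.
by rewrite vs_inv // /= comp_id.
Qed.

(** A block holds at most one label, as [yR] vanishes on two, and with the labels in front it starts
    with that label. The points of the block are the arguments of its map; the points left over are
    singletons, each with a factor [s]. *)
Lemma psum_tree xs (h : seq V -> V) u : thom xs -> multilinear h -> thom u ->
  psum fst yR (Rext h) (map rb xs ++ map inv u) = tree xs h u.
Proof.
elim: xs h u => [|x xs IH] h u /=; first by move=> _; exact: psum_vec.
case=> hx hxs hl hu.
have hl' v : multilinear (fun u => h (v :: u)) by move=> s1; exact: (hl (v :: s1)).
rewrite psum_cons unsh_cat_skip => [|t a b c d s]; last first.
  rewrite yR_two; first exact: psum_zero_arg.
  rewrite /= {1}/noV eqxx (_ : noV t) //.
  apply: spl_hd s; by elim: (xs) => //= y ys ->; rewrite /noV eqxx.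
rewrite (unsh_map _ _ (deg := fst)) //; apply: eq_unsh => a b s.
have [ha hb] := thom_spl s hu.
rewrite !(degw_map (deg := fst)) //; congr (_ *: _).
rewrite yR_rb //; under eq_psum do rewrite Rext_iota //.
exact: IH.
Qed.

Lemma tree_zero xs h u : (forall v, (size xs <= size v)%N -> h v = 0) -> tree xs h u = 0.
Proof.
elim: xs h u => [|x xs IH] h u e /=.
  by rewrite e //; elim: (size u) => //= n ->; rewrite smul0.
by apply: unsh0 => a b _; rewrite IH ?scaler0 // => v sv; exact: e.
Qed.

Lemma tree_zero0 xs h u : (forall v, h v = 0) -> tree xs h u = 0.
Proof. by move=> e; apply: tree_zero => v _; exact: e. Qed.

Fixpoint arities (bs : seq nat) (xs : seq (int * HomSV V)) : Prop :=
  match bs, xs with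
  | [::], [::] => True
  | b :: bs', x :: xs' => arity b x.2 /\ arities bs' xs'
  | _, _ => False
  end.

(** The sign at each stage moves the later maps across the arguments of the current one, which is
    the recursion of [tensor_sign]. The arities fix the block sizes and leave [r] factors [s]. *)
Lemma tree_shs bs xs h r u : multilinear h -> arities bs xs ->
  (forall v, size v <> (size xs + r)%N -> h v = 0) ->
  tree xs h u = shs fst (rcons bs r) u (fun s =>
    tensor_sign K (map fst xs) bs (map fst s) *:
      iter r smul (iota_R (h (tensor_eval (map snd xs) bs (map snd s))))).
Proof.
elim: xs bs h u => [|x xs IH] [|b bs] h u hl //.
  move=> _ hs; rewrite [rcons _ _]/= shs1; case: eqP => [<-|su].
    by rewrite [tensor_sign _ _ _ _]/= scale1r.
  by rewrite /= hs ?size_map //; elim: (size u) => //= n ->; rewrite smul0.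
rewrite /= => -[ax axs] hs; apply: eq_unsh => a c _; case: eqP => [sa|sa]; last first.
  rewrite tree_zero0 ?scaler0 // => v; rewrite ax ?size_map //.
  exact: (ml_0 hl [::]).
rewrite (IH bs) //.
- rewrite -shs_Z; apply: eq_shs => s; rewrite !scalerA map_cat map_cat.
  rewrite !take_size_cat ?size_map // !drop_size_cat ?size_map //.
  by congr (_ * _ *: _); rewrite /degw /sg big_map [in RHS]big_map.
- by move=> s1; exact: (hl (_ :: s1)).
by move=> v sv; apply: hs => /= -[].
Qed.

Definition sf (df : int) (f : homS V) : letter := inX (df - 1, of_sLie f).

Lemma Fh_sf df f : homS_deg df f -> Fh [:: sf df f] = f.
Proof. by move=> hf; rewrite /= subrK; exact: (@comp_id _ (HomSV V)). Qed.

Lemma noF_rb xs u : all noF (map rb xs ++ map inv u).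
Proof.
rewrite all_cat; apply/andP; split; first by elim: xs => //= x xs ->; rewrite /noF eqxx.
by elim: u => //= x u ->; rewrite /noF eqxx.
Qed.

Lemma noV_rb xs : all noV (map rb xs).
Proof. by elim: xs => //= x xs ->; rewrite /noV eqxx. Qed.

Lemma Fy_tree df (f : homS V) xs u : homS_deg df f -> thom xs -> thom u ->
  Fy (sf df f :: map rb xs ++ map inv u) = tree xs f u.
Proof.
move=> hf hxs hu; rewrite Fy_lie ?noF_rb // Fh_sf // psum_tree //; exact: homS_ml.
Qed.

Lemma thom_omit k (xs : seq (int * HomSV V)) : thom xs -> thom (omit k xs).
Proof.
elim: xs k => [|x xs IH] [|k] //= [hx hxs]; first by rewrite /omit /= drop0.
by split=> //; exact: IH.
Qed.

Lemma thom_nth k (xs : seq (int * HomSV V)) : thom xs -> (k < size xs)%N ->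
  homS_homog (nth (0, 0) xs k).1 (nth (0, 0) xs k).2.
Proof. by elim: xs k => [|x xs IH] [|k] //= [hx hxs] // hk; exact: IH. Qed.

Lemma rho_tree df (f : homS V) xs u : homS_deg df f -> thom xs -> thom u ->
  rho (sf df f :: map rb xs ++ map inv u) =
  (tree xs f u).1 - \sum_(0 <= k < size xs)
    sg K (df + degt (take k xs)) (nth (0, 0) xs k).1 *:
      unsht u (fun c d => ((nth (0, 0) xs k).2 : homS V) ((tree (omit k xs) f c).2 :: map snd d)).
Proof.
move=> hf hxs hu; rewrite /rho /Py Fy_tree //; congr (_ - _).
rewrite (delta_Hx Xh_single Xh_V Uy_hd).
rewrite -[sf df f :: _]/((sf df f :: map rb xs) ++ map inv u) unsh_catl; last first.
  move=> a b t c d s; rewrite unsh0 ?scaler0 // => b1 b2 _.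
  by rewrite Xh_noX //; exact: spl_hd (noX_inv u) s.
have [hs _ _] := Xh_single.
rewrite (unsh_extract fst (sf df f)) => [|a b sa]; last first.
  by rewrite unsh0 ?scaler0 // => b1 b2 _; rewrite hs.
rewrite [size (_ :: _)](_ : _ = (size xs).+1); last by rewrite /= size_map.
(* Position 0 extracts the Lie label, which has no Rota-Baxter component. *)
rewrite big_nat_recl // [X in X + _ = _](_ : _ = 0) ?add0r; last first.
  rewrite [X in _ *: X](_ : _ = 0) ?scaler0 //.
  by rewrite unsh0 ?scaler0 // => b1 b2 _; rewrite /= comp0.
apply: eq_big_nat => k /andP[_ hk].
rewrite [nth _ (_ :: _) _]/= (nth_map (0, 0)) // scalerA.
have hx := thom_nth hxs hk; set x := nth (0, 0) xs k in hx *.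
congr (_ *: _).
  (* The extracted map crosses the Lie label of shifted degree [df - 1]; the sign [sgn1] of
     [delta_Hx] restores the missing 1. *)
  by rewrite [take _ _]/= !degw_cons degw0 -map_take (degw_map (deg := fst)) //=; sign_cases.
have -> : omit k.+1 (sf df f :: map rb xs) = sf df f :: map rb (omit k xs).
  by rewrite -omit_map.
rewrite unsh_catr; last first.
  move=> a t b c d s; apply: (vs_noV _ [:: _]).
  apply: spl_hdr s; rewrite /= noV_rb andbT /noV eqxx //.
rewrite (unsh_map _ _ (deg := fst)) //; apply: eq_unsh => c d s.
have [hc hd] := thom_spl s hu.
rewrite vs_inv // /Uy -[_ ++ _]/(sf df f :: map rb (omit k xs) ++ map inv c).
rewrite Fy_tree //; last exact: thom_omit.
by congr (homS_val _ _); exact: (@comp_id _ (HomSV V) _ _ hx).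
Qed.

Lemma arities_omit k bs (xs : seq (int * HomSV V)) : arities bs xs -> arities (omit k bs) (omit k xs).
Proof.
elim: k bs xs => [|k IH] [|b bs] [|x xs] //= [hb h]; first by rewrite /omit /= !drop0.
by split=> //; exact: IH.
Qed.

Lemma size_omit (A : Type) k (s : seq A) : (k < size s)%N -> size (omit k s) = (size s).-1.
Proof.
by move=> hk; rewrite size_cat size_drop size_takel 1?ltnW //; lia.
Qed.

Lemma zip_data ms (es : seq int) (xis : seq (homS V)) :
  size ms = size xis -> size es = size xis ->
  (forall j, (j < size xis)%N ->
        arity (nth 0%N ms j).+1 xis`_j /\ homS_deg es`_j xis`_j) ->
  arities [seq m.+1 | m <- ms] (zip es xis) /\ thom (zip es xis : seq (int * HomSV V)).
Proof.
elim: xis ms es => [|x xis IH] [|m ms] [|e es] //= [e1] [e2] h.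
have [h1 h2] := h 0%N isT; have [|h3 h4] := IH _ _ e1 e2; first by move=> j; exact: (h j.+1).
by [].
Qed.

Section Mixed.
Variables (n : nat) (df : int) (f : homS V) (ms : seq nat) (es : seq int) (xis : seq (homS V)).
Hypotheses (af : arity n.+1 f) (hf : homS_deg df f) (r0 : (0 < size xis)%N)
  (sms : size ms = size xis) (ses : size es = size xis)
  (hx : forall j, (j < size xis)%N ->
        arity (nth 0%N ms j).+1 xis`_j /\ homS_deg es`_j xis`_j).
Variables (dv : seq int) (v : seq V).
Hypothesis hv : homog dv v.
Let u := zip dv v.
Let xs : seq (int * HomSV V) := zip es xis.
Let bs := [seq m.+1 | m <- ms].

Let fst_xs : map fst xs = es.
Proof. by rewrite -/(unzip1 _) unzip1_zip ?ses. Qed.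
Let snd_xs : map snd xs = xis.
Proof. by rewrite -/(unzip2 _) unzip2_zip ?ses. Qed.
Let size_xs : size xs = size xis.
Proof. by rewrite size_zip ses minnn. Qed.

Lemma mixed_first_tree : mixed_first mu lam n f ms es xis dv v = - (tree xs f u).1.
Proof.
have [ax _] := zip_data sms ses hx; have [sv _] := hv.
(* If the guard fails there are more maps than the [n + 1] arguments of [f], so [f] vanishes on
   every list that the tree can form. *)
rewrite /mixed_first; have [g|g] := boolP ((size xis).+1 <= n + 2)%N; last first.
  rewrite big_pred0 // tree_zero ?oppr0 // => v' sv'; apply: af => e.
  by move: sv' g; rewrite e size_xs; lia.
rewrite (@tree_shs bs xs f (n + 2 - (size xis).+1)) //; first last.
- by move=> v' sv'; apply: af => e; apply: sv'; rewrite size_xs e; lia.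
- exact: homS_ml.
rewrite (shs_lin _ (phi := fun p : VR => p.1)) //.
pose Psi (a : seq int) (b : seq V) : V :=
  (Acoef mu lam (n%:Z - ((size xis).+1)%:Z + 1) * tensor_sign K es bs a)
    *: f (tensor_eval xis bs b).
rewrite (eq_bigr (fun tau => koszul K dv tau *: Psi (permute tau dv) (permute tau v))); last first.
  by move=> tau _; rewrite /Psi scalerA mulrA.
rewrite shuffle_sum_zip // -scaleN1r -shs_Z; apply: eq_shs => s.
rewrite /Psi fst_xs snd_xs smul_iter [in RHS]/= scalerN scaleN1r opprK !scalerA mulrC.
congr (_ * Acoef _ _ _ *: _).
(* The power of [s] is [n + 2 - i], and [smul_iter] gives [A] the index one lower. *)
by rewrite -subzn // PoszD; ring.
Qed.

Lemma mixed_second_tree k : (k < size xis)%N -> mixed_second mu lam n df f ms es xis dv v k =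
  sg K (df + degt (take k xs)) (nth (0, 0) xs k).1 *:
    unsht u (fun c d => ((nth (0, 0) xs k).2 : homS V) ((tree (omit k xs) f c).2 :: map snd d)).
Proof.
move=> hk; have [ax hxs] := zip_data sms ses hx; have [sv _] := hv.
have [ak hek] := hx hk.
have ex : nth (0, 0) xs k = (es`_k, xis`_k) by rewrite nth_zip.
rewrite ex /=; set x := xis`_k in ak hek *.
have so : size (omit k xs) = (size xis).-1 by rewrite size_omit size_xs.
rewrite /mixed_second; have [g|g] := boolP ((size xis).+1 <= n + 3)%N; last first.
  rewrite big_pred0 // unsh0 ?scaler0 // => c d _; rewrite tree_zero; first exact: (ml_0 (homS_ml x) [::]).
  by move=> v'; rewrite so => sv'; apply: af; lia.
(* With [xi_k] taken out of [f], one more argument of [f] than in [mixed_first] carries a factor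
   [s]. *)
set q := (n + 3 - (size xis).+1)%N; set N := (sumn (omit k bs) + q)%N.
have eN : N = sumn (rcons (omit k bs) q) by rewrite -cats1 sumn_cat /= addn0.
pose sk := sg K (df + degt (take k xs)) es`_k.
pose Psi (a : seq int) (b : seq V) : V :=
  (sk * Bcoef mu lam q * tensor_sign K (omit k es) (omit k bs) (take N a))
    *: x (f (tensor_eval (omit k xis) (omit k bs) (take N b)) :: drop N b).
rewrite (eq_bigr (fun tau => koszul K dv tau *: Psi (permute tau dv) (permute tau v))); last first.
  move=> tau _; rewrite /Psi scalerA !mulrA; congr (_ * _ * _ * _ *: _).
  rewrite /sk /sg; congr (_ ^ ((df + _) * _)).
  by rewrite /degw -(big_map fst xpredT id) /= map_take fst_xs.
rewrite shuffle_sum_zip // -[_ ++ [:: q; _]]cat_rcons shs_cat -unshZ; apply: eq_unsh => c d _.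
have [sd|sd] := eqVneq (size d) (ms`_k); last first.
  transitivity (0 : V).
    rewrite -[RHS](shs_0 fst V (rcons (omit k bs) q) c); apply: eq_shs => s.
    by rewrite shs1 (negbTE sd).
  rewrite ak ?scaler0 // /= size_map => -[e]; move: sd; rewrite e eqxx //.
rewrite (@tree_shs (omit k bs) (omit k xs) f q); first last.
- by move=> v' sv'; apply: af => e; apply: sv'; rewrite so e /q; lia.
- exact: arities_omit.
- exact: homS_ml.
rewrite (shs_lin _ (phi := fun p : VR => x (p.2 :: map snd d))); last first.
  by move=> b y z; exact: (homS_ml x [::]).
have -> : map fst (omit k xs) = omit k es by rewrite -omit_map fst_xs.
have -> : map snd (omit k xs) = omit k xis by rewrite -omit_map snd_xs.
rewrite -shs_Z; apply: shs_size => s ss; rewrite shs1 sd eqxx /Psi !map_cat.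
rewrite !take_size_cat ?size_map ?ss ?drop_size_cat ?size_map //.
rewrite smul_iter [in RHS]/=.
have xZ a y b : x (a *: y :: b) = a *: x (y :: b).
  by have := homS_ml x [::] b a y 0; rewrite addr0 (ml_0 (homS_ml x) [::]) addr0.
rewrite xZ /= scalerA xZ !scalerA; congr (_ *: _); rewrite /sk.
  by ring.
by rewrite ss eN.
Qed.

Lemma rho_mixed : rho (sf df f :: map rb xs ++ map inv u) = mixed mu lam n df f ms es xis dv v.
Proof.
have [ax hxs] := zip_data sms ses hx.
rewrite rho_tree //; last exact: homog_thom.
rewrite /mixed mixed_first_tree opprK; congr (_ - _); rewrite /= size_xs.
by apply: eq_big_nat => k /andP[_ hk]; rewrite mixed_second_tree.
Qed.
End Mixed.

Section Bracket.
Variables (dv : seq int) (v : seq V).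
Hypothesis hv : homog dv v.
Let u := zip dv v.

Lemma nr_circ_unsh p (P : homS V) q (Q : homS V) : arity p.+1 P -> arity q.+1 Q ->
  nr_circ p P q Q dv v = unsht u (fun a b => P (Q (map snd a) :: map snd b)).
Proof.
move=> aP aQ; have [sv _] := hv.
rewrite /nr_circ (shuffle_sum_zip _ (fun _ s => P (Q (take q.+1 s) :: drop q.+1 s)) sv) shs2.
apply: eq_unsh => a b _; have [sa|sa] /= := eqVneq (size a) q.+1; last first.
  rewrite aQ ?size_map; last exact/eqP.
  by rewrite (ml_0 (homS_ml P) [::]).
have [sb|sb] := eqVneq (size b) p; last first.
  by rewrite aP //= size_map => -[e]; rewrite e eqxx in sb.
by rewrite map_cat take_size_cat ?size_map // drop_size_cat ?size_map.
Qed.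

(** Of the four splittings of the two labels, those with one label on each side survive. The sign
    [(-1)^(df - 1)] of the first and the minus in [lie] combine to [(-1)^df]; the sign of the second
    includes the exchange of the shifted labels. *)
Lemma lie_bracket n df (f : homS V) m dg (g : homS V) :
  arity n.+1 f -> homS_deg df f -> arity m.+1 g -> homS_deg dg g ->
  lie ([:: sf df f; sf dg g] ++ map inv u) = (-1) ^ df *: nr_bracket n df f m dg g dv v.
Proof.
move=> af hf ag hg.
rewrite -[[:: _; _]]/(map Lt [:: sf df f; sf dg g]) lie_comp; last exact: homog_thom.
rewrite /nr_bracket !nr_circ_unsh //.
set X := unsht u _; set Y := unsht u _.
have [hs _ _] := Fh_single.
have z a1 a2 : Fh a1 = 0 \/ Fh a2 = 0 ->
    unsht u (fun u1 u2 => Fh a1 (Fh a2 (map snd u1) :: map snd u2)) = 0.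
  case=> e; apply: unsh0 => u1 u2 _; rewrite e //.
  exact: (ml_0 (homS_ml (Fh a1)) [::]).
rewrite unsh_two (z [:: _; _]); last by left.
have -> : unsht u (fun u1 u2 => Fh [:: sf df f] (Fh [:: sf dg g] (map snd u1) :: map snd u2)) = X.
  by rewrite !Fh_sf.
have -> : unsht u (fun u1 u2 => Fh [:: sf dg g] (Fh [:: sf df f] (map snd u1) :: map snd u2)) = Y.
  by rewrite !Fh_sf.
rewrite !scaler0 add0r addr0 scalerBr !scalerA opprD -!scaleNr.
have e1 : (-1 : K) ^ df = sg K df 1 by rewrite /sg mulr1.
by congr (_ *: _ + _ *: _); rewrite ?e1 -?[(-1) ^ (df * dg)]/(sg K df dg) ?degw0 ?degw1 /=; sign_cases.
Qed.
End Bracket.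

Lemma lX_RB a v dv : homog dv v -> RB_part (lX a) v = rho (map inX a ++ map inv (zip dv v)).
Proof.
move=> hv; have [sv _] := hv.
rewrite -(part_thom rho_tl rho_swap rho_hd rho_inX); last exact: homog_thom.
by rewrite -/(unzip2 _) unzip2_zip ?sv.
Qed.

Lemma lX_Lie a v dv : homog dv v -> sLie_part (lX a) v = lie (map inX a ++ map inv (zip dv v)).
Proof.
move=> hv; have [sv _] := hv.
rewrite -(part_thom lie_tl lie_swap lie_hd lie_inX); last exact: homog_thom.
by rewrite -/(unzip2 _) unzip2_zip ?sv.
Qed.

Lemma sLie_deg df (f : homS V) : homS_deg df f -> gdeg (df - 1) (of_sLie f).
Proof.
move=> hf; split; last exact: (@gdeg0 _ (HomSV V)).
by rewrite /= /shift_deg subrK.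
Qed.

Lemma RB_deg e (x : homS V) : homS_deg e x -> gdeg e (of_RB x).
Proof. by move=> hx; split=> //; exact: (@gdeg0 _ (HomSV V)). Qed.

Lemma lrba_unary n df (f : homS V) : arity n.+1 f -> homS_deg df f ->
  lrba [:: of_sLie f] = of_RB (- Acoef mu lam n%:Z *: f).
Proof.
move=> af hf; pose a : seq (int * CRBA V) := [:: (df - 1, of_sLie f)].
have ha : thom a by split=> //; exact: sLie_deg.
rewrite -[[:: _]]/(map snd a) lrba_thom // /of_RB [lX a]surjective_pairing; congr pair.
  apply: lie_part0 => u; apply: lie_one.
  rewrite /= (_ : count _ (map inv u) = 0%N) ?addn0; first by case: (~~ _).
  by elim: u => //= x u ->; rewrite /noX eqxx.
apply: homS_eqh => u hu; rewrite -[LHS]/(RB_part (lX a) _).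
have hd := thom_homog hu; rewrite (lX_RB _ hd) zip_fst_snd.
rewrite -[map inX a ++ _]/(sf df f :: map rb [::] ++ map inv u) rho_tree //.
rewrite big_geq // subr0 /= smul_iter -[RHS]/(- Acoef mu lam n%:Z *: f (map snd u)) scaleNr /=.
have [su|su] := eqVneq (size u) n.+1; last by rewrite af ?scaler0 // size_map; exact/eqP.
(* With no Rota-Baxter label all [n + 1] arguments carry [s], so the index of [A] is [n]. *)
by rewrite su -addn1 PoszD addrK.
Qed.

Lemma lrba_RB0 zs : (forall ds u, size ds = size zs -> rho (map inX (zip ds zs) ++ map inv u) = 0) ->
  RB_part (lrba zs) = 0.
Proof.
move=> h; apply: etrans (expand_lin (phi := fun p : CRBA V => p.2) (fun _ _ _ => erefl) lX _) _.
by apply: expand_eq0 => ds sds; apply: rho_part0 => u; exact: h.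
Qed.

Lemma lrba_Lie0 zs : (forall ds u, size ds = size zs -> lie (map inX (zip ds zs) ++ map inv u) = 0) ->
  sLie_part (lrba zs) = 0.
Proof.
move=> h; apply: etrans (expand_lin (phi := fun p : CRBA V => p.1) (fun _ _ _ => erefl) lX _) _.
by apply: expand_eq0 => ds sds; apply: lie_part0 => u; exact: h.
Qed.

Lemma lrba_binary n m df dg (f g : homS V) :
  arity n.+1 f -> homS_deg df f -> arity m.+1 g -> homS_deg dg g ->
  RB_part (lrba [:: of_sLie f; of_sLie g]) = 0 /\
  forall (dv : seq int) (v : seq V), homog dv v ->
    sLie_part (lrba [:: of_sLie f; of_sLie g]) v
    = (-1) ^ df *: nr_bracket n df f m dg g dv v.
Proof.
move=> af hf ag hg; split.
  apply: lrba_RB0 => -[|d1 [|d2 [|]]] u //= _; apply: rho_isF2 => /=.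
  by rewrite /isF /= !eqxx.
move=> dv v hv; pose a : seq (int * CRBA V) := [:: (df - 1, of_sLie f); (dg - 1, of_sLie g)].
have ha : thom a by split; [exact: sLie_deg | split=> //; exact: sLie_deg].
rewrite -[[:: _; _]]/(map snd a) lrba_thom // (lX_Lie _ hv).
exact: lie_bracket.
Qed.

Lemma lrba_mixed n df (f : homS V) ms es (xis : seq (homS V)) :
  arity n.+1 f -> homS_deg df f ->
  (0 < size xis)%N -> size ms = size xis -> size es = size xis ->
  (forall j, (j < size xis)%N ->
    arity (nth 0%N ms j).+1 xis`_j /\ homS_deg es`_j xis`_j) ->
  sLie_part (lrba (of_sLie f :: [seq of_RB x | x <- xis])) = 0 /\
  forall (dv : seq int) (v : seq V), homog dv v ->
    RB_part (lrba (of_sLie f :: [seq of_RB x | x <- xis])) v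
    = mixed mu lam n df f ms es xis dv v.
Proof.
move=> af hf r0 sms ses hx; split.
  apply: lrba_Lie0 => ds u sds; apply: lie_isR; rewrite has_cat.
  case: xis r0 ds sds {sms ses hx} => // x xis _ [|d1 [|d2 ds]] //= _.
  by rewrite {2}/isR /= !eqxx orbT.
move=> dv v hv; have [_ hxs] := zip_data sms ses hx.
pose a : seq (int * CRBA V) :=
  (df - 1, of_sLie f) :: [seq (x.1, of_RB x.2) | x <- (zip es xis : seq (int * HomSV V))].
have ha : thom a.
  split; first exact: sLie_deg.
  elim: (zip es xis) hxs => //= x xs IH [h1 h2]; split; [exact: RB_deg | exact: IH].
have -> : of_sLie f :: [seq of_RB x | x <- xis] = map snd a.
  rewrite /= -map_comp; congr (_ :: _).
  by rewrite -[in LHS](unzip2_zip (s := es) (t := xis)) ?ses // -map_comp.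
rewrite lrba_thom // (lX_RB _ hv) -rho_mixed //; congr (rho _).
by rewrite /= -map_comp.
Qed.

(** Every surviving term of [rho] on pure labels has one Lie label, and every one of [lie] has two
    labels, both Lie; the hypotheses exclude exactly these counts. *)
Lemma lrba_vanish (zs : seq (homS V + homS V)) : (0 < size zs)%N ->
  count (@is_sLie K V) zs != 1%N ->
  ~~ ((size zs == 2%N) && (count (@is_sLie K V) zs == 2%N)) ->
  lrba [seq of_pure z | z <- zs] = 0.
Proof.
move=> z0 c1 c2.
have noF0 u : all noF (map inv u) by elim: u => //= x u ->; rewrite /noF eqxx.
have cF ds : size ds = size zs ->
    (count (@is_sLie K V) zs <= count isF (map inX (zip ds (map (@of_pure K V) zs))))%N.
  by elim: zs ds {z0 c1 c2} => [|[f|x] zs IH] [|d ds] //= [e];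
    rewrite ?add0n ?{1}/isF /= ?eqxx ?leq_add2l ?IH //; apply: leq_trans (IH _ e) (leq_addl _ _).
have cN ds : size ds = size zs -> count (@is_sLie K V) zs = 0%N ->
    all noF (map inX (zip ds (map (@of_pure K V) zs))).
  by elim: zs ds {z0 c1 c2 cF} => [|[f|x] zs IH] [|d ds] //= [e] h; rewrite {1}/noF /= eqxx IH.
have cR ds : size ds = size zs -> (count (@is_sLie K V) zs < size zs)%N ->
    has isR (map inX (zip ds (map (@of_pure K V) zs))).
  elim: zs ds {z0 c1 c2 cF cN} => [|[f|x] zs IH] [|d ds] //= [e] h.
    by rewrite IH ?orbT.
  by rewrite {1}/isR /= !eqxx.
have cV ds : size ds = size zs -> count noV (map inX (zip ds (map (@of_pure K V) zs))) = size zs.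
  elim: zs ds {z0 c1 c2 cF cN cR} => [|z zs IH] [|d ds] //= [e].
  by rewrite {1}/noV eqxx IH.
rewrite [lrba _]surjective_pairing -[RHS]/((0, 0) : CRBA V); congr pair.
  apply: lrba_Lie0 => ds u; rewrite size_map => sds.
  have [lt|ge] := ltnP (count (@is_sLie K V) zs) (size zs).
    by apply: lie_isR; rewrite has_cat cR.
  have ec : count (@is_sLie K V) zs = size zs.
    by apply/eqP; rewrite eqn_leq ge count_size.
  apply: lie_three; rewrite count_cat cV //; apply: leq_trans (leq_addr _ _).
  by move: c1 c2 z0; rewrite ec; case: (size zs) => [|[|[|k]]].
apply: lrba_RB0 => ds u; rewrite size_map => sds.
have [e0|ne0] := eqVneq (count (@is_sLie K V) zs) 0%N.
  by apply: rho_noF; rewrite all_cat cN ?noF0.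
apply: rho_isF2; rewrite count_cat; apply: leq_trans (leq_addr _ _).
apply: leq_trans (cF _ sds); by case: (count _ zs) c1 ne0 => [|[|k]].
Qed.

End Structure.

Theorem theorem9p3 (K : fieldType) (charK : [pchar K] =i pred0) (mu lam t : K)
    (ht : t ^+ 2 = mu ^+ 2 - 4%:R * lam) (V : gvect K) :
  exists l : seq (CRBA V) -> CRBA V,
    is_Linfty1 l /\
    arity_continuous l /\
    (forall (n : nat) (df : int) (f : homS V), arity n.+1 f -> homS_deg df f ->
      l [:: of_sLie f] = of_RB (- Acoef mu lam n%:Z *: f)) /\
    (forall (n m : nat) (df dg : int) (f g : homS V),
      arity n.+1 f -> homS_deg df f -> arity m.+1 g -> homS_deg dg g ->
      RB_part (l [:: of_sLie f; of_sLie g]) = 0 /\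
      forall (dv : seq int) (v : seq V), homog dv v ->
        sLie_part (l [:: of_sLie f; of_sLie g]) v
        = (-1) ^ df *: nr_bracket n df f m dg g dv v) /\
    (forall (n : nat) (df : int) (f : homS V)
        (ms : seq nat) (es : seq int) (xis : seq (homS V)),
      arity n.+1 f -> homS_deg df f ->
      (0 < size xis)%N -> size ms = size xis -> size es = size xis ->
      (forall j, (j < size xis)%N ->
        arity (nth 0%N ms j).+1 xis`_j /\ homS_deg es`_j xis`_j) ->
      sLie_part (l (of_sLie f :: [seq of_RB xi | xi <- xis])) = 0 /\
      forall (dv : seq int) (v : seq V), homog dv v ->
        RB_part (l (of_sLie f :: [seq of_RB xi | xi <- xis])) v
        = mixed mu lam n df f ms es xis dv v) /\
    (forall zs : seq (homS V + homS V), (0 < size zs)%N ->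
      count (@is_sLie K V) zs != 1%N ->
      ~~ ((size zs == 2%N) && (count (@is_sLie K V) zs == 2%N)) ->
      l [seq of_pure z | z <- zs] = 0).
Proof.
have two_neq0 : (2%:R : K) != 0.
  by apply/negP => /eqP e; have := charK 2; rewrite inE /= e eqxx.
exists (@lrba K mu lam V); split; first exact: lrba_Linfty.
split; first exact: lrba_cont.
split; first exact: lrba_unary.
split; first exact: lrba_binary.
by split; [exact: lrba_mixed | exact: lrba_vanish].
Qed.
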